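(* Let $\beta\in(0,1)$, $k\in\mathbb{N}$, $2\ge\alpha_1>\cdots>\alpha_k>1$ and $p_1,\dots,p_k>0$, and set $\boldsymbol{\nu}(\boldsymbol{\alpha},\mathbf{p}):=\boldsymbol{\nu}_{\alpha_1}^{\boxtimes p_1}\boxtimes\cdots\boxtimes\boldsymbol{\nu}_{\alpha_k}^{\boxtimes p_k}$. Let $\mathbf{b}_\beta$ be the positive Boolean $\beta$-stable law. Then $$\left((\mathbf{b}_\beta\boxtimes\boldsymbol{\nu}(\boldsymbol{\alpha},\mathbf{p}))^{\boxtimes t}\right)^{t^{-1/\alpha_1}}\longrightarrow\mathcal{L}\!\left(e^{p_1^{1/\alpha_1}\mathbf{F}_{\alpha_1}}\right)\quad\text{weakly as }t\downarrow0,$$ where $\mathbf{F}_{\alpha_1}$ is a random variable with the free stable law $\mathbf{f}_{\alpha_1}$ and $\mathcal{L}(X)$ denotes the law of $X$.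
   Context: For a probability measure $\mu\ne\delta_0$ on $[0,\infty)$ let $G_\mu(z)=\int\frac{\mu(dx)}{z-x}$, $F_\mu=1/G_\mu$, $\eta_\mu(z)=1-zF_\mu(1/z)$, and $\Sigma_\mu(z)=\eta_\mu^{-1}(z)/z$ for $1-1/\mu(\{0\})<z<0$ (inverse of the strictly increasing function $\eta_\mu|_{(-\infty,0)}$). The $S$-transform is determined by $\Sigma_\mu(z)=S_\mu\!\left(\frac{z}{1-z}\right)$. Multiplicative free convolution $\boxtimes$ satisfies $S_{\mu\boxtimes\nu}=S_\mu S_\nu$ near $0$ on the negative axis. If $\mu$ on $(0,\infty)$ is $\boxtimes$-infinitely divisible (has an $n$-th $\boxtimes$-convolution root for every $n$), then for $t\ge0$, $\mu^{\boxtimes t}$ is the unique probability measure on $(0,\infty)$ with $S_{\mu^{\boxtimes t}}=S_\mu^t$ on $(-1,0)$. For a measure $\nu$ on $(0,\infty)$ and $p\in\mathbb{R}$, $\nu^p$ is the push-forward of $\nu$ by $x\mapsto x^p$. For $\alpha\in(1,2]$, $\boldsymbol{\nu}_\alpha$ is the ($\boxtimes$-infinitely divisible) probability measure on $(0,\infty)$ with $S_{\boldsymbol{\nu}_\alpha}(z)=e^{(-z)^{\alpha-1}}$, $z\in(-1,0)$. For $\beta\in(0,1)$, $\mathbf{b}_\beta$ is the probability measure on $(0,\infty)$ with $F_{\mathbf{b}_\beta}(z)=z+e^{\mathrm{i}\beta\pi}z^{1-\beta}$, $\Im z>0$; it is $\boxtimes$-infinitely divisible with $\Sigma_{\mathbf{b}_\beta}(z)=(-z)^{(1-\beta)/\beta}$,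 $z<0$. For a probability measure $\mu$ on $\mathbb{R}$, the Voiculescu transform is $\varphi_\mu(z)=F_\mu^{-1}(z)-z$ on a suitable truncated cone $\{z:\Im z>0,|\Re z|<a\Im z,|z|>b\}$. For $\alpha\in(1,2]$, $\mathbf{f}_\alpha$ is the free stable law with $\varphi_{\mathbf{f}_\alpha}(z)=-(-z)^{1-\alpha}$ for $\Im z>0$ (principal branch). *)

(* Defs.v *)
From HB Require Import structures.
From mathcomp Require Export all_boot all_order all_algebra complex.
From mathcomp Require Export all_classical all_reals all_analysis
  measurable_realfun.
Export Order.TTheory GRing.Theory Num.Theory numFieldNormedType.Exports.

Set Implicit Arguments.
Unset Strict Implicit.
Unset Printing Implicit Defensive.

Local Open Scope classical_set_scope.
Local Open Scope ring_scope.
Local Open Scope complex_scope.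

Section complex_powers.
Context {R : realType}.
Implicit Types (z : R[i]) (s theta : R).

Definition cmod z : R := Num.sqrt (complex.Re z ^+ 2 + complex.Im z ^+ 2).

(* principal argument, with values in ]-pi, pi] for z != 0 *)
Definition carg z : R :=
  if 0 <= complex.Im z then acos (complex.Re z / cmod z)
  else - acos (complex.Re z / cmod z).

Definition expi theta : R[i] := cos theta +i* sin theta.

(* principal branch of z ^ s for z != 0 *)
Definition cpow z s : R[i] := (cmod z `^ s)%:C * expi (s * carg z).

End complex_powers.

Section transforms.
Context {R : realType}.
Implicit Types (mu nu : probability R R) (z : R[i]) (x y a b : R).

Definition on_pos mu := mu `]0, +oo[%classic = 1%E.

Definition cauchyG mu z : R[i] :=
  (\int[mu]_x complex.Re (z - x%:C)^-1) +i*
  (\int[mu]_x complex.Im (z - x%:C)^-1).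

Definition recF mu z : R[i] := (cauchyG mu z)^-1.

(* for mu on [0, +oo[, [1 - y F_mu(1/y)] is real when y < 0 *)
Definition eta mu y : R := complex.Re (1 - y%:C * recF mu (y^-1)%:C).

Definition eta_inv mu : R -> R := 'pinv_(fun=> 0) `]-oo, 0[%classic (eta mu).

Definition Sigma mu y : R := eta_inv mu y / y.

(* [z = w / (1 + w)] is the inverse of [w = z / (1 - z)], so that
   [Sigma mu z = Strans mu (z / (1 - z))] *)
Definition Strans mu w : R := Sigma mu (w / (1 + w)).

Definition trunc_cone a b : set R[i] :=
  [set z | [/\ 0 < complex.Im z, `|complex.Re z| < a * complex.Im z
             & b < cmod z]].

(* [phi] is the Voiculescu transform of [mu] on some truncated cone, where
   F_mu is inverted as a map defined on another truncated cone *)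
Definition has_voiculescu mu (phi : R[i] -> R[i]) :=
  exists a b a' b' : R, [/\ [/\ 0 < a, 0 < b, 0 < a' & 0 < b'],
    {in trunc_cone a' b' &, injective (recF mu)},
    trunc_cone a b `<=` recF mu @` trunc_cone a' b' &
    forall z, trunc_cone a b z ->
      'pinv_(fun=> 0) (trunc_cone a' b') (recF mu) z - z = phi z].

End transforms.

Section free_multiplicative.
Context {R : realType}.
Implicit Types mu nu rho : probability R R.

(* The S-transform determines a probability measure on ]0, +oo[, so that
   [rho] below is the only candidate for the operation described; operations
   on measures are given by their graphs. *)

(* rho = mu \boxtimes nu, for mu and nu on ]0, +oo[ *)
Definition is_mfconv mu nu rho :=
  on_pos rho /\
  \forall w \near 0^'-, Strans rho w = Strans mu w * Strans nu w.

(* rho = mu \boxtimes s_0 \boxtimes s_1 \boxtimes ... *)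
Fixpoint is_mfconv_seq mu (s : seq (probability R R)) rho : Prop :=
  if s is nu :: s' then
    exists2 sigma, is_mfconv mu nu sigma & is_mfconv_seq sigma s' rho
  else forall A, measurable A -> rho A = mu A.

Definition is_mfprod k (mu : 'I_k.+1 -> probability R R) rho :=
  is_mfconv_seq (mu ord0) [seq mu (lift ord0 i) | i <- enum 'I_k] rho.

(* rho = mu ^ (\boxtimes t); existence of [rho] for all t > 0 already forces
   infinite divisibility of [mu] (take t = 1 / n) *)
Definition is_mfpow mu (t : R) rho :=
  on_pos rho /\
  forall w : R, -1 < w < 0 -> Strans rho w = Strans mu w `^ t.

Definition is_nu_law (alpha : R) mu :=
  on_pos mu /\
  forall w : R, -1 < w < 0 -> Strans mu w = expR ((- w) `^ (alpha - 1)).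

Definition is_boolean_stable (beta : R) mu :=
  on_pos mu /\
  forall z : R[i], 0 < complex.Im z ->
    recF mu z = z + expi (beta * pi) * cpow z (1 - beta).

Definition is_free_stable (alpha : R) mu :=
  has_voiculescu mu (fun z => - cpow (- z) (1 - alpha)).

End free_multiplicative.

Section laws.
Context {R : realType}.

Definition power_map (p : R) : R -> R := fun x => x `^ p.

HB.instance Definition _ p :=
  isMeasurableFun.Build _ _ _ _ (power_map p) (measurable_powR p).

Definition pow_law (mu : probability R R) (p : R) : probability R R :=
  distribution mu (power_map p).

Definition exp_scale (c : R) : R -> R := fun x => expR (c * x).

Lemma measurable_exp_scale c : measurable_fun setT (exp_scale c).
Proof. by apply: measurableT_comp => //; apply: mulrl_measurable. Qed.

HB.instance Definition _ c :=
  isMeasurableFun.Build _ _ _ _ (exp_scale c) (measurable_exp_scale c).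

Definition weak_cvg T (mu : T -> probability R R) (F : set_system T)
    (nu : probability R R) :=
  forall f : R -> R, continuous f -> (exists M : R, forall x, `|f x| <= M) ->
    \int[mu t]_x f x @[t --> F] --> \int[nu]_x f x.

End laws.

(* Main.v *)
Require Import Defs.
From mathcomp Require Import ring lra.

(** Let [X_t] have law [rho t], and put [a_i = alpha i - 1], [t = d ^ alpha_1]
    and [L = log X_t / d]. What has to be shown is that [L] converges in law to
    [s F], where [s ^ alpha_1 = p_1].

    The S-transform of [X_t] is the power [t] of a product that is explicit near
    [0]. Writing the argument [w] as [w / (1 + w) = - exp x], the definition of
    the S-transform becomes
    [E (1 / (1 + X_t exp (Phi x))) = 1 / (1 + exp x)], where
    [Phi z = z + t (c z + \sum_i p_i (1 + exp (- z)) ^ (- a_i))] and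
    [c = 1 / beta - 1] ([Sigma_stieltjes], [Sigma_boolean], [defect_real]). This is
    known for very negative real [x] only. Both sides make sense for complex
    arguments as long as [Im (Phi z)] stays below [pi], and this is so in the
    strip [0 < Im z < pi - kappa d]. The identity extends to that strip
    ([defect_eq0]), by a uniqueness theorem for functions that vanish on a part of
    the boundary ([strip_identity]). It rests on the maximum principle alone, and
    the latter on second-order expansions, which all functions involved inherit
    from the exponential, the logarithm and the Stieltjes kernel.

    Now look at the pole of the right-hand side at scale [d]. For
    [z = i pi + d u] with [Im u < - kappa], [exp z = - exp (d u)], and
    [Phi z = i pi + d v_d] where [v_d] tends to [v = u + p_1 u ^ (- a_1)]: as
    [1 + exp (- z)] is of order [d u], the summand [i] contributes
    [t d ^ (- a_i) = d ^ (1 + alpha_1 - alpha_i)], which is of smaller order than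
    [d] unless [i = 1], and the linear term, with the Boolean factor, disappears
    ([slope_cvg]). The identity reads
    [E (1 / (1 - exp (d (v_d + L)))) = 1 / (1 - exp (d u))], and since
    [1 / (1 - exp w)] is [- 1 / w] up to a bounded term, multiplying by [d] gives
    [E (1 / (v + L)) --> 1 / u] ([resolvent_cvg]). On the other side, the
    Voiculescu transform of the free stable law says exactly that
    [E (1 / (v + s F)) = 1 / u] for the same [v] ([free_stable_resolvent]).

    So the resolvents of [L] converge to those of [s F] at a set of points without
    isolated points. By the resolvent identity, the uniformly closed span of
    the resolvents at these points and their conjugates is an algebra ([ralgM]);
    polynomial approximation shows that it contains the continuous functions of
    compact support ([ralg_compact_support]). Convergence of their means extends to
    bounded continuous functions, since no mass is lost in the limit
    ([cvg_bounded_continuous]). *)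

Set Implicit Arguments.
Unset Strict Implicit.
Unset Printing Implicit Defensive.
Local Open Scope classical_set_scope.
Local Open Scope ring_scope.
Local Open Scope complex_scope.

(** * Modulus and exponential *)

Section modulus.
Context {R : realType}.
Implicit Types (z w : R[i]) (x y : R).

Lemma cmodE z : cmod z = Normc.normc z. Proof. by case: z. Qed.

Lemma cmod_ge0 z : 0 <= cmod z. Proof. exact: sqrtr_ge0. Qed.

Lemma cmod0 : cmod (0 : R[i]) = 0.
Proof. by rewrite cmodE Normc.normc0. Qed.

Lemma cmod1 : cmod (1 : R[i]) = 1.
Proof. by rewrite cmodE Normc.normc1. Qed.

Lemma cmod_eq0 z : (cmod z == 0) = (z == 0).
Proof.
apply/eqP/eqP => [|->]; last exact: cmod0.
by rewrite cmodE => /Normc.eq0_normc.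
Qed.

Lemma cmod_gt0 z : (0 < cmod z) = (z != 0).
Proof. by rewrite lt_def cmod_ge0 andbT cmod_eq0. Qed.

Lemma cmodM z w : cmod (z * w) = cmod z * cmod w.
Proof. by rewrite !cmodE Normc.normcM. Qed.

Lemma cmodV z : cmod z^-1 = (cmod z)^-1.
Proof. by rewrite !cmodE Normc.normcV. Qed.

Lemma cmodX z n : cmod (z ^+ n) = cmod z ^+ n.
Proof. by elim: n => [|n IH]; rewrite ?cmod1 // !exprS cmodM IH. Qed.

Lemma cmodN z : cmod (- z) = cmod z.
Proof. by case: z => a b; rewrite /cmod /= !sqrrN. Qed.

Lemma cmodBC z w : cmod (z - w) = cmod (w - z).
Proof. by rewrite -cmodN opprB. Qed.

Lemma cmodD z w : cmod (z + w) <= cmod z + cmod w.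
Proof. by rewrite !cmodE; apply: le_normcD. Qed.

Lemma cmodB z w : cmod (z - w) <= cmod z + cmod w.
Proof. by rewrite -(cmodN w); apply: cmodD. Qed.

Lemma cmodB_ge z w : cmod z - cmod w <= cmod (z + w).
Proof. by have := cmodB (z + w) w; rewrite addrK -lerBlDr. Qed.

Lemma cmod_sqr z : cmod z ^+ 2 = complex.Re z ^+ 2 + complex.Im z ^+ 2.
Proof. by rewrite sqr_sqrtr // addr_ge0 ?sqr_ge0. Qed.

Lemma cmod_real x : cmod x%:C = `|x|.
Proof. by rewrite /cmod /= expr0n addr0 sqrtr_sqr. Qed.

Lemma cmodi : cmod ('i%C : R[i]) = 1.
Proof. by rewrite /cmod /= expr0n add0r expr1n sqrtr1. Qed.

Lemma normRe z : `|complex.Re z| <= cmod z.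
Proof. by rewrite -sqrtr_sqr ler_wsqrtr // lerDl sqr_ge0. Qed.

Lemma normIm z : `|complex.Im z| <= cmod z.
Proof. by rewrite -sqrtr_sqr ler_wsqrtr // lerDr sqr_ge0. Qed.

Lemma cmod_le_ReIm z : cmod z <= `|complex.Re z| + `|complex.Im z|.
Proof.
case: z => a b /=; have -> : a +i* b = a%:C + 'i%C * b%:C.
  by apply/eqP; rewrite eq_complex /=; apply/andP; split; apply/eqP; ring.
by apply: le_trans (cmodD _ _) _; rewrite cmodM !cmod_real cmodi mul1r.
Qed.

Lemma ReD z w : complex.Re (z + w) = complex.Re z + complex.Re w.
Proof. by case: z; case: w. Qed.
Lemma ImD z w : complex.Im (z + w) = complex.Im z + complex.Im w.
Proof. by case: z; case: w. Qed.
Lemma ReN z : complex.Re (- z) = - complex.Re z. Proof. by case: z. Qed.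
Lemma ImN z : complex.Im (- z) = - complex.Im z. Proof. by case: z. Qed.
Lemma ReM z w : complex.Re (z * w) =
  complex.Re z * complex.Re w - complex.Im z * complex.Im w.
Proof. by case: z; case: w. Qed.
Lemma ImM z w : complex.Im (z * w) =
  complex.Re z * complex.Im w + complex.Im z * complex.Re w.
Proof. by case: z => a b; case: w => c d /=; rewrite addrC [b * c]mulrC addrC mulrC. Qed.
Lemma ReV z : complex.Re z^-1 = complex.Re z / cmod z ^+ 2.
Proof. by rewrite cmod_sqr; case: z. Qed.
Lemma ImV z : complex.Im z^-1 = - complex.Im z / cmod z ^+ 2.
Proof. by rewrite cmod_sqr; case: z => a b /=; rewrite mulNr. Qed.

Lemma eqC z w : complex.Re z = complex.Re w -> complex.Im z = complex.Im w ->
  z = w.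
Proof. by case: z => a b; case: w => c d /= -> ->. Qed.

Lemma realCM x y : (x * y)%:C = x%:C * y%:C.
Proof. exact: rmorphM. Qed.
Lemma realCD x y : (x + y)%:C = x%:C + y%:C.
Proof. exact: rmorphD. Qed.
Lemma realCV x : (x^-1)%:C = (x%:C)^-1.
Proof. exact: fmorphV. Qed.
Lemma realC_eq0 x : (x%:C == 0) = (x == 0).
Proof. exact: fmorph_eq0. Qed.

Lemma norm_leM (a b A B : R) : `|a| <= A -> `|b| <= B -> `|a * b| <= A * B.
Proof. by move=> aA bB; rewrite normrM ler_pM. Qed.

Lemma norm_leD (a b A B : R) : `|a| <= A -> `|b| <= B -> `|a + b| <= A + B.
Proof. by move=> aA bB; apply: le_trans (ler_normD _ _) _; apply: lerD. Qed.

Lemma cmod_leM z w (A B : R) : cmod z <= A -> cmod w <= B -> cmod (z * w) <= A * B.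
Proof. by move=> aA bB; rewrite cmodM ler_pM // cmod_ge0. Qed.

Lemma cmod_leD z w (A B : R) : cmod z <= A -> cmod w <= B -> cmod (z + w) <= A + B.
Proof. by move=> aA bB; apply: le_trans (cmodD _ _) _; apply: lerD. Qed.

End modulus.

Section cexp_def.
Context {R : realType}.
Implicit Types (z w : R[i]) (x y : R).

Definition cexp z : R[i] :=
  (expR (complex.Re z) * cos (complex.Im z)) +i*
  (expR (complex.Re z) * sin (complex.Im z)).

Lemma Re_cexp z : complex.Re (cexp z) = expR (complex.Re z) * cos (complex.Im z).
Proof. by []. Qed.
Lemma Im_cexp z : complex.Im (cexp z) = expR (complex.Re z) * sin (complex.Im z).
Proof. by []. Qed.

Lemma cexpD z w : cexp (z + w) = cexp z * cexp w.
Proof.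
apply: eqC; rewrite ?ReM ?ImM ?Re_cexp ?Im_cexp ?ReD ?ImD expRD
  ?cosD ?sinD; ring.
Qed.

Lemma cexp0 : cexp 0 = 1.
Proof. by apply: eqC; rewrite ?Re_cexp ?Im_cexp /= ?cos0 ?sin0 expR0; ring. Qed.

Lemma cexpN z : cexp (- z) = (cexp z)^-1.
Proof.
have h : cexp (- z) * cexp z = 1 by rewrite -cexpD addNr cexp0.
have h0 : cexp z != 0.
  by apply/eqP => h1; move: h; rewrite h1 mulr0 => /eqP; rewrite eq_sym oner_eq0.
by apply: (mulIf h0); rewrite h mulVf.
Qed.

Lemma cmod_cexp z : cmod (cexp z) = expR (complex.Re z).
Proof. 
rewrite /cmod /= !exprMn -mulrDr cos2Dsin2 mulr1 sqrtr_sqr ger0_norm //.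
Qed.

Lemma cexp_real x : cexp x%:C = (expR x)%:C.
Proof. by apply: eqC; rewrite ?Re_cexp ?Im_cexp /= ?cos0 ?sin0; ring. Qed.

Lemma cexp_pi z : cexp (z + 0 +i* pi) = - cexp z.
Proof.
rewrite cexpD mulrC -mulN1r; congr (_ * _).
by apply: eqC; rewrite ?Re_cexp ?Im_cexp /= expR0 ?cospi ?sinpi; ring.
Qed.

End cexp_def.

(** * Taylor bounds for real functions *)

Section real_taylor.
Context {R : realType}.

(** Each application integrates a bound once, through the mean value theorem;
    the Taylor bounds below follow by climbing from [cos] and [expR]. *)
Lemma norm_primitive_le (F F' : R -> R) (C : R) n :
  (forall x : R, is_derive x 1 F (F' x)) -> F 0 = 0 ->
  (forall x, `|x| <= 1 -> `|F' x| <= C * `|x| ^+ n) ->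
  forall x, `|x| <= 1 -> `|F x| <= C * `|x| ^+ n.+1.
Proof.
move=> dF F0 leF'.
have C0 : 0 <= C.
  by have := leF' 1; rewrite normr1 lexx expr1n mulr1 => /(_ isT); apply: le_trans.
have cF x : {for x, continuous F}.
  by apply: differentiable_continuous; apply/derivable1_diffP; case: (dF x).
have key x y c : `|x| <= 1 -> `|c| <= `|x| -> F x = F' c * y -> `|y| = `|x| ->
    `|F x| <= C * `|x| ^+ n.+1.
  move=> x1 cx -> yx; rewrite normrM yx exprSr mulrA ler_wpM2r//.
  apply: le_trans (leF' c (le_trans cx x1)) _.
  by rewrite ler_wpM2l // lerXn2r // nnegrE.
move=> x x1; have [x0|x0] := leP 0 x.
  have [c|c cx /eqP] := @MVT_segment _ F F' 0 x x0 (fun y _ => dF y).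
    by apply: continuous_subspaceT => y; exact: cF.
  rewrite F0 !subr0 => /eqP Fx; apply: (key x x c) => //.
  move: cx; rewrite in_itv /= => /andP[c0 cx].
  by rewrite !ger0_norm.
have [c|c cx /eqP] := @MVT_segment _ F F' x 0 (ltW x0) (fun y _ => dF y).
  by apply: continuous_subspaceT => y; exact: cF.
rewrite F0 !sub0r eqr_oppLR -mulrN opprK => /eqP Fx; apply: (key x x c) => //.
move: cx; rewrite in_itv /= => /andP[c0 cx].
by rewrite !ler0_norm // ?lerN2 // ltW.
Qed.

Lemma sin_le (x : R) : `|x| <= 1 -> `|sin x| <= `|x|.
Proof.
move=> x1; have := @norm_primitive_le sin cos 1 0 _ (sin0 _) _ x x1.
by rewrite expr1 mul1r; apply => // y _; rewrite mul1r cos_max.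
Qed.

Lemma cosB1_le (x : R) : `|x| <= 1 -> `|cos x - 1| <= `|x| ^+ 2.
Proof.
move=> x1; rewrite -[leRHS]mul1r.
apply: (@norm_primitive_le (fun x => cos x - 1) (fun x => - sin x) 1 1) => //.
- move=> y; have -> : - sin y = - sin y - 0 by rewrite subr0.
  exact: is_deriveB.
- by rewrite cos0 subrr.
- by move=> y y1; rewrite normrN mul1r expr1 sin_le.
Qed.

Lemma sinBid_le (x : R) : `|x| <= 1 -> `|sin x - x| <= `|x| ^+ 3.
Proof.
move=> x1; rewrite -[leRHS]mul1r.
apply: (@norm_primitive_le (fun x => sin x - x) (fun x => cos x - 1) 1 2) => //.
- by rewrite sin0 subrr.
- by move=> y y1; rewrite mul1r cosB1_le.
Qed.

Lemma cosB2_le (x : R) : `|x| <= 1 -> `|cos x - 1 + x ^+ 2 / 2| <= `|x| ^+ 4.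
Proof.
move=> x1; rewrite -[leRHS]mul1r.
apply: (@norm_primitive_le (fun x => cos x - 1 + x ^+ 2 / 2)
  (fun x => - (sin x - x)) 1 3) => //.
- move=> y.
  apply: is_derive_eq.
  rewrite /GRing.scale /=. by field.
- by rewrite cos0; ring.
- by move=> y y1; rewrite normrN mul1r sinBid_le.
Qed.

Lemma expR_taylor2 : exists2 C : R, 0 <= C &
  forall x : R, `|x| <= 1 -> `|expR x - 1 - x - x ^+ 2 / 2| <= C * `|x| ^+ 3.
Proof.
exists (expR 1); first exact: expR_ge0.
have e0 (x : R) : `|x| <= 1 -> `|expR x| <= expR 1 * `|x| ^+ 0.
  move=> x1; rewrite mulr1 ger0_norm ?expR_ge0 // ler_expR.
  exact: le_trans (ler_norm _) x1.
have e1 (x : R) : `|x| <= 1 -> `|expR x - 1| <= expR 1 * `|x| ^+ 1.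
  apply: (@norm_primitive_le (fun x => expR x - 1) expR _ 0) => //.
  - move=> y; rewrite -[X in is_derive _ _ _ X]subr0.
    exact: is_deriveB.
  - by rewrite expR0 subrr.
have e2 (x : R) : `|x| <= 1 -> `|expR x - 1 - x| <= expR 1 * `|x| ^+ 2.
  apply: (@norm_primitive_le (fun x => expR x - 1 - x) (fun x => expR x - 1) _ 1) => //.
  - move=> y; rewrite -[X in is_derive _ _ _ (X - _)]subr0.
    by apply: is_deriveB.
  - by rewrite expR0; ring.
move=> x; apply: (@norm_primitive_le (fun x => expR x - 1 - x - x ^+ 2 / 2)
  (fun x => expR x - 1 - x) _ 2) => //.
- move=> y.
  apply: is_derive_eq.
  rewrite /GRing.scale /=. by field.
- by rewrite expR0; ring.
Qed.

End real_taylor.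

(** * Second-order expansions *)

Section bounded_near_zero.
Context {R : realType}.
Implicit Types (f g : R[i] -> R[i]) (z w s : R[i]).

Definition bnd f := exists M r : R, 0 < r /\
  forall s, cmod s < r -> cmod (f s) <= M.

Lemma bnd_cst w : bnd (fun=> w).
Proof. by exists (cmod w), 1. Qed.

Lemma bnd_id : bnd id.
Proof. by exists 1, 1; split => // s /ltW. Qed.

Lemma bndD f g : bnd f -> bnd g -> bnd (fun s => f s + g s).
Proof.
move=> [M [r [r0 fM]]] [M' [r' [r'0 gM]]]; exists (M + M'), (Num.min r r').
split=> [|s]; first by rewrite lt_min r0.
by rewrite lt_min => /andP[sr sr']; apply: cmod_leD; [exact: fM|exact: gM].
Qed.

Lemma bndM f g : bnd f -> bnd g -> bnd (fun s => f s * g s).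
Proof.
move=> [M [r [r0 fM]]] [M' [r' [r'0 gM]]]; exists (M * M'), (Num.min r r').
split=> [|s]; first by rewrite lt_min r0.
by rewrite lt_min => /andP[sr sr']; apply: cmod_leM; [exact: fM|exact: gM].
Qed.

Lemma bndX f n : bnd f -> bnd (fun s => f s ^+ n).
Proof.
move=> hf; elim: n => [|n IH]; first exact: bnd_cst.
have -> : (fun s => f s ^+ n.+1) = (fun s => f s * f s ^+ n).
  by apply/funext => s; rewrite exprS.
exact: bndM.
Qed.

Lemma bnd_small g e : bnd g -> 0 < e ->
  exists r : R, 0 < r /\ forall s, cmod s < r -> cmod (s * g s) < e.
Proof.
move=> [M [r [r0 gM]]] e0; have M0 : 0 < `|M| + 1 by rewrite ltr_wpDl.
exists (Num.min r (e / (`|M| + 1))); split; first by rewrite lt_min r0 divr_gt0.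
move=> s; rewrite lt_min => /andP[sr]; rewrite ltr_pdivlMr // => se.
apply: le_lt_trans se; rewrite cmodM ler_wpM2l ?cmod_ge0 //.
apply: le_trans (gM _ sr) _; apply: le_trans (ler_norm _) _; lra.
Qed.

Lemma bnd_comp f g : bnd f -> bnd g -> bnd (fun s => f (s * g s)).
Proof.
move=> [M [r [r0 fM]]] /bnd_small => /(_ _ r0)[r' [r'0 gr]].
by exists M, r'; split=> // s /gr /fM.
Qed.

Lemma bnd_near f g : (exists r : R, 0 < r /\ forall s, cmod s < r -> f s = g s) ->
  bnd g -> bnd f.
Proof.
move=> [r' [r'0 fg]] [M [r [r0 gM]]]; exists M, (Num.min r r').
split=> [|s]; first by rewrite lt_min r0.
by rewrite lt_min => /andP[sr sr']; rewrite fg //; exact: gM.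
Qed.

End bounded_near_zero.

Ltac bnd_tac := repeat lazymatch goal with
  | |- bnd (fun s => s) => apply: bnd_id
  | |- bnd (fun s => @Algebra.add _ (@?f s) (@?g s)) => apply (@bndD _ f g)
  | |- bnd (fun s => @GRing.mul _ (@?f s) (@?g s)) => apply (@bndM _ f g)
  | |- bnd (fun s => @GRing.exp _ (@?f s) ?n) => apply (@bndX _ f n)
  | |- bnd (fun s => ?f (s * @?g s)) => apply (@bnd_comp _ f g)
  | _ => first [assumption | apply: bnd_cst]
  end.

Section second_order.
Context {R : realType}.
Implicit Types (f g : R[i] -> R[i]) (z w s : R[i]).

(** An expansion to second order with a bounded remainder coefficient: the
    input of the maximum principle below, and a property that sums, products,
    compositions and integrals of a bounded kernel inherit by pure algebra. *)
Definition hol2 f z := exists a b : R[i], exists2 Q, bnd Q &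
  forall s, f (z + s) = f z + s * a + s ^+ 2 * b + s ^+ 3 * Q s.

Lemma hol2_cst w z : hol2 (fun=> w) z.
Proof.
by exists 0, 0, (fun=> 0) => [|s]; [exact: bnd_cst|rewrite !mulr0 !addr0].
Qed.

Lemma hol2_id z : hol2 id z.
Proof.
by exists 1, 0, (fun=> 0) => [|s]; [exact: bnd_cst|rewrite mulr1 !mulr0 !addr0].
Qed.

Lemma hol2D f g z : hol2 f z -> hol2 g z -> hol2 (fun z => f z + g z) z.
Proof.
move=> [a [b [Q hQ fE]]] [c [d [P hP gE]]].
exists (a + c), (b + d), (fun s => Q s + P s); first exact: bndD.
by move=> s; rewrite fE gE; ring.
Qed.

Lemma hol2M f g z : hol2 f z -> hol2 g z -> hol2 (fun z => f z * g z) z.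
Proof.
move=> [a [b [Q hQ fE]]] [c [d [P hP gE]]].
exists (f z * c + a * g z), (f z * d + a * c + b * g z), (fun s =>
  f z * P s + Q s * g z + a * d + b * c + s * (a * P s + b * d + Q s * c +
  s * (b * P s + Q s * d + s * (Q s * P s)))).
  bnd_tac.
by move=> s; rewrite fE gE; ring.
Qed.

Lemma hol2_comp f g z : hol2 f (g z) -> hol2 g z -> hol2 (fun z => f (g z)) z.
Proof.
move=> [a [b [Q hQ fE]]] [c [d [P hP gE]]].
pose T s : R[i] := c + s * d + s ^+ 2 * P s.
have hT : bnd T by rewrite /T; bnd_tac.
exists (a * c), (a * d + b * c ^+ 2), (fun s => a * P s +
  b * (2%:R * c * (d + s * P s) + s * (d + s * P s) ^+ 2) +
  T s ^+ 3 * Q (s * T s)).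
  bnd_tac.
move=> s; rewrite gE.
have -> : g z + s * c + s ^+ 2 * d + s ^+ 3 * P s = g z + s * T s.
  by rewrite /T; ring.
by rewrite fE; move: (Q _) => y; rewrite /T; ring.
Qed.

(** The identity is only needed near [0]: elsewhere the remainder can be
    defined by solving for it. *)
Lemma hol2I f z a b Q (r : R) : 0 < r -> bnd Q ->
  (forall s, cmod s < r ->
    f (z + s) = f z + s * a + s ^+ 2 * b + s ^+ 3 * Q s) -> hol2 f z.
Proof.
move=> r0 hQ fE; exists a, b, (fun s => if cmod s < r then Q s else
  (f (z + s) - (f z + s * a + s ^+ 2 * b)) / s ^+ 3).
  by apply: bnd_near hQ; exists r; split=> // s ->.
move=> s; case: ifPn => [/fE //|]; rewrite -leNgt => sr.
have s0 : s != 0 by rewrite -cmod_gt0 (lt_le_trans r0).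
by field.
Qed.

Lemma hol2_inv w : w != 0 -> hol2 (fun z => z^-1) w.
Proof.
move=> w0; have cw : 0 < cmod w by rewrite cmod_gt0.
apply: (@hol2I _ _ (- w ^- 2) (w ^- 3) (fun s => - (w ^- 3 * (w + s)^-1))
  (cmod w / 2)); first by rewrite divr_gt0.
  exists (cmod w ^- 3 * (2 / cmod w)), (cmod w / 2).
  split; first by rewrite divr_gt0.
  move=> s sw; rewrite cmodN cmodM !cmodV cmodX ler_wpM2l ?invr_ge0 ?exprn_ge0 //.
    exact: cmod_ge0.
  rewrite -[leRHS]invf_div lef_pV2 ?posrE ?divr_gt0 //.
    by apply: le_trans (cmodB_ge _ _); lra.
  by apply: lt_le_trans (cmodB_ge _ _); lra.
move=> s sw; have ws : w + s != 0.
  by rewrite -cmod_gt0; apply: lt_le_trans (cmodB_ge _ _); lra.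
by field; rewrite w0 ws.
Qed.

Lemma hol2V f z : f z != 0 -> hol2 f z -> hol2 (fun z => (f z)^-1) z.
Proof. by move=> fz hf; apply: (@hol2_comp (fun z => z^-1) f) => //; apply: hol2_inv. Qed.

Lemma hol2_lip f z : hol2 f z -> exists L r : R, [/\ 0 < r, 0 <= L &
  forall s, cmod s < r -> cmod (f (z + s) - f z) <= L * cmod s].
Proof.
move=> [a [b [Q hQ fE]]]; have : bnd (fun s => a + s * b + s ^+ 2 * Q s).
  bnd_tac.
move=> [M [r [r0 hM]]]; exists M, r; split => //.
  by apply: le_trans (hM 0 _); rewrite ?cmod_ge0 ?cmod0.
move=> s sr; rewrite fE.
have -> : f z + s * a + s ^+ 2 * b + s ^+ 3 * Q s - f z =
  (a + s * b + s ^+ 2 * Q s) * s by ring.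
by rewrite cmodM ler_wpM2r ?cmod_ge0 // hM.
Qed.

Lemma half_sqr (x y : R) :
  (x +i* y) ^+ 2 / 2%:R = ((x ^+ 2 - y ^+ 2) / 2) +i* (x * y) :> R[i].
Proof.
have two0 : (2%:R : R[i]) != 0 by rewrite pnatr_eq0.
apply: (mulIf two0); rewrite divfK //.
have -> : (2%:R : R[i]) = 2%:C by rewrite rmorph_nat.
by apply: eqC; rewrite ?ReM ?ImM /=; field.
Qed.

(** Real and imaginary parts of the remainder are combinations of the
    remainders of [expR], [cos] and [sin]; the explicit constants come from
    bounding each term. *)
Lemma hol2_cexp0 : exists2 Q, bnd Q &
  forall s, cexp s = 1 + s + s ^+ 2 / 2%:R + s ^+ 3 * Q s.
Proof.
have [C C0 hC] := @expR_taylor2 R.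
pose Q s : R[i] := (cexp s - (1 + s + s ^+ 2 / 2%:R)) / s ^+ 3.
exists Q; last first.
  move=> s; have [->|s0] := eqVneq s 0; last by rewrite /Q; field; rewrite s0.
  by rewrite cexp0 !expr0n !(mul0r, addr0).
exists (8 + 2 * C), 1; split=> // s /ltW s1.
rewrite /Q; have [->|s0] := eqVneq s 0.
  have -> : ((0 : R[i]) ^+ 3)^-1 = 0 by rewrite expr0n invr0.
  rewrite mulr0 cmod0; lra.
rewrite cmodM cmodV cmodX ler_pdivrMr ?exprn_gt0 ?cmod_gt0 //.
case: s s1 s0 => x y s1 s0.
have xn := normRe (x +i* y); have yn := normIm (x +i* y); rewrite /= in xn yn.
have n0 : 0 < cmod (x +i* y) by rewrite cmod_gt0.
set n := cmod _ in s1 xn yn n0 *.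
have x1 := le_trans xn s1; have y1 := le_trans yn s1.
have hexp := hC _ x1; have hcos := cosB2_le y1; have hsin := sinBid_le y1.
set r1 := expR x - 1 - x - x ^+ 2 / 2 in hexp.
set r2 := cos y - 1 + y ^+ 2 / 2 in hcos.
set r3 := sin y - y in hsin.
have xk k : `|x| ^+ k <= n ^+ k by rewrite lerXn2r ?nnegrE // ltW.
have yk k : `|y| ^+ k <= n ^+ k by rewrite lerXn2r ?nnegrE // ltW.
have nk k : n ^+ k <= 1 by rewrite exprn_ile1 // ltW.
have r1n : `|r1| <= C * n ^+ 3 by apply: le_trans hexp _; rewrite ler_wpM2l.
have r2n : `|r2| <= n ^+ 3.
  apply: le_trans hcos _; apply: le_trans (yk 4%N) _.
  by rewrite exprS ler_piMl // exprn_ge0 // ltW.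
have r3n : `|r3| <= n ^+ 3 by apply: le_trans hsin _.
have x2n : `|x ^+ 2 / 2| <= 1 / 2.
  by rewrite normrM normrX [`|2^-1|]ger0_norm // ler_wpM2r // (le_trans (xk 2%N)).
have An : `|1 + x + x ^+ 2 / 2| <= 3.
  apply: le_trans (norm_leD (norm_leD (lexx _) x1) x2n) _.
  rewrite normr1; lra.
have n30 : 0 <= n ^+ 3 by rewrite exprn_ge0 // ltW.
have xy2 : `|x * y ^+ 2| <= n * n ^+ 2 by apply: norm_leM => //; rewrite normrX.
have x2y : `|x ^+ 2 * y| <= n ^+ 2 * n by apply: norm_leM => //; rewrite normrX.
have Ar2 := norm_leM An r2n; have Ar3 := norm_leM An r3n.
have rcos := norm_leM r1n (cos_max y); have rsin := norm_leM r1n (sin_max y).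
have y2n : `|y ^+ 2 * x * x / 4| <= n ^+ 3 / 4.
  rewrite normrM [`|4^-1|]ger0_norm // ler_wpM2r //.
  by apply: le_trans (norm_leM (norm_leM _ xn) x1) _; first rewrite normrX; [exact: yk|rewrite mulr1 -exprSr].
rewrite half_sqr; apply: le_trans (cmod_le_ReIm _) _.
have -> : complex.Re (cexp (x +i* y) -
    (1 + x +i* y + ((x ^+ 2 - y ^+ 2) / 2) +i* (x * y))) =
   - (x * y ^+ 2 / 2) - y ^+ 2 * x * x / 4 + (1 + x + x ^+ 2 / 2) * r2
   + r1 * cos y.
  by rewrite /= /r1 /r2; field.
have -> : complex.Im (cexp (x +i* y) -
    (1 + x +i* y + ((x ^+ 2 - y ^+ 2) / 2) +i* (x * y))) =
   x ^+ 2 * y / 2 + (1 + x + x ^+ 2 / 2) * r3 + r1 * sin y.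
  by rewrite /= /r1 /r3; field.
have n3 : n * n ^+ 2 = n ^+ 3 by rewrite -exprS.
have n3' : n ^+ 2 * n = n ^+ 3 by rewrite -exprSr.
rewrite n3 in xy2; rewrite n3' in x2y; clear - xy2 x2y Ar2 Ar3 rcos rsin y2n n30.
set u1 := x * y ^+ 2 in xy2 *; set u2 := _ / 4 in y2n *.
set u3 := _ * r2 in Ar2 *; set u4 := _ * r3 in Ar3 *.
set u5 := r1 * _ in rcos *; set u6 := r1 * _ in rsin *.
set u7 := x ^+ 2 * y in x2y *; set N := n ^+ 3 in xy2 x2y Ar2 Ar3 rcos rsin y2n n30 *.
set CN := C * N in rcos rsin.
have -> : (8 + 2 * C) * N = 8 * N + 2 * CN by rewrite /CN; ring.
move: xy2 x2y Ar2 Ar3 rcos rsin y2n; rewrite !ler_norml => /andP[? ?] /andP[? ?] /andP[? ?]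
  /andP[? ?] /andP[? ?] /andP[? ?] /andP[? ?].
have h1 : `|- (u1 / 2) - u2 + u3 + u5| <= 4 * N + CN by rewrite ler_norml; lra.
have h2 : `|u7 / 2 + u4 + u6| <= 4 * N + CN by rewrite ler_norml; lra.
lra.
Qed.

Lemma hol2_cexp z : hol2 cexp z.
Proof.
have [Q hQ hE] := hol2_cexp0.
exists (cexp z), (cexp z / 2%:R), (fun s => cexp z * Q s).
  bnd_tac.
by move=> s; rewrite cexpD (hE s); field.
Qed.

Lemma hol2_cexpf f z : hol2 f z -> hol2 (fun z => cexp (f z)) z.
Proof. by move=> hf; apply: (@hol2_comp cexp f) => //; apply: hol2_cexp. Qed.

End second_order.

(** * The maximum principle *)

Section maximum_principle.
Context {R : realType}.
Implicit Types (f g q : R[i] -> R[i]) (z w s : R[i]).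

(** Parallelogram law over the fourth roots of unity: the cross terms cancel
    because the roots, and their squares, sum to [0]. *)
Lemma sum4_cmod_sqr (p u v : R[i]) :
  cmod (p + u + v) ^+ 2 + cmod (p + 'i%C * u - v) ^+ 2 +
  cmod (p - u + v) ^+ 2 + cmod (p - 'i%C * u - v) ^+ 2 =
  4 * (cmod p ^+ 2 + cmod u ^+ 2 + cmod v ^+ 2).
Proof.
case: p => p1 p2; case: u => u1 u2; case: v => v1 v2.
by rewrite !cmod_sqr /=; ring.
Qed.

Lemma cmod_sqrD_ge (p e : R[i]) :
  cmod p ^+ 2 - 2 * cmod p * cmod e <= cmod (p + e) ^+ 2.
Proof.
have := cmodB_ge p e; have := cmod_ge0 (p + e); have := cmod_ge0 e.
have := cmod_ge0 p; set x := cmod p; set y := cmod e; set t := cmod _ => *.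
have [xy|xy] := leP y x.
  have : (x - y) ^+ 2 <= t ^+ 2 by rewrite lerXn2r ?nnegrE // subr_ge0.
  have := sqr_ge0 y; lra.
have : 0 <= t ^+ 2 by rewrite exprn_ge0.
have : x * x <= x * y by rewrite ler_wpM2l // ltW.
have := sqr_ge0 x; rewrite expr2; lra.
Qed.

(** Compare [z] with the four points [z + k s], [k ^ 4 = 1]. The mean of the
    square moduli of the second-order expansion of [f] is at least its value at
    [z], the remainder costs a multiple of [s ^ 3], and [e * cmod ^ 2] gains
    [e * s ^ 2]. *)
Lemma no_interior_max f z (e r : R) : hol2 f z -> 0 < e -> 0 < r ->
  (forall s, cmod s < r -> cmod (f (z + s)) ^+ 2 + e * cmod (z + s) ^+ 2 <=
    cmod (f z) ^+ 2 + e * cmod z ^+ 2) -> False.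
Proof.
move=> [a [b [Q [M [r' [r'0 hQ]]] fE]]] e0 r0 hmax.
pose B := cmod (f z) + cmod a + cmod b.
have B0 : 0 <= B by rewrite !addr_ge0 ?cmod_ge0.
have M0 : 0 <= M by apply: le_trans (hQ 0 _); rewrite ?cmod_ge0 ?cmod0.
have [s [s0 [sr sr' s1 sBM]]] : exists s : R, 0 < s /\
    [/\ s < r, s < r', s <= 1 & 2 * B * M * s < e].
  have BM0 : 0 < 2 * B * M + 1 by rewrite ltr_wpDl // !mulr_ge0.
  pose m := Num.min (Num.min r r') (Num.min 1 (e / (2 * B * M + 1))).
  have m0 : 0 < m by rewrite !lt_min r0 r'0 ltr01 divr_gt0.
  have mm : m <= m := lexx m.
  move: mm; rewrite {2}/m !le_min => /andP[/andP[mr mr'] /andP[m1 me]].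
  exists (m / 2); split; first by lra.
  split; try lra.
  move: me; rewrite ler_pdivlMr // => me.
  have h : 0 <= 2 * B * M * m by rewrite !mulr_ge0 // ltW.
  rewrite mulrA; lra.
have s'0 := ltW s0.
(* the perturbation of size [s ^+ 3] costs at most [2 * B * M * s ^+ 3] *)
have key (k A : R[i]) (k1 : cmod k = 1) (AB : cmod A <= B) :
    f (z + k * s%:C) = A + (k * s%:C) ^+ 3 * Q (k * s%:C) ->
    cmod A ^+ 2 - 2 * B * M * s ^+ 3 + e * cmod (z + k * s%:C) ^+ 2 <=
      cmod (f z) ^+ 2 + e * cmod z ^+ 2.
  have ks : cmod (k * s%:C) = s by rewrite cmodM k1 cmod_real mul1r ger0_norm.
  move=> fA; apply: le_trans (hmax (k * s%:C) _); last by rewrite ks.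
  rewrite lerD2r fA; apply: le_trans (cmod_sqrD_ge _ _).
  rewrite lerD2l lerN2.
  have -> : 2 * B * M * s ^+ 3 = (2 * B) * (s ^+ 3 * M) by ring.
  apply: ler_pM; rewrite ?mulr_ge0 ?cmod_ge0 ?ler_pM2l //.
  by rewrite cmodM cmodX ks ler_wpM2l ?exprn_ge0 // hQ // ks.
have Bk (k j : R[i]) : cmod k = 1 -> cmod j = 1 ->
    cmod (f z + k * s%:C * a + j * (s%:C ^+ 2 * b)) <= B.
  move=> k1 j1; apply: cmod_leD; first apply: cmod_leD => //.
    by rewrite !cmodM k1 cmod_real mul1r ger0_norm // ler_piMl ?cmod_ge0.
  rewrite cmodM j1 mul1r cmodM cmodX cmod_real ger0_norm // ler_piMl ?cmod_ge0 //.
  by rewrite exprn_ile1.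
pose u := s%:C * a; pose v := s%:C ^+ 2 * b.
have i2 : ('i%C : R[i]) ^+ 2 = -1 by exact: sqr_i.
have c1 : cmod (-1 : R[i]) = 1 by rewrite cmodN cmod1.
have c4 : cmod (- 'i%C : R[i]) = 1 by rewrite cmodN cmodi.
have k1 : cmod (f z + u + v) ^+ 2 - 2 * B * M * s ^+ 3 +
    e * cmod (z + 1 * s%:C) ^+ 2 <= cmod (f z) ^+ 2 + e * cmod z ^+ 2.
  apply: (key _ _ cmod1); last by rewrite fE /u /v; ring.
  have -> : f z + u + v = f z + 1 * s%:C * a + 1 * (s%:C ^+ 2 * b).
    by rewrite /u /v; ring.
  by apply: Bk => //; exact: cmod1.
have k3 : cmod (f z - u + v) ^+ 2 - 2 * B * M * s ^+ 3 +
    e * cmod (z + -1 * s%:C) ^+ 2 <= cmod (f z) ^+ 2 + e * cmod z ^+ 2.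
  apply: (key _ _ c1); last by rewrite fE /u /v; ring.
  have -> : f z - u + v = f z + -1 * s%:C * a + 1 * (s%:C ^+ 2 * b).
    by rewrite /u /v; ring.
  by apply: Bk => //; exact: cmod1.
have k2 : cmod (f z + 'i%C * u - v) ^+ 2 - 2 * B * M * s ^+ 3 +
    e * cmod (z + 'i%C * s%:C) ^+ 2 <= cmod (f z) ^+ 2 + e * cmod z ^+ 2.
  apply: (key _ _ cmodi); last first.
    by rewrite fE [in X in _ + X * b]exprMn i2 /u /v; ring.
  have -> : f z + 'i%C * u - v =
      f z + 'i%C * s%:C * a + -1 * (s%:C ^+ 2 * b) by rewrite /u /v; ring.
  by apply: Bk => //; exact: cmodi.
have k4 : cmod (f z - 'i%C * u - v) ^+ 2 - 2 * B * M * s ^+ 3 +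
    e * cmod (z + - 'i%C * s%:C) ^+ 2 <= cmod (f z) ^+ 2 + e * cmod z ^+ 2.
  apply: (key _ _ c4); last first.
    by rewrite fE [in X in _ + X * b]exprMn sqrrN i2 /u /v; ring.
  have -> : f z - 'i%C * u - v =
      f z + - 'i%C * s%:C * a + -1 * (s%:C ^+ 2 * b) by rewrite /u /v; ring.
  exact: Bk.
have := sum4_cmod_sqr (f z) u v.
have := sum4_cmod_sqr z s%:C 0; rewrite !(addr0, subr0) cmod0 expr0n addr0.
rewrite cmod_real (ger0_norm s'0).
rewrite !(mul1r, mulN1r, mulNr) in k1 k2 k3 k4.
have := sqr_ge0 (cmod u); have := sqr_ge0 (cmod v).
have s3 : 2 * B * M * s ^+ 3 < e * s ^+ 2.
  have -> : 2 * B * M * s ^+ 3 = 2 * B * M * s * s ^+ 2 by ring.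
  by rewrite ltr_pM2r // exprn_gt0.
move: k1 k2 k3 k4 s3; set D := 2 * B * M * s ^+ 3.
set A1 := cmod (_ + u + v) ^+ 2; set A2 := cmod (_ + _ - v) ^+ 2.
set A3 := cmod (_ - u + v) ^+ 2; set A4 := cmod (_ - _ - v) ^+ 2.
set B1 := cmod (z + s%:C) ^+ 2; set B2 := cmod (z + _ * _) ^+ 2.
set B3 := cmod (z - s%:C) ^+ 2; set B4 := cmod (z - _) ^+ 2.
set F0 := cmod (f z) ^+ 2; set Z0 := cmod z ^+ 2.
move=> k1 k2 k3 k4 s3 v0 u0 sB sA.
have : e * (B1 + B2 + B3 + B4) = e * (4 * (Z0 + s ^+ 2)) by rewrite sB.
rewrite !mulrDr => sB'; lra.
Qed.

Definition rect (x0 x1 y0 y1 : R) : set R[i] :=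
  [set z | x0 <= complex.Re z <= x1 /\ y0 <= complex.Im z <= y1].

Definition rect_border (x0 x1 y0 y1 : R) : set R[i] :=
  rect x0 x1 y0 y1 `&` [set z | [\/ complex.Re z = x0, complex.Re z = x1,
    complex.Im z = y0 | complex.Im z = y1]].

Lemma lip_continuous (g : R * R -> R) (p : R * R) (L r : R) : 0 < r ->
  (forall x y, `|x| + `|y| < r ->
    `|g (p.1 + x, p.2 + y) - g p| <= L * (`|x| + `|y|)) ->
  {for p, continuous g}.
Proof.
move=> r0 hL; apply/cvgrPdist_lt => e e0.
have L0 : 0 < `|L| + 1 by rewrite ltr_wpDl.
pose d := Num.min (r / 2) (e / 2 / (`|L| + 1)).
have d0 : 0 < d by rewrite lt_min !divr_gt0.
exists (ball p.1 d, ball p.2 d); first by split; exact: nbhsx_ballx.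
move=> -[x y] [] /=; rewrite /ball /= => hx hy.
have := hL (x - p.1) (y - p.2); rewrite !subrKC.
rewrite [`|x - _|]distrC [`|y - _|]distrC [`|g _ - g p|]distrC.
move: hx hy; rewrite !lt_min => /andP[x1 x2] /andP[y1 y2].
move=> /(_ _)/le_lt_trans; apply; first lra.
apply: (@le_lt_trans _ _ ((`|L| + 1) * (`|p.1 - x| + `|p.2 - y|))).
  by apply: ler_wpM2r; [rewrite addr_ge0|have := ler_norm L; lra].
rewrite mulrC -ltr_pdivlMr //; lra.
Qed.

Lemma rect_max f (e x0 x1 y0 y1 : R) : 0 <= e -> x0 <= x1 -> y0 <= y1 ->
  (forall z, rect x0 x1 y0 y1 z -> hol2 f z) ->
  exists2 c, rect x0 x1 y0 y1 c & forall z, rect x0 x1 y0 y1 z ->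
    cmod (f z) ^+ 2 + e * cmod z ^+ 2 <= cmod (f c) ^+ 2 + e * cmod c ^+ 2.
Proof.
move=> e0 x01 y01 hf.
pose D := (`[x0, x1]%classic `*` `[y0, y1]%classic : set (R * R)).
pose psi (p : R * R) : R := cmod (f (p.1 +i* p.2)) ^+ 2 + e * cmod (p.1 +i* p.2) ^+ 2.
have DE p : D p <-> rect x0 x1 y0 y1 (p.1 +i* p.2).
  by rewrite /D /= !in_itv /=.
have cD : compact D by apply: compact_setX; exact: segment_compact.
have D0 : D !=set0 by exists (x0, y0); rewrite /D /= !in_itv /= !lexx x01 y01.
have cpsi : {within D, continuous psi}.
  apply: continuous_in_subspaceT => p; rewrite inE => /DE /hf hp.
  have sq_cts (g : R[i] -> R[i]) : hol2 g (p.1 +i* p.2) ->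
      {for p, continuous (fun p : R * R => cmod (g (p.1 +i* p.2)) ^+ 2)}.
    move=> /hol2_lip[L [r [r0 L0 hL]]].
    have gE (x y : R) : `|x| + `|y| < r -> cmod (g ((p.1 + x) +i* (p.2 + y)) -
        g (p.1 +i* p.2)) <= L * (`|x| + `|y|).
      move=> xyr; have xy : cmod (x +i* y) <= `|x| + `|y| by apply: cmod_le_ReIm.
      have := hL (x +i* y) (le_lt_trans xy xyr); rewrite /= => /le_trans; apply.
      exact: ler_wpM2l.
    have cRe : {for p, continuous (fun p : R * R => complex.Re (g (p.1 +i* p.2)))}.
      apply: (@lip_continuous _ _ L r r0) => x y xyr /=.
      by rewrite -ReN -ReD; apply: le_trans (normRe _) _; exact: gE.
    have cIm : {for p, continuous (fun p : R * R => complex.Im (g (p.1 +i* p.2)))}.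
      apply: (@lip_continuous _ _ L r r0) => x y xyr /=.
      by rewrite -ImN -ImD; apply: le_trans (normIm _) _; exact: gE.
    have -> : (fun p : R * R => cmod (g (p.1 +i* p.2)) ^+ 2) =
        (fun p : R * R => complex.Re (g (p.1 +i* p.2)) * complex.Re (g (p.1 +i* p.2))
          + complex.Im (g (p.1 +i* p.2)) * complex.Im (g (p.1 +i* p.2))).
      by apply/funext => u; rewrite cmod_sqr.
    by apply: cvgD; apply: cvgM; (exact: cRe || exact: cIm).
  apply: cvgD; first exact: sq_cts.
  apply: cvgM; first exact: cvg_cst.
  by apply: (sq_cts id); exact: hol2_id.
have [c cDc cmax] := compact_EVT_max D0 cD cpsi.
exists (c.1 +i* c.2); first by apply/DE; rewrite inE in cDc.
move=> z zr; have := cmax (complex.Re z, complex.Im z).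
rewrite inE /psi /=; case: z zr => x y zr; apply.
by apply/DE.
Qed.

(** If the bound failed at [z], a perturbation [e * cmod w ^+ 2] of at most half
    of the gap would still have its maximum inside. *)
Lemma maximum_modulus f (B x0 x1 y0 y1 : R) : 0 <= B ->
  (forall z, rect x0 x1 y0 y1 z -> hol2 f z) ->
  (forall z, rect_border x0 x1 y0 y1 z -> cmod (f z) <= B) ->
  forall z, rect x0 x1 y0 y1 z -> cmod (f z) <= B.
Proof.
move=> B0 hf hB z zr; rewrite leNgt; apply/negP => Bz.
have [x01 y01] : x0 <= x1 /\ y0 <= y1.
  by case: zr => /andP[a b] /andP[c d]; split; [exact: le_trans b|exact: le_trans d].
pose K := (`|x0| + `|x1|) ^+ 2 + (`|y0| + `|y1|) ^+ 2 + 1.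
have K0 : 0 < K by rewrite ltr_wpDl // addr_ge0 ?sqr_ge0.
have abs_le (a b x : R) : a <= x <= b -> x ^+ 2 <= (`|a| + `|b|) ^+ 2.
  move=> /andP[ax xb]; rewrite -[x ^+ 2]real_normK ?num_real //.
  rewrite lerXn2r ?nnegrE ?addr_ge0 // ler_norml.
  have := ler_norm (- a); have := ler_norm b; rewrite normrN.
  have := normr_ge0 a; have := normr_ge0 b; lra.
have zK w : rect x0 x1 y0 y1 w -> cmod w ^+ 2 <= K.
  move=> [/abs_le xw /abs_le yw]; rewrite cmod_sqr /K; lra.
have gap : 0 < cmod (f z) ^+ 2 - B ^+ 2.
  by rewrite subr_gt0 ltrXn2r // ?nnegrE // cmod_ge0.
pose e := (cmod (f z) ^+ 2 - B ^+ 2) / (2 * K).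
have e0 : 0 < e by rewrite divr_gt0 // mulr_gt0.
have eK : e * K = (cmod (f z) ^+ 2 - B ^+ 2) / 2 by rewrite /e; field; rewrite gt_eqF.
have [c cr cmax] := rect_max (ltW e0) x01 y01 hf.
have cB : B < cmod (f c).
  have : e * cmod c ^+ 2 <= e * K by rewrite ler_pM2l // zK.
  have := cmax _ zr; have : 0 <= e * cmod z ^+ 2.
    by rewrite mulr_ge0 ?sqr_ge0 // ltW.
  rewrite eK => h1 h2 h3.
  rewrite -(@ltr_pXn2r _ 2) ?nnegrE ?cmod_ge0 //; lra.
have notb : ~ rect_border x0 x1 y0 y1 c by move=> /hB; rewrite leNgt cB.
have [/andP[cx0 cx1] /andP[cy0 cy1]] := cr.
have [ax bx ay byy] : [/\ x0 < complex.Re c, complex.Re c < x1, y0 < complex.Im c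
    & complex.Im c < y1].
  by split; rewrite lt_neqAle; apply/andP; split=> //; apply/eqP => h; apply: notb;
    split=> //=; [constructor 1|constructor 2|constructor 3|constructor 4].
pose r := Num.min (Num.min (complex.Re c - x0) (x1 - complex.Re c))
  (Num.min (complex.Im c - y0) (y1 - complex.Im c)).
have r0 : 0 < r by rewrite !lt_min !subr_gt0 ax bx ay byy.
apply: (no_interior_max (hf c cr) e0 r0) => s.
rewrite !lt_min => /andP[/andP[s1 s2] /andP[s3 s4]]; apply: cmax.
have := normRe s; have := normIm s; rewrite !ler_norml => /andP[? ?] /andP[? ?].
rewrite /rect /= ReD ImD; split; apply/andP; split; lra.
Qed.

(** For every [N] the function [f * exp (N q)] is bounded on the border by the
    maximum [B] of [cmod f], since there either [f] vanishes or [exp (N q)] is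
    at most [1] in modulus. By the maximum principle
    [cmod (f z) <= B exp (- N Re (q z))] for every [N]. *)
Lemma two_constants f q (x0 x1 y0 y1 : R) :
  (forall z, rect x0 x1 y0 y1 z -> hol2 f z) ->
  (forall z, rect x0 x1 y0 y1 z -> hol2 q z) ->
  (forall z, rect_border x0 x1 y0 y1 z -> f z = 0 \/ complex.Re (q z) <= 0) ->
  forall z, rect x0 x1 y0 y1 z -> 0 < complex.Re (q z) -> f z = 0.
Proof.
move=> hf hq hb z zr qz; apply/eqP; rewrite -cmod_eq0; apply/eqP.
apply/eqP; rewrite eq_le cmod_ge0 andbT leNgt; apply/negP => fz.
have [x01 y01] : x0 <= x1 /\ y0 <= y1.
  by case: zr => /andP[a b] /andP[c d]; split; [exact: le_trans b|exact: le_trans d].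
have [c cr] := rect_max (lexx 0) x01 y01 hf.
set B := cmod (f c) => cmax.
have fB w : rect x0 x1 y0 y1 w -> cmod (f w) <= B.
  move=> /cmax; rewrite !mul0r !addr0.
  by rewrite ler_pXn2r ?nnegrE ?cmod_ge0.
pose N := (Num.truncn (B / (cmod (f z) * complex.Re (q z)))).+1.
have N0 : 0 < N%:R :> R by rewrite ltr0n.
have NB : B < cmod (f z) * (N%:R * complex.Re (q z)).
  rewrite mulrCA -ltr_pdivrMr ?mulr_gt0 //; exact: truncnS_gt.
pose g w := f w * cexp ((N%:R)%:C * q w).
have hg w : rect x0 x1 y0 y1 w -> hol2 g w.
  move=> wr; apply: hol2M; first exact: hf.
  by apply: hol2_cexpf; apply: hol2M; [exact: hol2_cst|exact: hq].
have cg w : cmod (g w) = cmod (f w) * expR (N%:R * complex.Re (q w)).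
  by rewrite cmodM cmod_cexp ReM /= mul0r subr0.
have gB w : rect_border x0 x1 y0 y1 w -> cmod (g w) <= B.
  move=> wb; rewrite cg; have [->|qw] := hb w wb.
    by rewrite cmod0 mul0r cmod_ge0.
  rewrite -[B]mulr1 ler_pM ?cmod_ge0 ?expR_ge0 ?fB //; first by case: wb.
  by rewrite -expR0 ler_expR mulr_ge0_le0 // ltW.
have := maximum_modulus (cmod_ge0 _) hg gB zr; rewrite cg leNgt => /negP; apply.
apply: lt_trans NB _; rewrite ltr_pM2l //.
apply: lt_le_trans (expR_ge1Dx _); lra.
Qed.

End maximum_principle.

(** * The logarithm on the slit plane *)

Section complex_logarithm.
Context {R : realType}.
Implicit Types (z w s : R[i]) (x y : R).

(** The complement of the closed negative half-line, as the domain where the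
    denominator in [clog] is positive. *)
Definition slit z := 0 < cmod z + complex.Re z.

(** The half-angle formula for the argument is a single expression on the whole
    slit plane, smooth across the imaginary axis. *)
Definition clog z : R[i] :=
  ln (cmod z) +i* (atan (complex.Im z / (cmod z + complex.Re z)) *+ 2).

Lemma slit_cmod z : slit z -> 0 < cmod z.
Proof. by rewrite /slit; have := normRe z; rewrite ler_norml => /andP[_ ?] ?; lra. Qed.

Lemma slit_neq0 z : slit z -> z != 0.
Proof. by move=> /slit_cmod; rewrite cmod_gt0. Qed.

Lemma slitP z : complex.Im z != 0 \/ 0 < complex.Re z -> slit z.
Proof.
move=> [y0|x0]; last by rewrite /slit ltr_wpDl ?cmod_ge0.
have : `|complex.Re z| ^+ 2 < cmod z ^+ 2.
  by rewrite real_normK ?num_real // cmod_sqr ltrDl lt_def sqrf_eq0 y0 sqr_ge0.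
rewrite ltr_pXn2r ?nnegrE ?cmod_ge0 // ltr_norml => /andP[? _].
by rewrite /slit; lra.
Qed.

Lemma cexp_clog z : slit z -> cexp (clog z) = z.
Proof.
move=> sz; have c0 := slit_cmod sz.
have := cmod_sqr z; rewrite /clog; case: z sz c0 => a b sz c0 /=.
set c := cmod _ in sz c0 *; rewrite /slit -/c /= in sz => cE.
set T := b / (c + a).
have T1 : 1 + T ^+ 2 = 2 * c / (c + a).
  rewrite /T expr_div_n.
  have -> : 2 * c / (c + a) = (2 * c * (c + a)) / (c + a) ^+ 2.
    by field; rewrite gt_eqF.
  have -> : 2 * c * (c + a) = (c + a) ^+ 2 + b ^+ 2.
    have -> : (c + a) ^+ 2 + b ^+ 2 = c ^+ 2 + 2 * c * a + (a ^+ 2 + b ^+ 2) by ring.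
    by rewrite -cE; ring.
  by field; rewrite gt_eqF.
have cos2 : cos (atan T) ^+ 2 = (c + a) / (2 * c).
  rewrite cos_atan exprVn sqr_sqrtr ?addr_ge0 ?sqr_ge0 // T1.
  by field; rewrite !gt_eqF.
have sinE : sin (atan T) = T * cos (atan T).
  have ct : cos (atan T) != 0.
    by apply/eqP => h; move: cos2; rewrite h expr0n /= => /esym/eqP;
       rewrite mulf_eq0 invr_eq0 !gt_eqF // mulr_gt0.
  by rewrite -{2}(atanK T) /tan divfK.
apply: eqC; rewrite /= lnK ?posrE //.
  by rewrite cos_mulr2n cos2; field; rewrite gt_eqF.
rewrite sin_mulr2n sinE.
have -> : cos (atan T) * (T * cos (atan T)) = T * cos (atan T) ^+ 2 by ring.
by rewrite cos2 /T; field; rewrite !gt_eqF.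
Qed.

Lemma Im_clog z : `|complex.Im (clog z)| < pi.
Proof.
rewrite /= ltr_norml; set T := _ / _.
have := atan_gtNpi2 T; have := atan_ltpi2 T; lra.
Qed.

Lemma clog_real x : 0 < x -> clog x%:C = (ln x)%:C.
Proof.
move=> x0; rewrite /clog cmod_real /= mul0r atan0 ger0_norm ?ltW //.
by rewrite mul0rn.
Qed.

Lemma clog_scale x z : 0 < x -> z != 0 -> clog (x%:C * z) = (ln x)%:C + clog z.
Proof.
move=> x0 z0; rewrite /clog cmodM cmod_real ger0_norm ?ltW //.
rewrite lnM ?posrE ?cmod_gt0 // ReM ImM /= !mul0r subr0 addr0 -mulrDr.
by rewrite invfM mulrACA divff ?gt_eqF // mul1r; apply: eqC; rewrite /= ?add0r.
Qed.

(** The two branches agree because both arguments lie in the interval from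
    [- pi] to [pi] and have the same cosine, and the same sign. *)
Lemma cpow_clog z (a : R) : complex.Im z < 0 -> cpow z a = cexp (a%:C * clog z).
Proof.
move=> z0; have sz : slit z by apply: slitP; left; rewrite lt_eqF.
have c0 := slit_cmod sz.
have zE := cexp_clog sz.
have cosE : cos (complex.Im (clog z)) = complex.Re z / cmod z.
  by rewrite -[in RHS]zE Re_cexp /= lnK ?posrE // zE; field; rewrite gt_eqF.
have ang : carg z = complex.Im (clog z).
  have zi : complex.Im z = expR (complex.Re (clog z)) * sin (complex.Im (clog z)).
    by rewrite -[in LHS]zE Im_cexp.
  rewrite /carg leNgt z0 -cosE.
  move: (Im_clog z) zi; rewrite ltr_norml => /andP[].
  move: (complex.Im (clog z)) => th hth hpi zi.
  rewrite cosKN ?opprK // (ltW hth) leNgt; apply/negP => h; move: z0.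
  by rewrite zi pmulr_rlt0 ?expR_gt0 // ltNge sin_ge0_pi // (ltW h) ltW.
rewrite /cpow ang; apply: eqC.
  by rewrite ReM Re_cexp ReM ImM /= !mul0r !subr0 addr0 /powR gt_eqF.
by rewrite ImM Im_cexp ReM ImM /= !mul0r !subr0 !addr0 /powR gt_eqF.
Qed.

Lemma continuous_eps (g : R * R -> R) (p : R * R) : {for p, continuous g} ->
  forall e : R, 0 < e -> exists2 r, 0 < r & forall x y, `|x| < r -> `|y| < r ->
    `|g (p.1 + x, p.2 + y) - g p| < e.
Proof.
move=> /cvgrPdist_lt hg e e0; have [[A B] [/= hA hB] AB] := hg _ e0.
have [r1 /= r10 h1] := hA; have [r2 /= r20 h2] := hB.
exists (Num.min r1 r2); first by rewrite lt_min r10.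
move=> x y; rewrite !lt_min => /andP[x1 x2] /andP[y1 y2].
rewrite distrC; apply: (AB (_, _)); split.
  by apply: h1; rewrite /ball_ /= opprD addNKr normrN.
by apply: h2; rewrite /ball_ /= opprD addNKr normrN.
Qed.

(** Proved from the formula, as a first step: the expansion of [clog] below
    inverts that of [cexp], which requires small increments of [clog]. *)
Lemma clog_cts z : slit z -> forall e : R, 0 < e ->
  exists2 r, 0 < r & forall s, cmod s < r -> cmod (clog (z + s) - clog z) < e.
Proof.
move=> sz e e0; pose p : R * R := (complex.Re z, complex.Im z).
have c0 := slit_cmod sz.
pose N (p : R * R) : R := Num.sqrt (p.1 * p.1 + p.2 * p.2).
have cf : {for p, continuous (fst : R * R -> R)} by exact: cvg_fst.
have cs : {for p, continuous (snd : R * R -> R)} by exact: cvg_snd.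
have NE w : N (complex.Re w, complex.Im w) = cmod w by [].
have cN : {for p, continuous N}.
  apply: (@continuous_comp _ _ _ (fun p : R * R => p.1 * p.1 + p.2 * p.2) Num.sqrt).
    by apply: cvgD; apply: cvgM.
  exact: sqrt_continuous.
have cln : {for p, continuous (fun p : R * R => ln (N p))}.
  apply: (@continuous_comp _ _ _ N (@ln R)) => //.
  by apply: continuous_ln; rewrite NE.
have cat : {for p, continuous (fun p : R * R => atan (p.2 / (N p + p.1)))}.
  apply: (@continuous_comp _ _ _ (fun p : R * R => p.2 / (N p + p.1)) (@atan R)).
    apply: cvgM => //; apply: cvgV; last by apply: cvgD.
    by rewrite NE gt_eqF.
  exact: continuous_atan.
have e4 : 0 < e / 4 by rewrite divr_gt0.
have [r1 r10 h1] := continuous_eps cln e4.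
have [r2 r20 h2] := continuous_eps cat e4.
exists (Num.min r1 r2); first by rewrite lt_min r10.
move=> s; rewrite lt_min => /andP[s1 s2].
apply: le_lt_trans (cmod_le_ReIm _) _; rewrite ReD ReN ImD ImN /=.
have xs1 := le_lt_trans (normRe s) s1; have xs2 := le_lt_trans (normRe s) s2.
have ys1 := le_lt_trans (normIm s) s1; have ys2 := le_lt_trans (normIm s) s2.
have {}h1 := h1 _ _ xs1 ys1; have {}h2 := h2 _ _ xs2 ys2.
rewrite /p /= -ReD -ImD !NE in h1 h2.
rewrite -mulrnBl normrMn -mulr_natr; lra.
Qed.

(** Inverse function argument: the increment [d] of [clog] satisfies
    [cexp d = 1 + s / z]. Since [d] is small, the expansion of [cexp] shows
    that [d] is of order [s]; reinserting this yields the expansion of [d] one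
    order at a time. *)
Lemma hol2_clog z : slit z -> hol2 clog z.
Proof.
move=> sz; have z0 := slit_neq0 sz; have [Q hQ expE] := @hol2_cexp0 R.
pose d s := clog (z + s) - clog z.
have [r1 r10 hr1] : exists2 r, 0 < r & forall s, cmod s < r -> slit (z + s).
  exists ((cmod z + complex.Re z) / 2); first by rewrite divr_gt0.
  move=> s hs; rewrite /slit ReD.
  have := cmodB_ge z s; have := normRe s; rewrite ler_norml => /andP[? _] ?; lra.
have edE s : cmod s < r1 -> cexp (d s) = 1 + s / z.
  move=> /hr1 sr; rewrite cexpD cexpN !cexp_clog //; by field.
(* [cexp d - 1 = d * h d] with [h] close to [1], so [d] is of size [s / z] *)
pose h w : R[i] := 1 + w * (2%:R^-1 + w * Q w).
have bh : bnd (fun w => 2%:R^-1 + w * Q w) by bnd_tac.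
have half0 : (0 : R) < 1 / 2 by rewrite divr_gt0.
have [r2 [r20 hr2]] := bnd_small bh half0.
have [r3 r30 hr3] := clog_cts sz r20.
have dE s : cmod s < r1 -> d s * h (d s) = s / z.
  move=> sr; have := expE (d s); rewrite edE // => eq1.
  have -> : d s * h (d s) = 1 + d s + d s ^+ 2 / 2%:R + d s ^+ 3 * Q (d s) - 1.
    by rewrite /h; field.
  by rewrite -eq1; ring.
pose T s := d s / s.
have hT : bnd T.
  exists (2 / cmod z), (Num.min r1 r3); split; first by rewrite lt_min r10.
  move=> s; rewrite lt_min => /andP[s1 s3]; rewrite /T.
  have [->|s0] := eqVneq s 0.
    by rewrite invr0 mulr0 cmod0 divr_ge0 ?cmod_ge0.
  have c0 : 0 < cmod z by rewrite cmod_gt0.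
  rewrite cmodM cmodV ler_pdivrMr ?cmod_gt0 //.
  have hge : 1 / 2 <= cmod (h (d s)).
    rewrite /h; apply: le_trans (cmodB_ge _ _); rewrite cmod1.
    have := hr2 _ (hr3 _ s3); lra.
  have := congr1 cmod (dE s s1); rewrite !cmodM cmodV => h1.
  have : cmod (d s) * (1 / 2) <= cmod s / cmod z.
    by rewrite -h1 ler_wpM2l ?cmod_ge0.
  have -> : 2 / cmod z * cmod s = 2 * (cmod s / cmod z) by ring.
  lra.
pose P s := 2%:R^-1 + s * T s * Q (s * T s).
have hP : bnd P by rewrite /P; bnd_tac.
pose T1 s := - T s ^+ 2 * P s.
have hT1 : bnd T1.
  have : bnd (fun s => -1 * (T s ^+ 2 * P s)) by bnd_tac.
  by apply: bnd_near; exists 1; split => // s _; rewrite /T1; ring.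
pose S s := - (2%:R / z * T1 s + s * T1 s ^+ 2) * 2%:R^-1 - T s ^+ 3 * Q (s * T s).
have hS : bnd S.
  have : bnd (fun s => -1 * (2%:R / z * T1 s + s * T1 s ^+ 2) * 2%:R^-1 +
     -1 * (T s ^+ 3 * Q (s * T s))) by bnd_tac.
  by apply: bnd_near; exists 1; split => // s _; rewrite /S; ring.
apply: (@hol2I _ clog z z^-1 (- (2%:R^-1 * z ^- 2)) S r1) => // s s1.
have [->|s0] := eqVneq s 0; first by rewrite addr0 !expr0n !mul0r !addr0.
have dT : d s = s * T s by rewrite /T; field.
have TE : T s = z^-1 + s * T1 s.
  have := dE s s1; rewrite dT => eq1; apply: (mulfI s0).
  by rewrite mulrDr -[s / z]eq1 /T1 /P /h; ring.
have -> : clog (z + s) = clog z + d s by rewrite /d; ring.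
rewrite dT -!addrA; congr (_ + _); rewrite {1}TE.
have T1E : T1 s = - (2%:R^-1 * z ^- 2) + s * S s.
  have T1a : T1 s = - T s ^+ 2 * 2%:R^-1 - s * (T s ^+ 3 * Q (s * T s)).
    by rewrite {1}/T1 /P; ring.
  have T2 : T s ^+ 2 = z ^- 2 + s * (2%:R / z * T1 s + s * T1 s ^+ 2).
    by rewrite [in LHS]TE; field.
  by rewrite {1}T1a T2 /S; field.
rewrite {1}T1E; ring.
Qed.

End complex_logarithm.

(** * Integrals of bounded complex functions *)

Section complex_integral.
Context {R : realType} d (T : measurableType d).
Implicit Types (f g : T -> R[i]) (w : R[i]) (r : T -> R).

Definition cmeas f := measurable_fun setT (fun x => complex.Re (f x)) /\
  measurable_fun setT (fun x => complex.Im (f x)).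

Definition cbounded f := cmeas f /\ exists M : R, forall x, cmod (f x) <= M.

Lemma cmeas_cst w : cmeas (fun=> w).
Proof. by split; apply: measurable_cst. Qed.

Lemma cmeas_real r : measurable_fun setT r -> cmeas (fun x => (r x)%:C).
Proof. by move=> mr; split => //; apply: measurable_cst. Qed.

Lemma cmeasD f g : cmeas f -> cmeas g -> cmeas (fun x => f x + g x).
Proof.
move=> [f1 f2] [g1 g2]; split.
  by under eq_fun do rewrite ReD; exact: measurable_funD.
by under eq_fun do rewrite ImD; exact: measurable_funD.
Qed.

Lemma cmeasM f g : cmeas f -> cmeas g -> cmeas (fun x => f x * g x).
Proof.
move=> [f1 f2] [g1 g2]; split.
  under eq_fun do rewrite ReM.
  by apply: measurable_funB; exact: measurable_funM.
under eq_fun do rewrite ImM.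
by apply: measurable_funD; exact: measurable_funM.
Qed.

Lemma cmeasV f : cmeas f -> cmeas (fun x => (f x)^-1).
Proof.
move=> [f1 f2].
have mi : measurable_fun setT (fun x => (cmod (f x) ^+ 2)^-1).
  under eq_fun do rewrite -powR_inv1 ?sqr_ge0 // cmod_sqr !expr2.
  apply: (@measurableT_comp _ _ _ _ _ _ ((@powR R)^~ (-1))
    _ (fun x => complex.Re (f x) * complex.Re (f x) +
                complex.Im (f x) * complex.Im (f x))).
    exact: measurable_powR.
  by apply: measurable_funD; exact: measurable_funM.
split.
  by under eq_fun do rewrite ReV; exact: measurable_funM.
under eq_fun do rewrite ImV.
apply: measurable_funM => //; exact: measurableT_comp.
Qed.

Lemma cbounded_cst w : cbounded (fun=> w).
Proof. by split; [exact: cmeas_cst|exists (cmod w)]. Qed.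

Lemma cboundedD f g : cbounded f -> cbounded g -> cbounded (fun x => f x + g x).
Proof.
move=> [mf [M hM]] [mg [N hN]]; split; first exact: cmeasD.
by exists (M + N) => x; exact: cmod_leD.
Qed.

Lemma cboundedM f g : cbounded f -> cbounded g -> cbounded (fun x => f x * g x).
Proof.
move=> [mf [M hM]] [mg [N hN]]; split; first exact: cmeasM.
by exists (M * N) => x; exact: cmod_leM.
Qed.

Lemma cboundedN f : cbounded f -> cbounded (fun x => - f x).
Proof.
move=> hf; under eq_fun do rewrite -mulN1r.
by apply: cboundedM => //; exact: cbounded_cst.
Qed.

Lemma cboundedX f n : cbounded f -> cbounded (fun x => f x ^+ n).
Proof.
move=> hf; elim: n => [|n IH]; first exact: cbounded_cst.
by under eq_fun do rewrite exprS; exact: cboundedM.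
Qed.

Lemma cboundedV f (e : R) : 0 < e -> cmeas f -> (forall x, e <= cmod (f x)) ->
  cbounded (fun x => (f x)^-1).
Proof.
move=> e0 mf ef; split; first exact: cmeasV.
by exists e^-1 => x; rewrite cmodV lef_pV2 ?posrE // (lt_le_trans e0).
Qed.

Section real_integral.
Context (mu : probability T R).

Lemma bounded_integrable (r : T -> R) (M : R) : measurable_fun setT r ->
  (forall x, `|r x| <= M) -> mu.-integrable setT (EFin \o r).
Proof.
move=> mr rM; apply: measurable_bounded_integrable => //.
  by apply: le_lt_trans (ltry 1); rewrite le_eqVlt (introT eqP (probability_setT mu)).
exists M; split; first exact: num_real.
by move=> N MN x _; apply: le_trans (rM x) _; exact: ltW.
Qed.

Lemma Rintegral_norm_le (r : T -> R) (M : R) : measurable_fun setT r ->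
  (forall x, `|r x| <= M) -> `|\int[mu]_x r x| <= M.
Proof.
move=> mr rM; apply: le_trans (le_normr_Rintegral _ _) _ => //.
  exact: bounded_integrable rM.
have -> : M = \int[mu]_(x in setT) M.
  rewrite Rintegral_cst //.
  by rewrite (congr1 fine (probability_setT mu)) mulr1.
apply: le_Rintegral => //.
- apply: (@bounded_integrable (fun x => `|r x|) M) => [|x].
    exact: measurableT_comp.
  by rewrite normr_id.
- by apply: (@bounded_integrable (fun=> M) `|M|).
Qed.

(** Lets an integrand that only makes sense on the positive half-line be
    replaced by one that is bounded and measurable everywhere. *)
Lemma eq_Rintegral_full (A : set T) (r r' : T -> R) : measurable A ->
  mu A = 1%E -> measurable_fun setT r -> measurable_fun setT r' ->
  (forall x, A x -> r x = r' x) -> \int[mu]_x r x = \int[mu]_x r' x.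
Proof.
move=> mA A1 mr mr' rr'; rewrite /Rintegral; congr fine.
apply: ae_eq_integral => //; try exact/measurable_EFinP.
exists (~` A); split; first exact: measurableC.
  by apply: etrans (probability_setC mu mA) _; rewrite A1 subee.
by move=> x /= h Ax; apply: h => _; rewrite rr'.
Qed.

End real_integral.

Context (mu : probability T R).

Definition Cint f : R[i] :=
  (\int[mu]_x complex.Re (f x)) +i* (\int[mu]_x complex.Im (f x)).

Lemma Re_integrable f : cbounded f ->
  mu.-integrable setT (EFin \o (fun x => complex.Re (f x))).
Proof.
move=> [[mf _] [M fM]]; apply: (@bounded_integrable _ _ M) => // x.
exact: le_trans (normRe _) _.
Qed.

Lemma Im_integrable f : cbounded f ->
  mu.-integrable setT (EFin \o (fun x => complex.Im (f x))).
Proof.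
move=> [[_ mf] [M fM]]; apply: (@bounded_integrable _ _ M) => // x.
exact: le_trans (normIm _) _.
Qed.

Lemma CintD f g : cbounded f -> cbounded g ->
  Cint (fun x => f x + g x) = Cint f + Cint g.
Proof.
move=> hf hg; apply: eqC; rewrite /Cint /=.
  by under eq_Rintegral do rewrite ReD; rewrite RintegralD //; exact: Re_integrable.
by under eq_Rintegral do rewrite ImD; rewrite RintegralD //; exact: Im_integrable.
Qed.

Lemma CintZ w f : cbounded f -> Cint (fun x => w * f x) = w * Cint f.
Proof.
move=> hf; have hR := Re_integrable hf; have hI := Im_integrable hf.
case: w => a b; apply: eqC; rewrite /Cint ?ReM ?ImM /=.
  under eq_Rintegral do rewrite ReM /=.
  rewrite RintegralB ?RintegralZl //.
    exact: (integrableZl measurableT a hR).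
  exact: (integrableZl measurableT b hI).
under eq_Rintegral do rewrite ImM /=.
rewrite RintegralD ?RintegralZl //.
  exact: (integrableZl measurableT a hI).
exact: (integrableZl measurableT b hR).
Qed.

Lemma CintN f : cbounded f -> Cint (fun x => - f x) = - Cint f.
Proof.
move=> hf; rewrite -mulN1r -CintZ //; congr Cint.
by apply/funext => x; rewrite mulN1r.
Qed.

Lemma CintB f g : cbounded f -> cbounded g ->
  Cint (fun x => f x - g x) = Cint f - Cint g.
Proof. by move=> hf hg; rewrite CintD ?CintN //; exact: cboundedN. Qed.

(** The factor [2] comes from treating real and imaginary parts separately. *)
Lemma Cint_le f (M : R) : cmeas f -> (forall x, cmod (f x) <= M) ->
  cmod (Cint f) <= 2 * M.
Proof.
move=> [f1 f2] fM; apply: le_trans (cmod_le_ReIm _) _.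
have -> : 2 * M = M + M by ring.
apply: lerD; apply: Rintegral_norm_le => // x; apply: le_trans (fM x).
  exact: normRe.
exact: normIm.
Qed.

Lemma Cint_close f g (M : R) : cbounded f -> cbounded g ->
  (forall x, cmod (f x - g x) <= M) -> cmod (Cint f - Cint g) <= 2 * M.
Proof.
move=> hf hg fgM; rewrite -CintB //; apply: Cint_le => //.
by have [] := cboundedD hf (cboundedN hg).
Qed.

Lemma eq_Cint_full (A : set T) f g : measurable A -> mu A = 1%E ->
  cmeas f -> cmeas g -> (forall x, A x -> f x = g x) -> Cint f = Cint g.
Proof.
move=> mA A1 [f1 f2] [g1 g2] fg; rewrite /Cint.
congr (_ +i* _); apply: (eq_Rintegral_full mA A1) => // x Ax; by rewrite fg.
Qed.

End complex_integral.

Lemma cauchyGE (R : realType) (mu : probability R R) (z : R[i]) :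
  cauchyG mu z = Cint mu (fun x => (z - x%:C)^-1).
Proof. by []. Qed.

(** * Stieltjes transforms *)

Section stieltjes.
Context {R : realType}.
Implicit Types (z s : R[i]) (x : R) (mu : probability R R).

(** With [|x|] for [x] the kernel is bounded on the whole line; nothing changes
    for measures carried by the positive half-line. *)
Definition stieltjes mu z : R[i] := Cint mu (fun x => (`|x|%:C + z)^-1).

Lemma slit_dist z : slit z ->
  exists2 e : R, 0 < e & forall x, 0 <= x -> e <= cmod (x%:C + z).
Proof.
move=> sz; have [y0|y0] := eqVneq (complex.Im z) 0; last first.
  exists `|complex.Im z|; first by rewrite normr_gt0.
  by move=> x _; apply: le_trans (normIm _); rewrite ImD /= add0r.
have x0 : 0 < complex.Re z.
  move: sz; rewrite /slit /cmod y0 expr0n addr0 sqrtr_sqr.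
  have [//|h] := ltP 0 (complex.Re z).
  by rewrite ler0_norm // addNr ltxx.
exists (complex.Re z) => // x x'0; apply: le_trans (normRe _).
by rewrite ReD /=; apply: le_trans (ler_norm _); rewrite lerDr.
Qed.

Lemma slit_addr_neq0 x z : 0 <= x -> slit z -> x%:C + z != 0.
Proof.
move=> x0 /slit_dist[e e0 /(_ x x0) h].
by rewrite -cmod_gt0 (lt_le_trans e0).
Qed.

Lemma cmeas_stieltjes z : @cmeas R _ R (fun x => `|x|%:C + z).
Proof.
apply: cmeasD; last exact: cmeas_cst.
by apply: cmeas_real; exact: normr_measurable.
Qed.

(** Expand the kernel as a finite geometric sum; the exact remainder
    [k ^ 3 / (x + z + s)] is bounded uniformly in [x]. *)
Lemma hol2_stieltjes mu z : slit z -> hol2 (stieltjes mu) z.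
Proof.
move=> sz; have [e e0 he] := slit_dist sz.
have n0 x : `|x|%:C + z != 0 by apply: slit_addr_neq0.
pose k x : R[i] := (`|x|%:C + z)^-1.
have bk : cbounded k.
  by apply: (cboundedV e0 (cmeas_stieltjes z)) => x; exact: he.
pose ks s x : R[i] := (`|x|%:C + (z + s))^-1.
have hs s x : cmod s < e / 2 -> e / 2 <= cmod (`|x|%:C + (z + s)).
  move=> se; rewrite addrA; apply: le_trans (cmodB_ge _ _).
  have := he `|x| (normr_ge0 x); lra.
have e20 : 0 < e / 2 by rewrite divr_gt0.
have bks s : cmod s < e / 2 -> cbounded (ks s).
  by move=> se; apply: (cboundedV e20 (cmeas_stieltjes _)) => x; exact: hs.
have bk3 s : cmod s < e / 2 -> cbounded (fun x => k x ^+ 3 * ks s x).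
  by move=> se; apply: cboundedM; [exact: cboundedX|exact: bks].
apply: (@hol2I _ _ _ (- Cint mu (fun x => k x ^+ 2)) (Cint mu (fun x => k x ^+ 3))
  (fun s => - Cint mu (fun x => k x ^+ 3 * ks s x)) (e / 2)) => //.
  exists (2 * (e^-1 ^+ 3 * (e / 2)^-1)), (e / 2); split => // s se.
  rewrite cmodN; apply: Cint_le; first by have [] := bk3 s se.
  move=> x; rewrite cmodM cmodX !cmodV ler_pM ?exprn_ge0 ?invr_ge0 ?cmod_ge0 //.
    rewrite lerXn2r ?nnegrE ?invr_ge0 ?cmod_ge0 ?(ltW e0) //.
    by rewrite lef_pV2 ?posrE ?(lt_le_trans e0) ?he.
  by rewrite lef_pV2 ?posrE ?hs // (lt_le_trans e20) ?hs.
move=> s se.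
have -> : stieltjes mu (z + s) = Cint mu (fun x =>
    k x + ((- s) * k x ^+ 2 + (s ^+ 2 * k x ^+ 3 + (- s ^+ 3) * (k x ^+ 3 * ks s x)))).
  congr Cint; apply/funext => x; rewrite /k /ks.
  have h2 : `|x|%:C + (z + s) != 0.
    by rewrite -cmod_gt0 (lt_le_trans e20) ?hs.
  by field; rewrite addrA in h2 *; rewrite n0 h2.
have Zb w f : cbounded f -> cbounded (fun x : R => w * f x).
  by move=> hf; apply: cboundedM => //; exact: cbounded_cst.
have b2 := cboundedX 2 bk; have b3 := cboundedX 3 bk; have b4 := bk3 s se.
rewrite CintD //; last by do 2![apply: cboundedD; first exact: Zb]; exact: Zb.
rewrite CintD //; [|exact: Zb|apply: cboundedD; exact: Zb].
rewrite CintD //; [|exact: Zb|exact: Zb].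
rewrite !CintZ // /stieltjes -/k; ring.
Qed.

Lemma cbounded_stieltjes z : slit z ->
  @cbounded R _ R (fun x => (`|x|%:C + z)^-1).
Proof.
move=> /slit_dist[e e0 he].
by apply: (cboundedV e0 (cmeas_stieltjes z)) => x; exact: he.
Qed.

Lemma cauchyG_stieltjes mu z : on_pos mu -> slit z ->
  cauchyG mu (- z) = - stieltjes mu z.
Proof.
move=> mu1 sz; have bk := cbounded_stieltjes sz.
rewrite cauchyGE /stieltjes -CintN //.
apply: (@eq_Cint_full R _ _ mu `]0, +oo[%classic) => //.
- apply: cmeasV; apply: cmeasD; first exact: cmeas_cst.
  have -> : (fun x : R => - x%:C) = (fun x : R => (-1) * x%:C).
    by apply/funext => x; rewrite mulN1r.
  by apply: cmeasM; [exact: cmeas_cst|exact: cmeas_real].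
- by have [] := cboundedN bk.
- move=> x /=; rewrite in_itv /= andbT => x0.
  by rewrite -invrN opprD addrC gtr0_norm.
Qed.

End stieltjes.

(** * Uniqueness in a strip *)

Section strip.
Context {R : realType}.

Lemma Re_idiv (w : R[i]) : complex.Re ('i%C / w) = complex.Im w / cmod w ^+ 2.
Proof. by rewrite ReM ReV ImV /= mul0r sub0r mul1r mulNr opprK. Qed.

(** Uniqueness from a piece of the boundary. The map [E z = exp (pi z / b)]
    takes the strip to the upper half-plane and the half-line where [f]
    vanishes to an interval that contains [E0]. The function
    [Re (i / (E z - E0 + i eta))] is the Poisson kernel of a pole just below
    [E0]. For a small [eta] it is at most [c], of order [eta], on the part of
    the border where [f] is not known to vanish, and above [c] at the given
    point. A rectangle wide enough for this to hold on its vertical sides too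
    gives the conclusion by [two_constants]. *)
Lemma strip_identity (f : R[i] -> R[i]) (b M : R) : 0 < b ->
  (forall z : R[i], 0 <= complex.Im z <= b -> hol2 f z) ->
  (forall x : R, x < M -> f x%:C = 0) ->
  forall z : R[i], 0 < complex.Im z < b -> f z = 0.
Proof.
move=> b0 hf fM zT /andP[zT0 zTb].
pose l := pi / b; have l0 : 0 < l by rewrite divr_gt0 // pi_gt0.
pose E (z : R[i]) := cexp (l%:C * z).
have ReE (z : R[i]) : complex.Re (l%:C * z) = l * complex.Re z.
  by rewrite ReM /= mul0r subr0.
have ImE (z : R[i]) : complex.Im (l%:C * z) = l * complex.Im z.
  by rewrite ImM /= mul0r addr0.
have cE (z : R[i]) : cmod (E z) = expR (l * complex.Re z) by rewrite cmod_cexp ReE.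
have lb : l * b = pi by rewrite /l divfK // gt_eqF.
have ImE0 (z : R[i]) : 0 <= complex.Im z <= b -> 0 <= complex.Im (E z).
  move=> /andP[z0 zb]; rewrite Im_cexp ImE mulr_ge0 ?expR_ge0 // sin_ge0_pi //.
  by rewrite mulr_ge0 ?(ltW l0) // -lb ler_pM2l.
have ImET : 0 < complex.Im (E zT).
  rewrite Im_cexp ImE mulr_gt0 ?expR_gt0 // sin_gt0_pi //.
  by rewrite mulr_gt0 // -lb ltr_pM2l.
pose E0 := expR (l * M) / 2; have E00 : 0 < E0 by rewrite divr_gt0 ?expR_gt0.
pose D := cmod (E zT) + E0 + 1.
have D0 : 0 < D by rewrite /D; have := cmod_ge0 (E zT); lra.
pose eta := Num.min 1 (complex.Im (E zT) * E0 ^+ 2 / (16 * D ^+ 2)).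
have eta0 : 0 < eta.
  rewrite lt_min ltr01 /=; apply: divr_gt0; apply: mulr_gt0 => //; exact: exprn_gt0.
have eta1 : eta <= 1 by rewrite ge_min lexx.
have etaD : eta * (16 * D ^+ 2) <= complex.Im (E zT) * E0 ^+ 2.
  by rewrite -ler_pdivlMr ?mulr_gt0 ?exprn_gt0 // ge_min lexx orbT.
pose c : R := 8 * eta / E0 ^+ 2.
have c0 : 0 < c by apply: divr_gt0; [exact: mulr_gt0|exact: exprn_gt0].
pose w z : R[i] := E z - E0%:C + 0 +i* eta.
have Rew z : complex.Re (w z) = complex.Re (E z) - E0.
  by rewrite /w !ReD ReN /= addr0.
have Imw z : complex.Im (w z) = complex.Im (E z) + eta.
  by rewrite /w !ImD ImN /= subr0.
pose q z : R[i] := 'i%C / w z - c%:C.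
have Req z : complex.Re (q z) = (complex.Im (E z) + eta) / cmod (w z) ^+ 2 - c.
  by rewrite /q ReD Re_idiv Imw ReN.
have Imw0 z : 0 <= complex.Im z <= b -> 0 < complex.Im (w z).
  by move=> /ImE0 h; rewrite Imw ltr_wpDl.
have wn0 z : 0 <= complex.Im z <= b -> 0 < cmod (w z).
  by move=> /Imw0 h; apply: lt_le_trans (normIm _); rewrite gtr0_norm.
have qle z (A : R) : 0 <= complex.Im z <= b -> 0 < A ->
    A ^+ 2 <= cmod (w z) ^+ 2 -> complex.Im (E z) + eta <= c * A ^+ 2 ->
    complex.Re (q z) <= 0.
  move=> hz A0 Aw hI; rewrite Req subr_le0 ler_pdivrMr ?exprn_gt0 ?wn0 //.
  by apply: le_trans hI _; rewrite ler_pM2l.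
have wRe z : (complex.Re (E z) - E0) ^+ 2 <= cmod (w z) ^+ 2.
  by rewrite cmod_sqr Rew lerDl sqr_ge0.
pose e1 := Num.min eta (E0 / 2).
have e10 : 0 < e1 by rewrite lt_min eta0 divr_gt0.
pose e2 := E0 + eta + c^-1.
have e20 : 0 < e2 by rewrite !addr_gt0 ?invr_gt0.
pose x0 := Num.min (complex.Re zT) (ln e1 / l).
pose x1 := Num.max (complex.Re zT) (ln e2 / l).
have Ex0 : expR (l * x0) <= e1.
  rewrite -[leRHS]lnK ?posrE // ler_expR mulrC -ler_pdivlMr // ge_min lexx orbT //.
have Ex1 : e2 <= expR (l * x1).
  rewrite -[leLHS]lnK ?posrE // ler_expR mulrC -ler_pdivrMr // le_max lexx orbT //.
have cE0 : c * E0 ^+ 2 = 8 * eta by rewrite /c; field; rewrite gt_eqF.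
apply: (@two_constants _ f q x0 x1 0 b) => [z [_ /hf //]|z [_ hz]|z|
  |].
- apply: hol2D; last exact: hol2_cst.
  apply: hol2M; first exact: hol2_cst.
  apply: hol2V; first by rewrite -cmod_gt0 wn0.
  apply: hol2D; last exact: hol2_cst.
  apply: hol2D; last exact: hol2_cst.
  by apply: hol2_cexpf; apply: hol2M; [exact: hol2_cst|exact: hol2_id].
- move=> [[_ hz] hb]; have ImE1 : complex.Im (E z) <= cmod (E z).
    exact: le_trans (ler_norm _) (normIm _).
  case: hb => [zx|zx|zy|zy].
  + right; have cEz : cmod (E z) <= e1 by rewrite cE zx.
    move: cEz; rewrite le_min => /andP[cEz1 cEz2].
    apply: (@qle z (E0 / 2)) => //; first by rewrite divr_gt0.
      apply: le_trans (wRe z); rewrite -[leRHS]sqrrN lerXn2r ?nnegrE //.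
      - by rewrite divr_ge0 // ltW.
      - have := le_trans (ler_norm _) (normRe (E z)); lra.
      have := le_trans (ler_norm _) (normRe (E z)); lra.
    have -> : c * (E0 / 2) ^+ 2 = c * E0 ^+ 2 / 4 by field.
    rewrite cE0; lra.
  + right; have cEz : e2 <= cmod (E z) by rewrite cE zx.
    have cw : c^-1 <= cmod (w z).
      have : cmod (E0%:C - 0 +i* eta) <= E0 + eta.
        apply: le_trans (cmod_le_ReIm _) _; rewrite /= subr0 sub0r normrN.
        by rewrite !gtr0_norm.
      have := cmodB (w z) (- (E0%:C - 0 +i* eta)); rewrite cmodN.
      have -> : w z - - (E0%:C - 0 +i* eta) = E z.
        by rewrite /w; ring.
      rewrite /e2 in cEz; lra.
    rewrite Req subr_le0 -Imw.
    have wz0 := wn0 _ hz.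
    rewrite ler_pdivrMr ?exprn_gt0 //.
    apply: le_trans (ler_norm _) _; apply: le_trans (normIm _) _.
    by rewrite expr2 mulrA ler_peMl ?cmod_ge0 // -ler_pdivrMl // mulr1.
  + have zE : z = (complex.Re z)%:C by apply: eqC.
    have [xM|xM] := ltP (complex.Re z) M; first by left; rewrite zE fM.
    have EzE : E z = (expR (l * complex.Re z))%:C by rewrite /E zE -realCM cexp_real.
    have EM : E0 * 2 <= expR (l * complex.Re z).
      by rewrite /E0 divfK ?pnatr_eq0 // ler_expR ler_pM2l.
    right; apply: (@qle z E0) => //; last by rewrite EzE /= cE0; lra.
    apply: le_trans (wRe z); rewrite EzE /= lerXn2r ?nnegrE ?(ltW E00) //; lra.
  + have EzR : complex.Re (E z) = - expR (l * complex.Re z).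
      by rewrite Re_cexp ImE zy lb cospi ReE mulrN1.
    have EzI : complex.Im (E z) = 0.
      by rewrite Im_cexp ImE zy lb sinpi mulr0.
    right; apply: (@qle z E0) => //; last by rewrite EzI cE0; lra.
    apply: le_trans (wRe z); rewrite EzR -[leRHS]sqrrN.
    have := expR_gt0 (l * complex.Re z) => h.
    rewrite lerXn2r ?nnegrE ?(ltW E00) //; lra.
- split; last by rewrite !ltW.
  by rewrite ge_min le_max lexx.
have cwT : cmod (w zT) <= D.
  rewrite /w /D -!addrA; apply: cmod_leD => //.
  apply: le_trans (cmod_le_ReIm _) _; rewrite /= oppr0 addr0 add0r normrN.
  by rewrite !gtr0_norm // lerD2l.
have zTb' : 0 <= complex.Im zT <= b by rewrite !ltW.
rewrite Req subr_gt0 ltr_pdivlMr ?exprn_gt0 ?wn0 //.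
apply: (@le_lt_trans _ _ (c * D ^+ 2)).
  by rewrite ler_pM2l // lerXn2r ?nnegrE ?cmod_ge0 // ltW.
have h : eta * (16 * D ^+ 2) = 2 * (c * D ^+ 2) * E0 ^+ 2.
  by rewrite /c; field; rewrite gt_eqF.
move: etaD; rewrite h ler_pM2r ?exprn_gt0 // => h1; lra.
Qed.

End strip.

(** * S-transforms *)

Section S_transform.
Context {R : realType}.
Implicit Types (mu nu rho : probability R R) (z : R[i]) (x y : R).

Lemma pinv_in (T U : Type) (dflt : U -> T) (f : T -> U) (A : set T) u :
  (f @` A) u -> A ('pinv_dflt A f u) /\ f ('pinv_dflt A f u) = u.
Proof.
move=> uA; rewrite /pinv_ splitV.
by case: ('oinvP_[fun f in A] uA).
Qed.

Lemma pinv_out (T U : Type) (dflt : U -> T) (f : T -> U) (A : set T) u :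
  ~ (f @` A) u -> 'pinv_dflt A f u = dflt u.
Proof. by move=> uA; rewrite /pinv_ splitV oinv_surj; case: pselect. Qed.

Lemma expiD (a b : R) : expi (a + b) = expi a * expi b.
Proof. by apply: eqC; rewrite /= ?cosD ?sinD; ring. Qed.

Lemma Cint_real d (T : measurableType d) (mu : probability T R) (r : T -> R) :
  Cint mu (fun t => (r t)%:C) = (\int[mu]_t r t)%:C.
Proof. by rewrite /Cint /= Rintegral_cst // mul0r. Qed.

Lemma stieltjes_real mu x : 0 < x -> exists A : R, stieltjes mu x%:C = A%:C.
Proof.
move=> x0; exists (\int[mu]_t (`|t| + x)^-1); rewrite -Cint_real /stieltjes.
by congr Cint; apply/funext => t; rewrite realCV realCD.
Qed.

Lemma eta_stieltjes mu x (A : R) : on_pos mu -> 0 < x ->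
  stieltjes mu x%:C = A%:C -> eta mu (- x^-1) = 1 - (x * A)^-1.
Proof.
move=> mu1 x0 NA; rewrite /eta /recF invrN invrK.
have -> : (- x)%:C = - x%:C by rewrite rmorphN.
rewrite cauchyG_stieltjes //; last by apply: slitP; right.
rewrite NA -rmorphN -realCV -realCM ReD ReN /=.
by rewrite invrN mulrNN invfM.
Qed.

(** The definition of [Sigma] through the inverse of [eta], solved for the
    Stieltjes transform. Since the inverse takes the default value [0] outside
    the range of [eta], positivity of [Sigma mu y] certifies that [y] is in
    that range. *)
Lemma Sigma_stieltjes mu y : on_pos mu -> y < 0 -> 0 < Sigma mu y ->
  (- (y * Sigma mu y)^-1)%:C * stieltjes mu (- (y * Sigma mu y)^-1)%:C =
  ((1 - y)^-1)%:C.
Proof.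
move=> mu1 y0; rewrite /Sigma => S0.
have [|h0] := pselect ((eta mu @` `]-oo, 0[%classic) y); last first.
  by move: S0; rewrite /eta_inv pinv_out // mul0r ltxx.
move=> yA; have [] := pinv_in (fun=> 0) yA; rewrite -/(eta_inv mu y) /= in_itv /= => i0 iy.
rewrite mulrCA divff ?lt_eqF // mulr1.
set x := - (eta_inv mu y)^-1; have x0 : 0 < x by rewrite oppr_gt0 invr_lt0.
have [A NA] := stieltjes_real mu x0; rewrite NA -realCM.
have xE : eta_inv mu y = - x^-1 by rewrite /x invrN invrK opprK.
rewrite xE (eta_stieltjes mu1 x0 NA) in iy.
by rewrite -iy opprB addrC subrK invrK.
Qed.

Lemma hol2_value (f : R[i] -> R[i]) z c : hol2 f z ->
  (forall e : R, 0 < e -> exists2 s, cmod s < e & f (z + s) = c) -> f z = c.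
Proof.
move=> /hol2_lip[L [r [r0 L0 hL]]] hc; apply/eqP; rewrite -subr_eq0 -cmod_eq0.
rewrite eq_le cmod_ge0 andbT leNgt; apply/negP => d0.
set d := cmod _ in d0.
have e0 : 0 < Num.min r (d / (L + 1)) by rewrite lt_min r0 divr_gt0 // ltr_wpDl.
have [s] := hc _ e0; rewrite lt_min => /andP[sr]; rewrite ltr_pdivlMr ?ltr_wpDl // => sd fs.
have := hL _ sr; rewrite fs cmodBC -/d => h.
have := cmod_ge0 s; nra.
Qed.

(** The reciprocal Cauchy transform is prescribed on the upper half-plane only.
    The value at [- x] is reached along the arc [- x exp (- i theta)], [theta]
    decreasing to [0], by continuity of the Stieltjes transform. *)
Lemma stieltjes_boolean (beta : R) mu x : 0 < beta < 1 ->
  is_boolean_stable beta mu -> 0 < x ->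
  stieltjes mu x%:C = ((x + x `^ (1 - beta))^-1)%:C.
Proof.
move=> /andP[b0 b1] [mu1 Fmu] x0.
pose g (w : R[i]) : R[i] := x%:C * cexp w + (x `^ (1 - beta))%:C * cexp ((1 - beta)%:C * w).
pose f (w : R[i]) := stieltjes mu (x%:C * cexp w) * g w.
have xb0 : 0 < x `^ (1 - beta) by rewrite powR_gt0.
have s0 : x%:C * cexp 0 = x%:C by rewrite cexp0 mulr1.
have hg : hol2 g 0.
  apply: hol2D; apply: hol2M; (try exact: hol2_cst); first exact: hol2_cexp.
  by apply: hol2_cexpf; apply: hol2M; [exact: hol2_cst|exact: hol2_id].
have hf : hol2 f 0.
  apply: hol2M => //.
  apply: (@hol2_comp _ (stieltjes mu) (fun w => x%:C * cexp w)).
    by apply: hol2_stieltjes; rewrite s0; apply: slitP; right.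
  by apply: hol2M; [exact: hol2_cst|exact: hol2_cexp].
have g0 : g 0 = (x + x `^ (1 - beta))%:C.
  by rewrite /g mulr0 cexp0 !mulr1 realCD.
have g00 : 0 < x + x `^ (1 - beta) by rewrite addr_gt0.
have : f 0 = 1.
  apply: (hol2_value hf) => e e0.
  have [L [r [r0 L0 hL]]] := hol2_lip hg.
  pose th := Num.min (Num.min (e / 2) (r / 2)) (Num.min 1 ((x + x `^ (1 - beta)) / 2 / (L + 1))).
  have L1 : 0 < L + 1 by rewrite ltr_wpDl.
  have th0 : 0 < th by rewrite !lt_min !divr_gt0 //= ltr01.
  have : th <= th := lexx th.
  rewrite {2}/th !le_min => /andP[/andP[the thr] /andP[th1 thL]].
  have cth : cmod (0 -i* th : R[i]) = th.
    by rewrite /cmod /= expr0n add0r sqrrN sqrtr_sqr gtr0_norm.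
  exists (0 -i* th); first by rewrite cth; lra.
  rewrite add0r.
  have gth : g (0 -i* th) != 0.
    have := hL (0 -i* th); rewrite cth add0r => /(_ _) h.
    rewrite -cmod_gt0; have := cmodB_ge (g 0) (g (0 -i* th) - g 0).
    rewrite subrKC {1}g0 cmod_real gtr0_norm //.
    have {}h := h _; have thr' : th < r by lra.
    have {}h := h thr'; move: thL; rewrite ler_pdivlMr // => thL.
    nra.
  have pi2 := @pi_ge2 R.
  have thpi : 0 < pi - th by lra.
  pose w : R[i] := - (x%:C * cexp (0 -i* th)).
  have wE : w = (x * cos (pi - th)) +i* (x * sin (pi - th)).
    rewrite /w; apply: eqC; rewrite /= expR0 ?cosB ?sinB ?cospi ?sinpi ?cosN ?sinN; ring.
  have sth : 0 < sin (pi - th) by rewrite sin_gt0_pi // thpi /=; lra.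
  have Imw : 0 < complex.Im w by rewrite wE /= mulr_gt0.
  have cw : cmod w = x.
    by rewrite /w cmodN cmodM cmod_real cmod_cexp expR0 mulr1 gtr0_norm.
  have aw : carg w = pi - th.
    rewrite /carg (ltW Imw) cw wE /= mulrC mulKf ?gt_eqF // cosK // in_itv /=.
    by rewrite ltW //=; lra.
  have Fw : recF mu w = - g (0 -i* th).
    rewrite Fmu // /cpow cw aw /g opprD -/w; congr (_ + _).
    have -> : cexp ((1 - beta)%:C * (0 -i* th)) = expi (- ((1 - beta) * th)).
      have -> : (1 - beta)%:C * (0 -i* th) = 0 +i* (- ((1 - beta) * th)).
        by apply: eqC; rewrite /=; ring.
      by apply: eqC; rewrite /= expR0 mul1r.
    rewrite mulrCA -expiD.
    have -> : beta * pi + (1 - beta) * (pi - th) = - ((1 - beta) * th) + pi by ring.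
    have -> : expi (- ((1 - beta) * th) + pi) = - expi (- ((1 - beta) * th)).
      rewrite expiD -[RHS]mulrN1; congr (_ * _).
      by apply: eqC; rewrite /= ?cospi ?sinpi ?oppr0.
    by rewrite mulrN.
  rewrite /f.
  have : cauchyG mu w = - stieltjes mu (x%:C * cexp (0 -i* th)).
    apply: cauchyG_stieltjes => //; apply: slitP; left.
    by rewrite -oppr_eq0 -ImN gt_eqF.
  move: Fw; rewrite /recF => Fw Gw.
  have -> : stieltjes mu (x%:C * cexp (0 -i* th)) = (g (0 -i* th))^-1.
    by rewrite -[LHS]opprK -Gw -[cauchyG mu w]invrK Fw invrN opprK.
  by rewrite mulVf.
rewrite /f g0 s0 => h; rewrite realCV; apply: (mulIf (x := (x + x `^ (1 - beta))%:C)).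
  by rewrite realC_eq0 gt_eqF.
by rewrite h mulVf // realC_eq0 gt_eqF.
Qed.

(** By [stieltjes_boolean], [eta mu u = - (- u) ^ beta], whose inverse is
    explicit. *)
Lemma Sigma_boolean (beta : R) mu y : 0 < beta < 1 ->
  is_boolean_stable beta mu -> y < 0 ->
  Sigma mu y = expR ((beta^-1 - 1) * ln (- y)).
Proof.
move=> b01 bmu y0; have /andP[b0 b1] := b01; have mu1 := bmu.1.
have etaE u : u < 0 -> eta mu u = - (- u) `^ beta.
  move=> u0; pose x := - u^-1; have x0 : 0 < x by rewrite oppr_gt0 invr_lt0.
  have -> : u = - x^-1 by rewrite /x invrN invrK opprK.
  rewrite (eta_stieltjes mu1 x0 (stieltjes_boolean b01 bmu x0)) opprK.
  rewrite invfM invrK mulrDr mulVf ?gt_eqF // /powR !gt_eqF ?invr_gt0 //.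
  rewrite lnV ?posrE // mulrDl mul1r expRD mulNr expRN lnK ?posrE //.
  rewrite mulrN expRN; set A := expR _; field.
  by rewrite gt_eqF ?expR_gt0 // gt_eqF.
pose u := - expR (beta^-1 * ln (- y)).
have u0 : u < 0 by rewrite oppr_lt0 expR_gt0.
have etau : eta mu u = y.
  rewrite etaE // opprK /powR gt_eqF ?expR_gt0 // expRK mulrA divff ?gt_eqF //.
  by rewrite mul1r lnK ?opprK // posrE oppr_gt0.
have inj : {in `]-oo, 0[%classic &, injective (eta mu)}.
  move=> a b; rewrite !inE /= !in_itv /= => a0 b'0; rewrite !etaE // => /oppr_inj.
  move=> h; apply: oppr_inj; apply: (powR_injective b0) h; rewrite nnegrE oppr_ge0 ltW //.
rewrite /Sigma /eta_inv -{1}etau pinvKV ?inE //=.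
rewrite /u mulrBl mul1r expRD expRN lnK ?posrE ?oppr_gt0 // invrN.
by rewrite mulNr mulrN.
Qed.

(** Two probability measures with the same values need not be equal as
    structures, so the equality is carried through the transforms. *)
Lemma eq_Strans mu rho : (forall A, measurable A -> rho A = mu A) ->
  Strans rho = Strans mu.
Proof.
move=> h; suff e : cauchyG rho = cauchyG mu.
  apply/funext => w; rewrite /Strans /Sigma /eta_inv; congr (_ / _).
  by congr ('pinv_ _ _ _ _); apply/funext => y; rewrite /eta /recF e.
apply/funext => z; rewrite /cauchyG /Rintegral.
by congr (fine _ +i* fine _); apply: eq_measure_integral => A mA _; exact: h.
Qed.

Lemma mfconv_seq_Strans mu (s : seq (probability R R)) rho :
  is_mfconv_seq mu s rho ->
  \forall w \near 0^'-, Strans rho w = Strans mu w * \prod_(nu <- s) Strans nu w.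
Proof.
elim: s mu => [|nu s IH] mu /=.
  by move=> /eq_Strans ->; near=> w; rewrite big_nil mulr1.
move=> [sigma [_ h1] /IH h2]; near=> w.
rewrite big_cons mulrA; have <- : Strans sigma w = Strans mu w * Strans nu w.
  by near: w.
by near: w.
Unshelve. all: by end_near. Qed.

Lemma mfprod_Strans k (mu : 'I_k.+1 -> probability R R) rho :
  is_mfprod mu rho ->
  \forall w \near 0^'-, Strans rho w = \prod_i Strans (mu i) w.
Proof.
move=> /mfconv_seq_Strans h; near=> w; rewrite big_ord_recl.
have -> : \prod_(i < k) Strans (mu (lift ord0 i)) w =
    \prod_(nu <- [seq mu (lift ord0 i) | i <- enum 'I_k]) Strans nu w.
  by rewrite big_map big_enum.
by near: w.
Unshelve. all: by end_near. Qed.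

End S_transform.

(** * The functional equation in a strip *)

Section slit_strip.
Context {R : realType}.
Implicit Types (z w : R[i]) (x : R).

Lemma sin_neq0 x : `|x| < pi -> x != 0 -> sin x != 0.
Proof.
rewrite ltr_norml => /andP[x1 x2]; rewrite neq_lt => /orP[x0|x0].
  rewrite -oppr_eq0 -sinN gt_eqF // sin_gt0_pi //; lra.
by rewrite gt_eqF // sin_gt0_pi // x0.
Qed.

Lemma slit_cexp z : `|complex.Im z| < pi -> slit (cexp z).
Proof.
move=> zpi; apply: slitP; have [z0|z0] := eqVneq (complex.Im z) 0.
  by right; rewrite Re_cexp z0 cos0 mulr1 expR_gt0.
by left; rewrite Im_cexp mulf_neq0 ?sin_neq0 // gt_eqF // expR_gt0.
Qed.

Lemma slit_1Dcexp z : `|complex.Im z| < pi -> slit (1 + cexp z).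
Proof.
move=> zpi; apply: slitP; have [z0|z0] := eqVneq (complex.Im z) 0.
  by right; rewrite ReD Re_cexp z0 cos0 mulr1 addr_gt0 // expR_gt0.
by left; rewrite ImD Im_cexp add0r mulf_neq0 ?sin_neq0 // gt_eqF // expR_gt0.
Qed.

Lemma hol2_sum (I : Type) (s : seq I) (f : I -> R[i] -> R[i]) z :
  (forall i, hol2 (f i) z) -> hol2 (fun z => \sum_(i <- s) f i z) z.
Proof.
move=> hf; elim: s => [|i s IH].
  by under eq_fun do rewrite big_nil; exact: hol2_cst.
by under eq_fun do rewrite big_cons; exact: hol2D.
Qed.

Lemma hol2N (f : R[i] -> R[i]) z : hol2 f z -> hol2 (fun z => - f z) z.
Proof.
move=> hf; under eq_fun do rewrite -mulN1r.
by apply: hol2M => //; exact: hol2_cst.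
Qed.

(** The square modulus is a combination of [(1 + A) ^ 2] and [(1 - A) ^ 2],
    with [A = exp (Re z)], of weights [(1 + cos (Im z)) / 2] and
    [(1 - cos (Im z)) / 2]. *)
Lemma cmod_1Dcexp z : (1 + cos (complex.Im z)) / 2 <= cmod (1 + cexp z) ^+ 2.
Proof.
rewrite cmod_sqr ReD ImD Re_cexp Im_cexp /= add0r.
set A := expR _; set C := cos _; set S := sin _.
have -> : (1 + A * C) ^+ 2 + (A * S) ^+ 2 =
    (1 + C) / 2 * (1 + A) ^+ 2 + (1 - C) / 2 * (1 - A) ^+ 2.
  have SC : S ^+ 2 = 1 - C ^+ 2 by rewrite sin2cos2.
  by rewrite [(A * S) ^+ 2]exprMn SC; field.
have C1 : -1 <= C := cos_geN1 _; have C2 : C <= 1 := cos_le1 _.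
have A0 : 0 < A by exact: expR_gt0.
have h1 : 0 <= (1 - C) / 2 * (1 - A) ^+ 2.
  by rewrite mulr_ge0 ?sqr_ge0 // divr_ge0 // subr_ge0.
have h2 : (1 + C) / 2 * 1 <= (1 + C) / 2 * (1 + A) ^+ 2.
  rewrite ler_wpM2l ?divr_ge0 //; first lra.
  by rewrite -[leLHS](expr1n _ 2) lerXn2r ?nnegrE //; lra.
lra.
Qed.

Lemma cmod_1Dcexp_strip z (h : R) : 0 < h <= 1 / 2 ->
  0 <= complex.Im z <= pi - h -> h / 4 <= cmod (1 + cexp (- z)).
Proof.
move=> /andP[h0 h1] /andP[z0 zh]; rewrite -(@ler_pXn2r _ 2) ?nnegrE ?cmod_ge0 //; last first.
  by rewrite divr_ge0 // ltW.
apply: le_trans (cmod_1Dcexp _); rewrite ImN cosN.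
have hn : `|h| <= 1 by rewrite gtr0_norm //; lra.
have := cosB2_le hn; rewrite (gtr0_norm h0) ler_norml => /andP[_ hc].
have cz : - cos h <= cos (complex.Im z).
  have := @cosDpi R (- h); rewrite cosN => <-.
  have [->|ne] := eqVneq (complex.Im z) (- h + pi); first by [].
  have pi2 := @pi_ge2 R.
  have i1 : complex.Im z \in `[0, pi] by rewrite in_itv /= z0 /=; lra.
  have i2 : - h + pi \in `[0, pi] by rewrite in_itv /=; apply/andP; split; lra.
  by rewrite ltW // ltr_cos // lt_neqAle ne; lra.
have h2 : h ^+ 2 <= 1 / 4.
  have : h * h <= 1 / 2 * (1 / 2) by apply: ler_pM => //; exact: ltW.
  rewrite expr2; lra.
have h4 : h ^+ 4 <= h ^+ 2 / 4.
  have -> : h ^+ 4 = h ^+ 2 * h ^+ 2 by ring.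
  by rewrite ler_wpM2l ?sqr_ge0 //; lra.
have -> : (h / 4) ^+ 2 = h ^+ 2 / 16 by field.
have := sqr_ge0 h; lra.
Qed.

End slit_strip.

Section continuation.
Context {R : realType} (n : nat).
Variables (c t : R) (a p : 'I_n -> R).
Implicit Types (z w : R[i]) (x : R) (mu : probability R R).

(** With [w / (1 + w) = - exp z], this is [z] plus [t] times the logarithm of
    the S-transform at [w] of the law that is raised to the power [t]: the
    linear term comes from the Boolean stable factor and the sum from the
    factors of index [1 + a i] and multiplicity [p i]. *)
Definition Phi z : R[i] := (1 + c * t)%:C * z +
  t%:C * \sum_(i < n) (p i)%:C * cexp (- (a i)%:C * clog (1 + cexp (- z))).

(** Zero if and only if the mean of [1 / (1 + X exp (Phi z))] is
    [1 / (1 + exp z)], where [X] has law [mu]. On the real line this is the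
    definition of the S-transform of [mu]. *)
Definition defect mu z : R[i] :=
  cexp (- Phi z) * stieltjes mu (cexp (- Phi z)) - (1 + cexp z)^-1.

Lemma hol2_Phi z : `|complex.Im z| < pi -> hol2 Phi z.
Proof.
move=> zpi; apply: hol2D; apply: hol2M; (try exact: hol2_cst); (try exact: hol2_id).
apply: hol2_sum => i; apply: hol2M; first exact: hol2_cst.
apply: hol2_cexpf; apply: hol2M; first exact: hol2_cst.
apply: (@hol2_comp _ clog (fun z => 1 + cexp (- z))).
  by apply: hol2_clog; apply: slit_1Dcexp; rewrite ImN normrN.
apply: hol2D; first exact: hol2_cst.
by apply: hol2_cexpf; apply: hol2N; exact: hol2_id.
Qed.

Lemma hol2_defect mu z : `|complex.Im z| < pi -> `|complex.Im (Phi z)| < pi ->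
  hol2 (defect mu) z.
Proof.
move=> zpi Ppi; have hE : hol2 (fun z => cexp (- Phi z)) z.
  by apply: hol2_cexpf; apply: hol2N; exact: hol2_Phi.
apply: hol2D.
  apply: hol2M => //.
  apply: (@hol2_comp _ (stieltjes mu) (fun z => cexp (- Phi z))) => //.
  by apply: hol2_stieltjes; apply: slit_cexp; rewrite ImN normrN.
apply: hol2N; apply: hol2V; first by apply: slit_neq0; exact: slit_1Dcexp.
by apply: hol2D; [exact: hol2_cst|exact: hol2_cexp].
Qed.

Lemma Phi_real x : Phi x%:C = (x + t * (c * x +
  \sum_(i < n) p i * expR (- a i * ln (1 + expR (- x)))))%:C.
Proof.
rewrite /Phi.
have -> : 1 + cexp (- x%:C) = (1 + expR (- x))%:C.
  by rewrite -rmorphN cexp_real -[1 in LHS]/(1%:C) -realCD.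
rewrite clog_real ?addr_gt0 ?expR_gt0 //.
have -> : \sum_(i < n) (p i)%:C * cexp (- (a i)%:C * (ln (1 + expR (- x)))%:C) =
    (\sum_(i < n) p i * expR (- a i * ln (1 + expR (- x))))%:C.
  rewrite rmorph_sum; apply: eq_bigr => i _.
  by rewrite -rmorphN -realCM cexp_real -realCM.
rewrite -!realCM -realCD; congr (_ %:C); ring.
Qed.

(** The modulus of [exp (- a clog w)] is [cmod w ^ (- a)], at most [m ^ (- a1)]
    because [m <= 1]. *)
Lemma Im_Phi_le (a1 m : R) z : 0 <= t -> (forall i, 0 <= p i) ->
  (forall i, 0 <= a i <= a1) -> 0 < m <= 1 -> m <= cmod (1 + cexp (- z)) ->
  `|complex.Im (Phi z) - (1 + c * t) * complex.Im z| <=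
    t * ((\sum_(i < n) p i) * expR (- a1 * ln m)).
Proof.
move=> t0 p0 ha /andP[m0 m1] mw.
have -> : complex.Im (Phi z) - (1 + c * t) * complex.Im z = complex.Im (t%:C *
    \sum_(i < n) (p i)%:C * cexp (- (a i)%:C * clog (1 + cexp (- z)))).
  by rewrite /Phi ImD [complex.Im ((1 + _)%:C * z)]ImM /= mul0r addr0; ring.
apply: le_trans (normIm _) _; rewrite cmodM cmod_real ger0_norm // ler_wpM2l //.
rewrite mulr_suml.
elim/big_ind2 : _ => [|x1 y1 x2 y2 h1 h2|i _]; first by rewrite cmod0.
  exact: cmod_leD.
rewrite cmodM cmod_real ger0_norm // ler_wpM2l // cmod_cexp ler_expR.
have /andP[ai0 ai1] := ha i.
have w0 : 0 < cmod (1 + cexp (- z)) by apply: lt_le_trans mw.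
rewrite -rmorphN ReM /= mul0r subr0 !mulNr lerN2.
apply: (@le_trans _ _ (a i * ln m)).
  by rewrite ler_wnM2r // ln_le0.
by rewrite ler_wpM2l // ler_ln.
Qed.

End continuation.

Section strip_vanishing.
Context {R : realType} (n : nat).
Variables (c alpha : R) (a p : 'I_n -> R).

(** With [t = delta ^ alpha], the distance [kappa * delta] to the line
    [Im z = pi] keeps [1 + exp (- z)] above [delta] in modulus. Hence the sum
    in [Phi] moves the imaginary part by at most [(\sum_i p i) * delta], and
    the linear term by less than [delta]. So [Im (Phi z)] stays below [pi], the
    defect has second-order expansions on the strip, and it vanishes there by
    [strip_identity]. *)
Lemma defect_eq0 (rho : probability R R) (M delta kappa : R) :
  0 <= c -> 1 < alpha -> (forall i, 0 <= p i) ->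
  (forall i, 0 <= a i <= alpha - 1) ->
  4 <= kappa -> \sum_(i < n) p i + 1 <= kappa ->
  0 < delta -> kappa * delta <= 1 / 2 -> c * pi * delta `^ alpha < delta ->
  (forall x : R, x < M -> defect c (delta `^ alpha) a p rho x%:C = 0) ->
  forall z : R[i], 0 <= complex.Im z < pi - kappa * delta ->
    `|complex.Im (Phi c (delta `^ alpha) a p z)| < pi /\
    (0 < complex.Im z -> defect c (delta `^ alpha) a p rho z = 0).
Proof.
move=> c0 al1 p0 ha k4 kP d0 kd cpd hM; set t := delta `^ alpha in cpd hM *.
have t0 : 0 < t by rewrite powR_gt0.
have k0 : 0 < kappa by lra.
set h := kappa * delta in kd *; have h0 : 0 < h by rewrite mulr_gt0.
have small : t * ((\sum_(i < n) p i) * expR (- (alpha - 1) * ln (h / 4))) <=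
    (\sum_(i < n) p i) * delta.
  rewrite mulrCA; apply: ler_wpM2l; first exact: sumr_ge0.
  rewrite /t /powR gt_eqF // -expRD -[leRHS]lnK ?posrE // ler_expR.
  have -> : h / 4 = delta * (kappa / 4) by rewrite /h; ring.
  have k41 : 1 <= kappa / 4 by lra.
  rewrite lnM ?posrE //; last by lra.
  have : 0 <= ln (kappa / 4) by rewrite ln_ge0.
  by move: (ln (kappa / 4)) (ln delta) => u v u0; nra.
have key (z : R[i]) : 0 <= complex.Im z <= pi - h -> `|complex.Im (Phi c t a p z)| < pi.
  move=> hz; have h12 : 0 < h <= 1 / 2 by rewrite h0.
  have m1 : 0 < h / 4 <= 1 by rewrite divr_gt0 //=; lra.
  have hm : h / 4 <= cmod (1 + cexp (- z)) by exact: cmod_1Dcexp_strip.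
  have := @Im_Phi_le R n c t a p (alpha - 1) (h / 4) z (ltW t0) p0 ha m1 hm.
  move=> /le_trans/(_ small); rewrite ler_norml ltr_norml.
  move: hz => /andP[z0 zh] /andP[b1 b2].
  have ct0 : 0 <= c * t by rewrite mulr_ge0 // ltW.
  have pi2 := @pi_ge2 R.
  have : (1 + c * t) * complex.Im z <= (1 + c * t) * (pi - h).
    by rewrite ler_wpM2l //; lra.
  have : 0 <= (1 + c * t) * complex.Im z by rewrite mulr_ge0 //; lra.
  have : 0 <= c * t * h by rewrite mulr_ge0 // ltW.
  have : (\sum_(i < n) p i) * delta + delta <= h.
    by rewrite -[X in _ + X]mul1r -mulrDl /h ler_wpM2r // ltW.
  move=> e1 e2 e3 e4; apply/andP; split; nra.
move=> z /andP[z0 zh]; split; first by apply: key; rewrite z0 ltW.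
move=> z0'; have pi2 := @pi_ge2 R.
apply: (@strip_identity R _ (pi - h) M); [lra| |exact: hM|by rewrite z0' zh].
move=> w hw; apply: hol2_defect; last exact: key.
by move: hw => /andP[w0 wh]; rewrite ltr_norml; apply/andP; split; lra.
Qed.

End strip_vanishing.

(** * Limits at zero *)

Section limits_at_zero.
Context {R : realType}.
Implicit Types (f g : R -> R[i]) (l : R[i]).

Definition clim f l := forall e : R, 0 < e ->
  \forall d \near 0^'+, cmod (f d - l) < e.

Lemma clim_cst l : clim (fun=> l) l.
Proof. by move=> e e0; near=> d; rewrite subrr cmod0. Unshelve. all: by end_near. Qed.

Lemma climD f g l l' : clim f l -> clim g l' -> clim (fun d => f d + g d) (l + l').
Proof.
move=> hf hg e e0; have e2 : 0 < e / 2 by rewrite divr_gt0.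
near=> d; have -> : f d + g d - (l + l') = (f d - l) + (g d - l') by ring.
apply: le_lt_trans (cmodD _ _) _; rewrite (splitr e) ltrD //; near: d.
  exact: hf.
exact: hg.
Unshelve. all: by end_near. Qed.

Lemma clim_hol2 (h : R[i] -> R[i]) f l : hol2 h l -> clim f l ->
  clim (fun d => h (f d)) (h l).
Proof.
move=> /hol2_lip[L [r [r0 L0 hL]]] hf e e0.
have L1 : 0 < L + 1 by rewrite ltr_wpDl.
have m0 : 0 < Num.min r (e / (L + 1)) by rewrite lt_min r0 divr_gt0.
near=> d; have : cmod (f d - l) < Num.min r (e / (L + 1)) by near: d; exact: hf.
rewrite lt_min => /andP[fr]; rewrite ltr_pdivlMr // => fe.
have := hL _ fr; rewrite subrKC => h1.
have := cmod_ge0 (f d - l); nra.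
Unshelve. all: by end_near. Qed.

Lemma climM f g l l' : clim f l -> clim g l' -> clim (fun d => f d * g d) (l * l').
Proof.
move=> hf hg.
(* polarization reduces products to squares *)
have sq (h : R -> R[i]) m : clim h m -> clim (fun d => h d * h d) (m * m).
  move=> hh; apply: (@clim_hol2 (fun z => z * z)) => //.
  by apply: hol2M; exact: hol2_id.
have half (h : R -> R[i]) m (w : R[i]) : clim h m -> clim (fun d => w * h d) (w * m).
  move=> hh; apply: (@clim_hol2 (fun z => w * z)) => //.
  by apply: hol2M; [exact: hol2_cst|exact: hol2_id].
have h1 := half _ _ 2%:R^-1 (sq _ _ (climD hf hg)).
have h2 := half _ _ (- 2%:R^-1) (sq _ _ hf).
have h3 := half _ _ (- 2%:R^-1) (sq _ _ hg).
have := climD (climD h1 h2) h3.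
have E (x y : R[i]) : 2%:R^-1 * ((x + y) * (x + y)) + - 2%:R^-1 * (x * x) +
    - 2%:R^-1 * (y * y) = x * y by field.
by rewrite E; under eq_fun do rewrite E.
Qed.

Lemma clim_sum n (f : 'I_n -> R -> R[i]) (l : 'I_n -> R[i]) :
  (forall i, clim (f i) (l i)) ->
  clim (fun d => \sum_(i < n) f i d) (\sum_(i < n) l i).
Proof.
move=> hf; elim: (index_enum _) => [|i s IH].
  by rewrite big_nil; under eq_fun do rewrite big_nil; exact: clim_cst.
by rewrite big_cons; under eq_fun do rewrite big_cons; exact: climD.
Qed.

Lemma clim_near f g l : (\forall d \near 0^'+, f d = g d) -> clim g l -> clim f l.
Proof.
move=> fg hg e e0; near=> d; have -> : f d = g d by near: d.
by near: d; exact: hg.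
Unshelve. all: by end_near. Qed.

Lemma clim_le0 f (r : R -> R) l : (\forall d \near 0^'+, cmod (f d - l) <= r d) ->
  clim (fun d => (r d)%:C) 0 -> clim f l.
Proof.
move=> fr hr e e0; near=> d.
have h1 : cmod (f d - l) <= r d by near: d.
have : cmod ((r d)%:C - 0) < e by near: d; exact: hr.
by rewrite subr0 cmod_real; apply: le_lt_trans; apply: le_trans h1 (ler_norm _).
Unshelve. all: by end_near. Qed.

Lemma near0_gt0 : \forall d \near (0 : R)^'+, 0 < d.
Proof. exact: nbhs_right_gt. Qed.

Lemma near0_lt (e : R) : 0 < e -> \forall d \near (0 : R)^'+, d < e.
Proof. by move=> e0; exact: nbhs_right_lt. Qed.

Lemma powR_near0 (s e : R) : 0 < s -> 0 < e -> \forall d \near (0 : R)^'+, d `^ s < e.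
Proof.
move=> s0 e0; near=> d; have d0 : 0 < d by near: d; exact: near0_gt0.
have de : d < e `^ s^-1 by near: d; apply: near0_lt; exact: powR_gt0.
rewrite -[e](@powRr1 _) ?ltW // -(@mulVf _ s) ?gt_eqF // powRrM.
by rewrite gt0_ltr_powR // nnegrE ?powR_ge0 // ltW.
Unshelve. all: by end_near. Qed.

Lemma clim_powR (s : R) : 0 < s -> clim (fun d => (d `^ s)%:C) 0.
Proof.
move=> s0 e e0; near=> d.
rewrite subr0 cmod_real ger0_norm ?powR_ge0 //.
by near: d; exact: powR_near0.
Unshelve. all: by end_near. Qed.

Lemma clim_id : clim (fun d => d%:C) 0.
Proof.
move=> e e0; near=> d; rewrite subr0 cmod_real gtr0_norm; near: d.
  exact: near0_lt.
exact: near0_gt0.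
Unshelve. all: by end_near. Qed.

(** The function [1 / (1 - exp w)] has residue [-1] at its pole [0]. Off a
    neighbourhood of [0], a point of small imaginary part has a real part bounded
    away from [0], which keeps [exp w] off the unit circle. *)
Lemma bose_bound : exists C r : R, [/\ 0 <= C, 0 < r & forall w : R[i],
  w != 0 -> `|complex.Im w| <= r -> cmod ((1 - cexp w)^-1 + w^-1) <= C].
Proof.
have [Q hQ eE] := @hol2_cexp0 R.
have bT : bnd (fun w => 2%:R^-1 + w * Q w) by bnd_tac.
have [B [r1 [r10 hB]]] := bT.
have half0 : (0 : R) < 1 / 2 by rewrite divr_gt0.
have [r2 [r20 h2]] := bnd_small bT half0.
pose r := Num.min r1 r2; have r0 : 0 < r by rewrite lt_min r10.
have B0 : 0 <= B by apply: le_trans (hB 0 _); rewrite ?cmod_ge0 ?cmod0.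
pose m := Num.min (expR (r / 2) - 1) (1 - expR (- (r / 2))).
have m0 : 0 < m.
  rewrite lt_min !subr_gt0 -{1}(@expR0 R) ltr_expR divr_gt0 //=.
  by rewrite -{2}(@expR0 R) ltr_expR oppr_lt0 divr_gt0.
exists (2 * B + m^-1 + (r / 2)^-1), (r / 2); split.
- by rewrite !addr_ge0 ?mulr_ge0 ?invr_ge0 ?divr_ge0 // ltW.
- by rewrite divr_gt0.
move=> w w0 wr; have [wr'|wr'] := ltP (cmod w) r.
  pose T := 2%:R^-1 + w * Q w.
  have TB : cmod T <= B by apply: hB; move: wr'; rewrite lt_min => /andP[].
  have Ts : cmod (w * T) < 1 / 2 by apply: h2; move: wr'; rewrite lt_min => /andP[].
  have e1 : 1 - cexp w = - (w * (1 + w * T)) by rewrite eE /T; field.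
  have d2 : 1 / 2 <= cmod (1 + w * T).
    by have := cmodB_ge 1 (w * T); rewrite cmod1; lra.
  have dn : 1 + w * T != 0 by rewrite -cmod_gt0; lra.
  have -> : (1 - cexp w)^-1 + w^-1 = T / (1 + w * T).
    by rewrite e1; field; rewrite w0 dn.
  rewrite cmodM cmodV.
  have : cmod T / cmod (1 + w * T) <= 2 * B.
    rewrite ler_pdivrMr; last lra.
    have : B * (1 / 2) <= B * cmod (1 + w * T) by rewrite ler_wpM2l.
    lra.
  have : 0 <= m^-1 by rewrite invr_ge0 ltW.
  have : 0 <= (r / 2)^-1 by rewrite invr_ge0 divr_ge0 // ltW.
  lra.
have xr : r / 2 <= `|complex.Re w|.
  have := cmod_le_ReIm w; lra.
have em : m <= cmod (1 - cexp w).
  have h1 := cmodB_ge (cexp w) (1 - cexp w); rewrite subrKC cmod1 in h1.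
  have h3 := cmodB_ge 1 (- cexp w); rewrite cmodN cmod1 in h3.
  rewrite cmod_cexp in h1 h3.
  have h1' : expR (complex.Re w) - 1 <= cmod (1 - cexp w).
    have := cmodB (1 : R[i]) (1 - cexp w); have -> : 1 - (1 - cexp w) = cexp w by ring.
    rewrite cmod1 cmod_cexp; lra.
  move: xr; rewrite ler_normr => /orP[xr|xr].
    apply: le_trans h1'; rewrite ge_min lerD2r ler_expR xr //.
  apply: le_trans h3; rewrite ge_min lerD2l lerN2 ler_expR.
  by apply/orP; right; lra.
have en : 0 < cmod (1 - cexp w) by apply: lt_le_trans em.
apply: le_trans (cmodD _ _) _; rewrite !cmodV.
have : (cmod (1 - cexp w))^-1 <= m^-1 by rewrite lef_pV2 ?posrE.
have : (cmod w)^-1 <= (r / 2)^-1.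
  rewrite lef_pV2 ?posrE ?divr_gt0 ?cmod_gt0 //; lra.
have : 0 <= 2 * B by rewrite mulr_ge0.
lra.
Qed.

End limits_at_zero.

(** * Asymptotics at the pole *)

Section asymptotics.
Context {R : realType} (k : nat).
Variables (c alpha : R) (al p : 'I_k.+1 -> R).
Hypothesis c0 : 0 <= c.
Hypothesis alpha12 : 1 < alpha.
Hypothesis al0 : al ord0 = alpha.
Hypothesis al_lt : forall i, i != ord0 -> al i < alpha.
Hypothesis al_gt1 : forall i, 1 < al i.
Hypothesis p0 : forall i, 0 <= p i.
Implicit Types (u v : R[i]) (d : R).

Let a i := al i - 1.
Let Phid d z := Phi c (d `^ alpha) a p z.

(** Coordinates at scale [d] around [i * pi], the pole of [1 / (1 + exp z)]. *)
Definition zoom d u : R[i] := d%:C * u + 0 +i* pi.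

(** [Phi] in the same coordinates, at the source and at the target. *)
Definition slope d u : R[i] := (d^-1)%:C * (Phid d (zoom d u) - 0 +i* pi).

Definition slope_lim u : R[i] :=
  u + (p ord0)%:C * cexp (- (a ord0)%:C * clog u).

Lemma cexp_zoom d u : cexp (zoom d u) = - cexp (d%:C * u).
Proof. exact: cexp_pi. Qed.

Lemma subVV (x y : R[i]) : x != 0 -> y != 0 ->
  x^-1 - y^-1 = x^-1 * y^-1 * (y - x).
Proof. by move=> x0 y0; field; rewrite x0 y0. Qed.

Lemma near0_neq0 (f : R -> R[i]) l : l != 0 -> clim f l ->
  \forall d \near 0^'+, f d != 0.
Proof.
move=> l0 hf; near=> d.
have : cmod (f d - l) < cmod l by near: d; apply: hf; rewrite cmod_gt0.
by apply: contraTN => /eqP ->; rewrite sub0r cmodN ltxx.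
Unshelve. all: by end_near. Qed.

(** Near [i * pi], [1 + exp (- z)] is [1 - exp (- d u)], of order [d u]. As
    [t = d ^ alpha], the term of index [al i] is of order
    [d ^ (1 + alpha - al i)]: only the largest index contributes at scale [d].
    *)
Lemma slope_cvg u : complex.Im u < 0 -> clim (slope^~ u) (slope_lim u).
Proof.
move=> u0; have su : slit u by apply: slitP; left; rewrite lt_eqF.
have un0 := slit_neq0 su.
have [Q hQ eE] := @hol2_cexp0 R.
have bT : bnd (fun w => 2%:R^-1 + w * Q w) by bnd_tac.
pose T w : R[i] := 2%:R^-1 + w * Q w.
pose ud d : R[i] := u * (1 + - (d%:C * u) * T (- (d%:C * u))).
have udE d : 1 - cexp (- (d%:C * u)) = d%:C * ud d.
  by rewrite eE /ud /T; field.
have climud : clim ud u.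
  have -> : u = u * (1 + 0) by rewrite addr0 mulr1.
  apply: climM; first exact: clim_cst.
  apply: climD; first exact: clim_cst.
  move=> e e0; have [r [r0 hr]] := bnd_small bT e0.
  have cu : 0 < cmod u by rewrite cmod_gt0.
  near=> d; rewrite subr0; apply: hr; rewrite cmodN cmodM cmod_real.
  have d0 : 0 < d by near: d; exact: near0_gt0.
  rewrite gtr0_norm // -ltr_pdivlMr //; near: d; apply: near0_lt.
  by rewrite divr_gt0.
pose term i d : R[i] := (p i)%:C * ((d `^ (alpha - al i))%:C *
  cexp (- (a i)%:C * clog (ud d))).
have slopeE : \forall d \near 0^'+, slope d u = (1 + c%:C * (d `^ alpha)%:C) * u +
    c%:C * (d `^ (alpha - 1))%:C * (0 +i* pi) + \sum_(i < k.+1) term i d.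
  near=> d; have d0 : 0 < d by near: d; exact: near0_gt0.
  have ud0 : ud d != 0 by near: d; exact: near0_neq0 climud.
  have dn : (d%:C : R[i]) != 0 by rewrite realC_eq0 gt_eqF.
  rewrite /slope /Phid /Phi cexpN cexp_zoom invrN -cexpN udE clog_scale //.
  have -> : d `^ (alpha - 1) = d^-1 * d `^ alpha.
    by rewrite powRD ?(gt_eqF d0) ?implybT // powRN powRr1 ?ltW // mulrC.
  have -> : \sum_(i < k.+1) term i d = (d^-1)%:C * ((d `^ alpha)%:C *
      \sum_(i < k.+1) (p i)%:C * cexp (- (a i)%:C * ((ln d)%:C + clog (ud d)))).
    rewrite mulrA mulr_sumr; apply: eq_bigr => i _.
    have aln : - (a i)%:C * (ln d)%:C = (- a i * ln d)%:C.
      by rewrite realCM rmorphN.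
    rewrite /term mulrDr cexpD aln cexp_real.
    have -> : d `^ (alpha - al i) = d^-1 * d `^ alpha * expR (- a i * ln d).
      rewrite /powR gt_eqF // -{2}[d]lnK ?posrE // -expRN -!expRD.
      by congr expR; rewrite /a; ring.
    by rewrite !realCM; ring.
  rewrite realCD !realCM realCV /zoom; field.
  exact: dn.
have alim i : clim (term i) (if i == ord0 then (p ord0)%:C *
    cexp (- (a ord0)%:C * clog u) else 0).
  have hE : clim (fun d => cexp (- (a i)%:C * clog (ud d))) (cexp (- (a i)%:C * clog u)).
    apply: (@clim_hol2 _ (fun z => cexp (- (a i)%:C * clog z))) => //.
    apply: hol2_cexpf; apply: hol2M; first exact: hol2_cst.
    exact: hol2_clog.
  case: eqP => [i0|/eqP i0].
    rewrite i0 in hE *; apply: climM; first exact: clim_cst.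
    rewrite /term -[X in clim _ X]mul1r; apply: climM => //.
    have -> : (fun d : R => (d `^ (alpha - al ord0))%:C : R[i]) = fun=> 1.
      by apply/funext => d; rewrite al0 subrr powRr0.
    exact: clim_cst.
  have -> : (0 : R[i]) = (p i)%:C * (0 * cexp (- (a i)%:C * clog u)).
    by rewrite mul0r mulr0.
  apply: climM; first exact: clim_cst.
  by apply: climM => //; apply: clim_powR; rewrite subr_gt0 al_lt.
apply: (clim_near slopeE).
have -> : slope_lim u = (1 + c%:C * 0) * u + c%:C * 0 * (0 +i* pi) +
    \sum_(i < k.+1) (if i == ord0 then (p ord0)%:C *
    cexp (- (a ord0)%:C * clog u) else 0).
  rewrite -big_mkcond big_pred1_eq mulr0 mul0r !addr0 mul1r //.
apply: climD; last exact: clim_sum.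
have al00 : 0 < alpha by apply: lt_trans alpha12.
apply: climD.
  apply: climM; last by apply: clim_cst.
  apply: climD; first by apply: clim_cst.
  by apply: climM; [apply: clim_cst|apply: clim_powR].
apply: climM; last by apply: clim_cst.
by apply: climM; [apply: clim_cst|apply: clim_powR; rewrite subr_gt0].
Unshelve. all: by end_near. Qed.

Variables (rho : R -> probability R R) (M : R).
Hypothesis rho_pos : forall d, 0 < d -> on_pos (rho d).
Hypothesis rhoM : forall d x : R, 0 < d -> x < M ->
  defect c (d `^ alpha) a p (rho d) x%:C = 0.

Let kappa := 5 + \sum_(i < k.+1) p i.

Lemma cmeas_ln d (w : R[i]) : @cmeas R _ R (fun x => w + (ln x / d)%:C).
Proof.
apply: cmeasD; first exact: cmeas_cst.
apply: cmeas_real; apply: measurable_funM; first exact: measurable_ln.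
exact: measurable_cst.
Qed.

Lemma Im_addr_real (w : R[i]) (x : R) : complex.Im (w + x%:C) = complex.Im w.
Proof. by rewrite ImD /= addr0. Qed.

Lemma addr_real_neq0 (w : R[i]) (x : R) : complex.Im w != 0 -> w + x%:C != 0.
Proof.
by apply: contraNneq => h; rewrite -(Im_addr_real w x) h.
Qed.

Lemma cbounded_resolvent d (w : R[i]) : complex.Im w != 0 ->
  @cbounded R _ R (fun x => (w + (ln x / d)%:C)^-1).
Proof.
move=> w0; apply: (@cboundedV _ _ _ _ `|complex.Im w|); first by rewrite normr_gt0.
  exact: cmeas_ln.
by move=> x; rewrite -(Im_addr_real w (ln x / d)); exact: normIm.
Qed.

Lemma cmeas_bose d (w : R[i]) :
  @cmeas R _ R (fun x => (1 - cexp (d%:C * (w + (ln x / d)%:C)))^-1).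
Proof.
have -> : (fun x : R => (1 - cexp (d%:C * (w + (ln x / d)%:C)))^-1) =
    (fun x : R => (1 + (- cexp (d%:C * w)) * (expR (d * (ln x / d)))%:C)^-1).
  by apply/funext => x; rewrite mulrDr cexpD -realCM cexp_real mulNr.
apply: cmeasV; apply: cmeasD; first exact: cmeas_cst.
apply: cmeasM; first exact: cmeas_cst.
apply: cmeas_real; apply: measurableT_comp; first exact: measurable_expR.
apply: measurable_funM; first exact: measurable_cst.
by apply: measurable_funM; [exact: measurable_ln|exact: measurable_cst].
Qed.

Lemma kappa_ge4 : 4 <= kappa.
Proof. by have : 0 <= \sum_(i < k.+1) p i by [exact: sumr_ge0]; rewrite /kappa; lra. Qed.

(** The vanishing of the defect at [zoom d u], where both exponentials change
    sign. *)
Lemma bose_identity u : complex.Im u < - kappa ->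
  \forall d \near 0^'+, Cint (rho d)
    (fun x => (1 - cexp (d%:C * (slope d u + (ln x / d)%:C)))^-1) =
    (1 - cexp (d%:C * u))^-1.
Proof.
move=> uk; have k4 := kappa_ge4; have k0 : 0 < kappa by lra.
have pi0 := @pi_gt0 R.
have cp0 : 0 <= c * pi by rewrite mulr_ge0 // ltW.
have cp : 0 < c * pi + 1 by rewrite ltr_wpDl.
near=> d; have d0 : 0 < d by near: d; exact: near0_gt0.
have kd : kappa * d <= 1 / 2.
  by rewrite -ler_pdivlMl // ltW //; near: d; apply: near0_lt; rewrite !mulr_gt0 ?invr_gt0.
have cpd : c * pi * d `^ alpha < d.
  have -> : d `^ alpha = d `^ (alpha - 1) * d.
    rewrite -{3}(@powRr1 _ d) ?ltW // -powRD ?subrK //.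
    by rewrite (gt_eqF d0) implybT.
  rewrite mulrA gtr_pMl //.
  have hd : d `^ (alpha - 1) < (c * pi + 1)^-1.
    by near: d; apply: powR_near0; rewrite ?invr_gt0 // subr_gt0.
  have : (c * pi + 1) * d `^ (alpha - 1) < 1 by rewrite -ltr_pdivlMl // mulr1.
  have := powR_ge0 d (alpha - 1); lra.
have ud : d * (- complex.Im u) < pi.
  by rewrite -ltr_pdivlMr; [near: d; apply: near0_lt; rewrite divr_gt0 //; lra|lra].
have dn : (d%:C : R[i]) != 0 by rewrite realC_eq0 gt_eqF.
have ImZ : complex.Im (zoom d u) = d * complex.Im u + pi.
  by rewrite /zoom ImD ImM /= mul0r addr0.
have hz : 0 <= complex.Im (zoom d u) < pi - kappa * d.
  rewrite ImZ; apply/andP; split; first lra.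
  have : d * complex.Im u < d * - kappa by rewrite ltr_pM2l.
  lra.
have hz0 : 0 < complex.Im (zoom d u) by rewrite ImZ; lra.
have ha i : 0 <= a i <= alpha - 1.
  rewrite /a subr_ge0 ltW //= lerD2r; have [->|/al_lt/ltW //] := eqVneq i ord0.
  by rewrite al0.
have kP : \sum_(i < k.+1) p i + 1 <= kappa by rewrite /kappa; lra.
have [Phipi /(_ hz0)] := @defect_eq0 R _ c alpha a p (rho d) M d kappa c0 alpha12 p0
  ha k4 kP d0 kd cpd (fun x => @rhoM d x d0) _ hz.
rewrite /defect cexp_zoom => /eqP; rewrite subr_eq0 => /eqP <-.
set g := cexp _; have sg : slit g by apply: slit_cexp; rewrite ImN normrN.
have gE : g^-1 = - cexp (d%:C * slope d u).
  rewrite /g -cexpN opprK -cexp_pi; congr cexp.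
  by rewrite /slope /Phid realCV mulrA divff // mul1r subrK.
rewrite /stieltjes -CintZ; last exact: cbounded_stieltjes.
apply: (@eq_Cint_full R _ _ (rho d) `]0, +oo[%classic) => //.
- exact: rho_pos.
- exact: cmeas_bose.
- by apply: cmeasM; [exact: cmeas_cst|have [] := cbounded_stieltjes sg].
move=> x /=; rewrite in_itv /= andbT => x0.
have g0 := slit_neq0 sg.
have -> : cexp (d%:C * (slope d u + (ln x / d)%:C)) = - (x%:C / g).
  have dl : d * (ln x / d) = ln x by rewrite mulrC divfK ?gt_eqF.
  by rewrite mulrDr cexpD -realCM dl cexp_real lnK ?posrE // gE; ring.
rewrite opprK gtr0_norm // -[g in RHS]invrK -invfM; congr (_^-1).
by rewrite invrK mulrDr mulVf // addrC mulrC.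
Unshelve. all: by end_near. Qed.

(** Multiply [bose_identity] by [d] and let [d] tend to [0]: by [bose_bound]
    each [1 / (1 - exp (d w))] may be replaced by [- 1 / (d w)] at a uniformly
    bounded cost, and [slope d u] by its limit, away from the real line. *)
Lemma resolvent_cvg u : complex.Im u < - kappa -> complex.Im (slope_lim u) < 0 ->
  clim (fun d => Cint (rho d) (fun x => (slope_lim u + (ln x / d)%:C)^-1)) u^-1.
Proof.
move=> uk v0; have k4 := kappa_ge4.
have u0 : complex.Im u < 0 by lra.
have un0 : u != 0 by apply/eqP => h; move: u0; rewrite h ltxx.
have [C [r [C0 r0 hC]]] := @bose_bound R.
set v := slope_lim u in v0 *.
have vcvg := slope_cvg u0; rewrite -/v in vcvg.
pose y := - complex.Im v; have y0 : 0 < y by rewrite oppr_gt0.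
apply: (@clim_le0 _ _ (fun d => 3 * C * d + 4 / y ^+ 2 * cmod (slope d u - v))); last first.
  have -> : (0 : R[i]) = (3 * C)%:C * 0 + (4 / y ^+ 2)%:C * 0 by rewrite !mulr0 addr0.
  under eq_fun do rewrite (realCD (3 * C * _)) (realCM (3 * C)) (realCM (4 / y ^+ 2)).
  apply: climD.
    by apply: climM; [apply: clim_cst|apply: clim_id].
  apply: climM; first by apply: clim_cst.
  move=> e e0; near=> d; rewrite subr0 cmod_real ger0_norm ?cmod_ge0 //.
  by near: d; exact: vcvg.
near=> d; have d0 : 0 < d by near: d; exact: near0_gt0.
have dn : (d%:C : R[i]) != 0 by rewrite realC_eq0 gt_eqF.
have vdv : cmod (slope d u - v) < y / 2 by near: d; apply: vcvg; rewrite divr_gt0.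
have bE : Cint (rho d) (fun x => (1 - cexp (d%:C * (slope d u + (ln x / d)%:C)))^-1) =
    (1 - cexp (d%:C * u))^-1 by near: d; exact: bose_identity.
have dr : d * (3 / 2 * y) <= r.
  rewrite -ler_pdivlMr; last by rewrite mulr_gt0 // divr_gt0.
  by rewrite ltW //; near: d; apply: near0_lt; rewrite divr_gt0 // mulr_gt0 // divr_gt0.
have dru : d * - complex.Im u <= r.
  rewrite -ler_pdivlMr ?oppr_gt0 //.
  by rewrite ltW //; near: d; apply: near0_lt; rewrite divr_gt0 // oppr_gt0.
set vd := slope d u in vdv bE *.
have Imvd : complex.Im vd <= - (y / 2).
  have := normIm (vd - v); rewrite ImD ImN ler_norml => /andP[_]; rewrite /y in vdv *; lra.
have Imvd' : - (3 / 2 * y) <= complex.Im vd.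
  have := normIm (vd - v); rewrite ImD ImN ler_norml => /andP[+ _]; rewrite /y in vdv *; lra.
have Ivd0 : complex.Im vd != 0 by rewrite lt_eqF //; lra.
have Iv0 : complex.Im v != 0 by rewrite lt_eqF.
have Imr (w : R[i]) : complex.Im (d%:C * w) = d * complex.Im w.
  by rewrite ImM /= mul0r addr0.
pose bose x : R[i] := (1 - cexp (d%:C * (vd + (ln x / d)%:C)))^-1.
pose res x : R[i] := (vd + (ln x / d)%:C)^-1.
have bres : cbounded res by exact: cbounded_resolvent.
have Z w (f : R -> R[i]) : cbounded f -> cbounded (fun x : R => w * f x).
  by move=> hf; apply: cboundedM => //; exact: cbounded_cst.
have near_bose x : cmod (bose x + (d^-1)%:C * res x) <= C.
  rewrite /bose /res realCV -invfM; apply: hC.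
    by rewrite mulf_neq0 ?addr_real_neq0.
  rewrite Imr Im_addr_real normrM gtr0_norm // ler0_norm; last lra.
  by apply: le_trans dr; rewrite ler_pM2l //; lra.
have bbose : cbounded bose.
  split; first exact: cmeas_bose.
  have [_ [N hN]] := Z (d^-1)%:C _ bres.
  exists (C + N) => x; have := cmodB (bose x + (d^-1)%:C * res x) ((d^-1)%:C * res x).
  rewrite addrK => /le_trans; apply; apply: lerD; [exact: near_bose|exact: hN].
have h1 : cmod (Cint (rho d) bose + (d^-1)%:C * Cint (rho d) res) <= 2 * C.
  have bZ := Z (d^-1)%:C _ bres; have [mD _] := cboundedD bbose bZ.
  rewrite -(CintZ _ _ bres) -(CintD _ bbose bZ).
  exact: (Cint_le _ mD near_bose).
have h2 : cmod ((1 - cexp (d%:C * u))^-1 + (d%:C * u)^-1) <= C.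
  apply: hC; first by rewrite mulf_neq0.
  by rewrite Imr normrM gtr0_norm // ler0_norm // ltW.
rewrite bE in h1.
have h3 : cmod (Cint (rho d) res - u^-1) <= 3 * C * d.
  have -> : Cint (rho d) res - u^-1 = d%:C * (((1 - cexp (d%:C * u))^-1 +
      (d^-1)%:C * Cint (rho d) res) - ((1 - cexp (d%:C * u))^-1 + (d%:C * u)^-1)).
    rewrite realCV; set I := Cint _ _; set b := (1 - _)^-1.
    by field; rewrite dn un0.
  rewrite cmodM cmod_real gtr0_norm // mulrC ler_wpM2r ?(ltW d0) //.
  apply: le_trans (cmodB _ _) _; lra.
have h4 : cmod (Cint (rho d) (fun x => (v + (ln x / d)%:C)^-1) - Cint (rho d) res)
    <= 4 / y ^+ 2 * cmod (vd - v).
  have -> : 4 / y ^+ 2 * cmod (vd - v) = 2 * (2 / y ^+ 2 * cmod (vd - v)) by ring.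
  apply: Cint_close => //; first exact: cbounded_resolvent.
  move=> x; rewrite /res; set L := (ln x / d)%:C.
  have n1 : v + L != 0 by exact: addr_real_neq0.
  have n2 : vd + L != 0 by exact: addr_real_neq0.
  rewrite subVV // (_ : vd + L - (v + L) = vd - v); last by ring.
  rewrite cmodM ler_wpM2r ?cmod_ge0 // cmodM !cmodV.
  have -> : 2 / y ^+ 2 = y^-1 * (y / 2)^-1 by field; rewrite gt_eqF.
  apply: ler_pM; rewrite ?invr_ge0 ?cmod_ge0 // lef_pV2 ?posrE ?cmod_gt0 ?divr_gt0 //.
    by apply: le_trans (normIm _); rewrite Im_addr_real ler0_norm // ltW.
  by apply: le_trans (normIm _); rewrite Im_addr_real ler0_norm; lra.
have -> : Cint (rho d) (fun x => (v + (ln x / d)%:C)^-1) - u^-1 =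
  (Cint (rho d) res - u^-1) + (Cint (rho d) (fun x => (v + (ln x / d)%:C)^-1) -
   Cint (rho d) res) by ring.
exact: cmod_leD.
Unshelve. all: by end_near. Qed.

End asymptotics.

(** * Bernstein polynomials *)

Section bernstein.
Context {R : realType}.
Implicit Types (s : R) (phi : nat -> R).

(** The mean of [phi] under the binomial law of parameters [n] and [s], by
    conditioning on the first trial; the moments are then polynomial identities. *)
Fixpoint bern s n phi : R :=
  if n is n'.+1 then s * bern s n' (fun i => phi i.+1) + (1 - s) * bern s n' phi
  else phi 0%N.

Lemma bern_le s n phi psi : 0 <= s <= 1 -> (forall i, phi i <= psi i) ->
  bern s n phi <= bern s n psi.
Proof.
move=> /andP[s0 s1]; elim: n phi psi => [|n IH] phi psi h /=; first exact: h.
by apply: lerD; apply: ler_wpM2l; rewrite ?subr_ge0 //; apply: IH.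
Qed.

Lemma bern_affine s n phi (a b : R) :
  bern s n (fun i => a + b * phi i) = a + b * bern s n phi.
Proof.
elim: n phi => [//|n IH] phi /=.
by rewrite (IH (fun i => phi i.+1)) IH; ring.
Qed.

Lemma bern_sqr s n (m : R) : bern s n (fun i => (i%:R - m) ^+ 2) =
  n%:R * s * (1 - s) + (n%:R * s - m) ^+ 2.
Proof.
elim: n m => [|n IH] m /=; first by ring.
have -> : (fun i => (i.+1%:R - m) ^+ 2) = (fun i : nat => (i%:R - (m - 1)) ^+ 2 : R).
  by apply/funext => i; rewrite -natr1; congr (_ ^+ 2); ring.
by rewrite !IH -natr1; ring.
Qed.

Lemma uniform_modulus (g : R -> R) (e : R) : continuous g -> 0 < e ->
  exists2 h : R, 0 < h & forall x y : R, 0 <= x <= 1 -> `|x - y| < h -> `|g x - g y| <= e.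
Proof.
move=> gc e0.
have /compact_near_coveringP cov : compact `[(0 : R), 1]%classic by exact: segment_compact.
have : \forall h \near (0 : R)^'+, forall x, `[(0 : R), 1]%classic x ->
    forall y, `|x - y| < h -> `|g x - g y| <= e.
  apply: cov => x _; have e2 : 0 < e / 2 by rewrite divr_gt0.
  have /cvgrPdist_lt/(_ _ e2)/nbhs_ballP[d /= d0 hd] := gc x.
  have d2 : 0 < d / 2 by rewrite divr_gt0.
  exists (ball x (d / 2), [set h | h < d / 2]); first split.
  - exact: nbhsx_ballx.
  - exact: nbhs_right_lt.
  move=> [x' h] [/= xx' hd2] y x'y.
  have h1 : `|g x - g x'| < e / 2.
    by apply: hd; rewrite /ball /=; apply: lt_trans xx' _; lra.
  have h2 : `|g x - g y| < e / 2.
    apply: hd; rewrite /ball /=; apply: le_lt_trans (ler_distD x' _ _) _.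
    by move: xx'; rewrite /ball /= => xx'; lra.
  rewrite (_ : g x' - g y = (g x - g y) - (g x - g x')); last by ring.
  apply: le_trans (ler_normB _ _) _; lra.
move=> hn; have [h [h0 hh]] : exists h : R, 0 < h /\ forall x, `[(0 : R), 1]%classic x ->
    forall y, `|x - y| < h -> `|g x - g y| <= e.
  near ((0 : R)^'+) => h; exists h; split; first by near: h; exact: nbhs_right_gt.
  by near: h.
by exists h => // x y hx; apply: hh; rewrite /= in_itv.
Unshelve. all: by end_near. Qed.

(** Chebyshev's argument: [|g s - g y| <= e / 2 + C (y - s) ^ 2] for all [y],
    and averaging the square over the binomial law gives at most [1 / n]. *)
Lemma bernstein (g : R -> R) (K e : R) : continuous g -> (forall x, `|g x| <= K) ->
  0 < e -> exists n, forall s, 0 <= s <= 1 ->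
    `|g s - bern s n (fun i => g (i%:R / n%:R))| <= e.
Proof.
move=> gc gK e0; have e2 : 0 < e / 2 by rewrite divr_gt0.
have [h h0 hh] := uniform_modulus gc e2.
have K0 : 0 <= K by apply: le_trans (gK 0); exact: normr_ge0.
pose C := 2 * K / h ^+ 2.
have C0 : 0 <= C by apply: divr_ge0; [exact: mulr_ge0|exact: sqr_ge0].
have quad s y : 0 <= s <= 1 -> `|g s - g y| <= e / 2 + C * (y - s) ^+ 2.
  move=> s01; have [sy|sy] := ltP `|s - y| h.
    apply: le_trans (hh _ _ s01 sy) _; rewrite lerDl mulr_ge0 ?sqr_ge0 //.
  apply: (@le_trans _ _ (2 * K)).
    by apply: le_trans (ler_normB _ _) _; have := gK s; have := gK y; lra.
  apply: (@le_trans _ _ (C * h ^+ 2)).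
    by rewrite /C divfK // gt_eqF // exprn_gt0.
  have : C * h ^+ 2 <= C * (y - s) ^+ 2.
    rewrite ler_wpM2l // -[leRHS]real_normK ?num_real // distrC.
    by rewrite lerXn2r ?nnegrE ?normr_ge0 // ltW.
  lra.
pose n := (Num.truncn (2 * C / e)).+1; exists n => s s01.
have n0 : 0 < n%:R :> R by rewrite ltr0n.
have nC : 2 * C < e * n%:R.
  by rewrite -ltr_pdivrMl // mulrC; exact: truncnS_gt.
have var : bern s n (fun i => (i%:R / n%:R - s) ^+ 2) = s * (1 - s) / n%:R.
  have -> : (fun i : nat => (i%:R / n%:R - s) ^+ 2 : R) =
      (fun i : nat => 0 + n%:R ^- 2 * (i%:R - n%:R * s) ^+ 2).
    by apply/funext => i; field; rewrite gt_eqF.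
  by rewrite bern_affine bern_sqr; field; rewrite gt_eqF.
have bound : e / 2 + C * (s * (1 - s) / n%:R) <= e.
  have : C * (s * (1 - s) / n%:R) <= C / n%:R.
    rewrite ler_wpM2l // ler_pdivrMr // mulVf ?gt_eqF //.
    move: s01 => /andP[s0 s1]; nra.
  have : C / n%:R <= e / 2 by rewrite ler_pdivrMr //; lra.
  lra.
have up : bern s n (fun i => g (i%:R / n%:R)) <=
    g s + e / 2 + C * (s * (1 - s) / n%:R).
  rewrite -var -bern_affine; apply: bern_le => // i.
  have := quad s (i%:R / n%:R) s01; rewrite ler_norml => /andP[? ?]; lra.
have low : g s - e / 2 - C * (s * (1 - s) / n%:R) <=
    bern s n (fun i => g (i%:R / n%:R)).
  have -> : g s - e / 2 - C * (s * (1 - s) / n%:R) =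
    (g s - e / 2) + (- C) * (s * (1 - s) / n%:R) by ring.
  rewrite -var -bern_affine; apply: bern_le => // i.
  have := quad s (i%:R / n%:R) s01; rewrite ler_norml => /andP[? ?]; lra.
rewrite ler_norml; apply/andP; split; lra.
Qed.

End bernstein.

(** * The span of the resolvents *)

Section resolvent_algebra.
Context {R : realType}.
Implicit Types (f g : R -> R[i]) (v w : R[i]) (x : R) (W : set R[i]).

Definition res w x : R[i] := (w + x%:C)^-1.

(** The sets of functions for which convergence of means passes from the
    resolvents to everything they approximate. *)
Record uniform_span_closed (S : (R -> R[i]) -> Prop) : Prop := {
  usc_add : forall f g, S f -> S g -> S (fun x => f x + g x);
  usc_scale : forall w f, S f -> S (fun x => w * f x);
  usc_lim : forall f, cbounded f -> (forall e : R, 0 < e ->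
    exists2 g, S g & forall x, cmod (f x - g x) <= e) -> S f
}.

(** The uniformly closed span of the resolvents at the points of [W], as the
    intersection of all closed sets that contain them: a property of its
    elements is proved by exhibiting one such set. *)
Definition ralg W f := forall S, uniform_span_closed S ->
  (forall w, W w -> S (res w)) -> S f.

Lemma ralg_closed W : uniform_span_closed (ralg W).
Proof.
split=> [f g hf hg|w f hf|f bf hf] S cS rS.
- by apply: (usc_add cS); [exact: hf|exact: hg].
- by apply: (usc_scale cS); exact: hf.
- apply: (usc_lim cS) => // e /hf[g hg fg]; exists g => //; exact: hg.
Qed.

Lemma ralg_res W w : W w -> ralg W (res w).
Proof. by move=> Ww S _; apply. Qed.

(** The absence of isolated points is what makes the span an algebra: squares
    of resolvents are limits of products at distinct points. *)
Definition nonreal_perfect W := (forall w, W w -> complex.Im w != 0) /\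
  forall w (e : R), W w -> 0 < e -> exists2 v, W v & v != w /\ cmod (v - w) < e.

Lemma res_neq0 w x : complex.Im w != 0 -> w + x%:C != 0.
Proof. exact: addr_real_neq0. Qed.

Lemma cmod_res w x : complex.Im w != 0 -> cmod (res w x) <= `|complex.Im w|^-1.
Proof.
move=> w0; rewrite /res cmodV lef_pV2 ?posrE ?normr_gt0 ?cmod_gt0 ?res_neq0 //.
by rewrite -(Im_addr_real w x); exact: normIm.
Qed.

Lemma cbounded_res w : complex.Im w != 0 -> cbounded (res w).
Proof.
move=> w0; split; last by exists `|complex.Im w|^-1 => x; exact: cmod_res.
by apply: cmeasV; apply: cmeasD; [exact: cmeas_cst|exact: cmeas_real].
Qed.

Lemma cbounded_closed : uniform_span_closed (@cbounded R _ R).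
Proof.
split=> [f g|w f hf|//]; first exact: cboundedD.
by apply: cboundedM => //; exact: cbounded_cst.
Qed.

Lemma ralg_cbounded W f : nonreal_perfect W -> ralg W f -> cbounded f.
Proof.
move=> [W0 _] hf; apply: hf; first exact: cbounded_closed.
by move=> w Ww; apply: cbounded_res; exact: W0.
Qed.

(** For distinct points the resolvent identity writes the product as a
    combination of the factors; the square is a uniform limit of such products.
    *)
Lemma ralg_resM W v w : nonreal_perfect W -> W v -> W w ->
  ralg W (fun x => res v x * res w x).
Proof.
move=> [W0 Wp] Wv Ww; have cl := ralg_closed W.
have off v' : W v' -> v' != w -> ralg W (fun x => res v' x * res w x).
  move=> Wv' vw.
  have -> : (fun x => res v' x * res w x) =
      (fun x => (w - v')^-1 * (res v' x + (-1) * res w x)).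
    apply/funext => x; rewrite mulN1r /res subVV ?res_neq0 ?W0 //.
    rewrite (_ : w + x%:C - (v' + x%:C) = w - v'); last by ring.
    by rewrite mulrCA mulVf ?mulr1 // subr_eq0 eq_sym.
  apply: (usc_scale cl); apply: (usc_add cl); first exact: ralg_res.
  by apply: (usc_scale cl); exact: ralg_res.
have [vw|] := eqVneq v w; last exact: off.
apply: (usc_lim cl) => [|e e0].
  by apply: cboundedM; apply: cbounded_res; exact: W0.
have Iw := W0 w Ww; rewrite {v Wv}vw.
pose y : R := `|complex.Im w|; have y0 : 0 < y by rewrite normr_gt0.
have e1 : 0 < Num.min (y / 2) (e * y ^+ 3 / 2).
  by rewrite lt_min !divr_gt0 // mulr_gt0 // exprn_gt0.
have [v Wv [vw]] := Wp w _ Ww e1.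
rewrite lt_min => /andP[v1 v2]; exists (fun x => res v x * res w x); first exact: off.
move=> x; rewrite -mulrBl cmodM /res subVV ?res_neq0 ?W0 // !cmodM.
rewrite (_ : v + x%:C - (w + x%:C) = v - w); last by ring.
have h1 : cmod (w + x%:C)^-1 <= y^-1 by exact: cmod_res.
have h2 : cmod (v + x%:C)^-1 <= (y / 2)^-1.
  apply: le_trans (cmod_res x (W0 v Wv)) _; rewrite lef_pV2 ?posrE ?divr_gt0 ?normr_gt0 ?W0 //.
  have := normIm (v - w); rewrite ImD ImN.
  have := ler_normB (complex.Im v) (complex.Im v - complex.Im w).
  rewrite opprB addrC subrK -/y; lra.
have h3 : cmod (w + x%:C)^-1 * cmod (v + x%:C)^-1 * cmod (v - w) * cmod (w + x%:C)^-1 <=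
    y^-1 * (y / 2)^-1 * (e * y ^+ 3 / 2) * y^-1.
  apply: ler_pM; rewrite ?mulr_ge0 ?cmod_ge0 //.
  apply: ler_pM; rewrite ?mulr_ge0 ?cmod_ge0 //; last exact: ltW.
  by apply: ler_pM; rewrite ?mulr_ge0 ?cmod_ge0.
apply: le_trans h3 _; rewrite le_eqVlt; apply/orP; left; apply/eqP.
by field; rewrite gt_eqF.
Qed.

(** Closedness of the multipliers, used once in each factor. *)
Lemma ralgM W f g : nonreal_perfect W -> ralg W f -> ralg W g ->
  ralg W (fun x => f x * g x).
Proof.
move=> Wp hf hg; have cl := ralg_closed W; have bg := ralg_cbounded Wp hg.
pose closedM (h : R -> R[i]) := fun f => cbounded f /\ ralg W (fun x => f x * h x).
have cM h : cbounded h -> uniform_span_closed (closedM h).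
  move=> bh; split=> [f1 f2 [b1 h1] [b2 h2]|w f1 [b1 h1]|f1 b1 h1].
  - split; first exact: cboundedD.
    by under eq_fun do rewrite mulrDl; exact: (usc_add cl).
  - split; first by apply: cboundedM => //; exact: cbounded_cst.
    by under eq_fun do rewrite -mulrA; exact: (usc_scale cl).
  - split=> //; apply: (usc_lim cl); first exact: cboundedM.
    move=> e e0; have [_ [N hN]] := bh.
    have N0 : 0 < `|N| + 1 by rewrite ltr_wpDl.
    have [f2 [_ h2] f12] := h1 (e / (`|N| + 1)) (divr_gt0 e0 N0).
    exists (fun x => f2 x * h x) => // x.
    rewrite -mulrBl cmodM -[e](@divfK _ (`|N| + 1)) ?gt_eqF //.
    apply: ler_pM; rewrite ?cmod_ge0 //.
    by apply: le_trans (hN x) _; apply: le_trans (ler_norm _) _; lra.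
suff : closedM g f by case.
apply: hf; first exact: cM.
move=> w Ww; have bw := cbounded_res (Wp.1 _ Ww); split => //.
suff [_] : closedM (res w) g.
  by under eq_fun do rewrite mulrC.
apply: hg; first exact: cM.
move=> v Wv; split; first exact: cbounded_res (Wp.1 _ Wv).
exact: ralg_resM.
Qed.

End resolvent_algebra.

Lemma cvg_maxr (R : realType) (T : Type) (F : set_system T) (f g : T -> R) (a b : R) :
  Filter F -> f x @[x --> F] --> a -> g x @[x --> F] --> b ->
  Num.max (f x) (g x) @[x --> F] --> Num.max a b.
Proof.
move=> FF fa gb; rewrite maxr_absE; under eq_fun do rewrite maxr_absE.
apply: cvgM; last exact: cvg_cst.
by apply: cvgD; [exact: cvgD|apply: cvg_norm; exact: cvgB].
Qed.

(** * Functions of compact support *)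

Section compact_support.
Context {R : realType}.
Variables (W : set R[i]) (v : R[i]).
Hypothesis Wp : nonreal_perfect W.
Hypothesis Wv : W v.
Hypothesis Wvc : W (v^*).

Let a := complex.Re v.
Let y := complex.Im v.

Let y0 : y != 0. Proof. exact: Wp.1. Qed.
Let cl := ralg_closed W.

(** A multiple of the product of [res v] and its conjugate, with values in the
    interval from [0] to [1], which determines [|x + a|]: even functions about
    [- a] are functions of it. *)
Definition bump (x : R) : R := y ^+ 2 / ((x + a) ^+ 2 + y ^+ 2).

Let den_gt0 (X : R) : 0 < X ^+ 2 + y ^+ 2.
Proof. by rewrite ltr_wpDl ?sqr_ge0 // lt_def sqrf_eq0 y0 sqr_ge0. Qed.

Lemma bump_gt0 x : 0 < bump x.
Proof. by rewrite divr_gt0 // lt_def sqrf_eq0 y0 sqr_ge0. Qed.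

Lemma bump_le1 x : bump x <= 1.
Proof. by rewrite ler_pdivrMr // mul1r lerDr sqr_ge0. Qed.

Lemma ralg_bump : ralg W (fun x => (bump x)%:C).
Proof.
have -> : (fun x => (bump x)%:C) = (fun x => (y ^+ 2)%:C * (res v x * res v^* x)).
  apply/funext => x; rewrite /bump realCM realCV /res -invfM; congr (_ * _^-1).
  by rewrite /a /y; case: (v) => p q; apply: eqC; rewrite /=; ring.
by apply: (usc_scale cl); apply: ralgM => //; exact: ralg_res.
Qed.

(** Without the factor [bump], the constant term must vanish, as constants are
    not known to be in the span. *)
Lemma ralg_bern n (phi : nat -> R) :
  ralg W (fun x => (bump x * bern (bump x) n phi)%:C) /\
  (phi 0%N = 0 -> ralg W (fun x => (bern (bump x) n phi)%:C)).
Proof.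
elim: n phi => [|n IH] phi.
  split=> [|phi0] /=; last rewrite phi0.
    have -> : (fun x => (bump x * phi 0%N)%:C) = (fun x => (phi 0%N)%:C * (bump x)%:C).
      by apply/funext => x; rewrite -realCM mulrC.
    by apply: (usc_scale cl); exact: ralg_bump.
  have -> : (fun _ : R => 0%:C : R[i]) = (fun x => 0 * (bump x)%:C).
    by apply/funext => x; rewrite mul0r.
  by apply: (usc_scale cl); exact: ralg_bump.
have rB := ralg_bump.
have subE (f g : R -> R[i]) : ralg W f -> ralg W g -> ralg W (fun x => f x + -1 * g x).
  by move=> hf hg; apply: (usc_add cl) => //; exact: (usc_scale cl).
have h1 := (IH (fun i => phi i.+1)).1; have h2 := (IH phi).1.
split=> [|phi0] /=.
  have -> : (fun x => (bump x * (bump x * bern (bump x) n (fun i => phi i.+1) +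
      (1 - bump x) * bern (bump x) n phi))%:C) =
    (fun x => (bump x)%:C * (bump x * bern (bump x) n (fun i => phi i.+1))%:C +
     ((bump x * bern (bump x) n phi)%:C + -1 * ((bump x)%:C *
      (bump x * bern (bump x) n phi)%:C))).
    by apply/funext => x; apply: eqC; rewrite /=; ring.
  by apply: (usc_add cl); [exact: ralgM|apply: subE => //; exact: ralgM].
have -> : (fun x => (bump x * bern (bump x) n (fun i => phi i.+1) +
      (1 - bump x) * bern (bump x) n phi)%:C) =
    (fun x => (bump x * bern (bump x) n (fun i => phi i.+1))%:C +
     ((bern (bump x) n phi)%:C + -1 * (bump x * bern (bump x) n phi)%:C)).
  by apply/funext => x; apply: eqC; rewrite /=; ring.
by apply: (usc_add cl) => //; apply: subE => //; exact: (IH phi).2.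
Qed.

Lemma cbounded_continuous (f : R -> R) (K : R) : continuous f ->
  (forall x, `|f x| <= K) -> @cbounded R _ R (fun x => (f x)%:C).
Proof.
move=> fc fK; split; last by exists K => x; rewrite cmod_real.
by apply: cmeas_real; exact: continuous_measurable_fun.
Qed.

(** A continuous function of [|x + a|] that vanishes far away is a continuous
    function of [bump x] vanishing near [0], hence a limit of its Bernstein
    polynomials. *)
Lemma ralg_even (f : R -> R) (N K : R) : continuous f -> 0 < N ->
  (forall X, N <= X -> f X = 0) -> (forall X, `|f X| <= K) ->
  ralg W (fun x => (f `|x + a|)%:C).
Proof.
move=> fc N0 fN fK.
have yn : 0 < `|y| by rewrite normr_gt0.
pose s1 := y ^+ 2 / (N ^+ 2 + y ^+ 2).
have s10 : 0 < s1 by rewrite divr_gt0 // lt_def sqrf_eq0 y0 sqr_ge0.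
(* the cut-off at [s1] makes [g] continuous at [0], where [|x|] is infinite *)
pose g s := f (`|y| * Num.sqrt ((Num.max s s1)^-1 - 1)).
have sqE X : `|y| * Num.sqrt ((y ^+ 2 / (X ^+ 2 + y ^+ 2))^-1 - 1) = `|X|.
  have -> : (y ^+ 2 / (X ^+ 2 + y ^+ 2))^-1 - 1 = (X / y) ^+ 2.
    by field; rewrite y0 gt_eqF.
  by rewrite sqrtr_sqr normrM normfV mulrC divfK // gt_eqF.
have gs1 s : s <= s1 -> g s = 0.
  move=> ss; rewrite /g; have -> : Num.max s s1 = s1 by apply/max_idPr.
  by rewrite sqE fN // gtr0_norm.
have gE x : g (bump x) = f `|x + a|.
  have [h|h] := leP s1 (bump x).
    rewrite /g; have -> : Num.max (bump x) s1 = bump x by apply/max_idPl.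
    by rewrite sqE.
  rewrite gs1 ?ltW // fN // ltW //.
  rewrite -(@ltr_pXn2r _ 2) ?nnegrE ?normr_ge0 ?ltW // real_normK ?num_real //.
  move: h; rewrite /bump /s1 ltr_pM2l; last by rewrite lt_def sqrf_eq0 y0 sqr_ge0.
  by rewrite ltf_pV2 ?posrE // ltrD2r.
have gc : continuous g.
  move=> s; rewrite /g; apply: (@continuous_comp _ _ _
    (fun s => `|y| * Num.sqrt ((Num.max s s1)^-1 - 1)) f); last exact: fc.
  apply: cvgM; first exact: cvg_cst.
  apply: (@continuous_comp _ _ _ (fun s => (Num.max s s1)^-1 - 1) Num.sqrt);
    last exact: sqrt_continuous.
  apply: cvgB; last exact: cvg_cst.
  apply: cvgV; first by rewrite gt_eqF // lt_max s10 orbT.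
  by apply: cvg_maxr; [exact: cvg_id|exact: cvg_cst].
apply: (usc_lim cl).
  apply: (@cbounded_continuous (fun x => f `|x + a|) K) => // x.
  apply: (@continuous_comp _ _ _ (fun x => `|x + a|) f); last exact: fc.
  apply: (@continuous_comp _ _ _ (fun x => x + a) Num.norm); last exact: norm_continuous.
  by apply: cvgD; [exact: cvg_id|exact: cvg_cst].
move=> e e0; have [n hn] := bernstein gc (fun s => fK _) e0.
exists (fun x => (bern (bump x) n (fun i => g (i%:R / n%:R)))%:C).
  by apply: (ralg_bern n _).2; rewrite mul0r gs1 // ltW.
move=> x; rewrite -[X in cmod (X - _)]/((f `|x + a|)%:C) -rmorphB cmod_real -gE.
by apply: hn; rewrite ltW ?bump_gt0 // bump_le1.
Qed.

(** Soft thresholding: a uniformly small change that makes an odd function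
    vanish near its centre, so that it can be divided by [X]. *)
Definition soft (e u : R) : R := Num.max 0 (u - e) - Num.max 0 (- u - e).

Lemma soft_odd e u : soft e (- u) = - soft e u.
Proof. by rewrite /soft opprK opprB. Qed.

Lemma soft_close e u : 0 <= e -> `|u - soft e u| <= e.
Proof.
move=> e0; rewrite /soft ler_norml.
by case: (leP 0 (u - e)); case: (leP 0 (- u - e)) => *; apply/andP; split; lra.
Qed.

Lemma soft_eq0 e u : `|u| <= e -> soft e u = 0.
Proof.
rewrite ler_norml => /andP[h1 h2]; rewrite /soft.
by case: (leP 0 (u - e)); case: (leP 0 (- u - e)) => *; lra.
Qed.

Lemma continuous_soft e : continuous (soft e).
Proof.
move=> u; apply: cvgB.
  apply: cvg_maxr; first exact: cvg_cst.
  by apply: cvgB; [exact: cvg_id|exact: cvg_cst].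
apply: cvg_maxr; first exact: cvg_cst.
by apply: cvgB; [apply: cvgN; exact: cvg_id|exact: cvg_cst].
Qed.

(** The span contains the odd function [X / (X ^ 2 + y ^ 2)], half the sum of
    two conjugate resolvents; the quotient by it extends to a continuous even
    function. *)
Lemma ralg_odd (o : R -> R) (N K e : R) : continuous o -> 0 < N -> 0 < e ->
  (forall X, o (- X) = - o X) -> (forall X, N <= X -> o X = 0) ->
  (forall X, `|o X| <= K) ->
  ralg W (fun x => (soft e (o (x + a)))%:C).
Proof.
move=> oc N0 e0 oodd oN oK.
have o0 : o 0 = 0 by have := oodd 0; rewrite oppr0; lra.
have [h h0 hh] : exists2 h : R, 0 < h & forall X, `|X| < h -> `|o X| <= e.
  have /cvgrPdist_lt/(_ _ e0)/nbhs_ballP[h /= h0 hh] := oc 0.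
  exists h => // X Xh; have := hh X; rewrite /ball /= o0 !sub0r !normrN.
  by move=> /(_ Xh)/ltW.
pose k X := soft e (o X) * ((X ^+ 2 + y ^+ 2) / Num.max X h).
have kc : continuous k.
  move=> X; apply: cvgM.
    by apply: (@continuous_comp _ _ _ o (soft e)); [exact: oc|exact: continuous_soft].
  apply: cvgM.
    apply: cvgD; last exact: cvg_cst.
    exact: exprn_continuous.
  apply: cvgV; first by rewrite gt_eqF // lt_max h0 orbT.
  by apply: cvg_maxr; [exact: cvg_id|exact: cvg_cst].
have kN X : N <= X -> k X = 0.
  by move=> XN; rewrite /k oN // soft_eq0 ?normr0 ?mul0r // ltW.
have oN' X : N <= `|X| -> o X = 0.
  move=> XN; have [X0|X0] := leP 0 X; first by rewrite oN // -(ger0_norm X0).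
  by rewrite -[X]opprK oodd oN ?oppr0 // -ltr0_norm.
have kK X : `|k X| <= (K + e) * ((N ^+ 2 + y ^+ 2) / h).
  have KX : 0 <= K + e by have := oK 0; have := normr_ge0 (o 0); lra.
  have [XN|XN] := leP N `|X|.
    rewrite /k oN' // soft_eq0 ?normr0 ?mul0r ?normr0 ?(ltW e0) //.
    by apply: mulr_ge0 => //; apply: divr_ge0; exact: ltW.
  rewrite normrM ler_pM ?normr_ge0 //.
    have := soft_close (o X) (ltW e0); have := oK X; rewrite !ler_norml.
    by move=> /andP[? ?] /andP[? ?]; apply/andP; split; lra.
  have m0 : 0 < Num.max X h by rewrite lt_max h0 orbT.
  rewrite ger0_norm; last by rewrite divr_ge0 // ltW.
  apply: ler_pM; rewrite ?invr_ge0 ?(ltW m0) ?(ltW (den_gt0 _)) //.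
    rewrite lerD2r -[leLHS]real_normK ?num_real //.
    by rewrite lerXn2r ?nnegrE ?normr_ge0 ?(ltW N0) ?(ltW XN).
  by rewrite lef_pV2 ?posrE // le_max lexx orbT.
have rk := ralg_even kc N0 kN kK.
have -> : (fun x => (soft e (o (x + a)))%:C) =
    (fun x => (2%:R^-1 * (res v x + res v^* x)) * (k `|x + a|)%:C).
  apply/funext => x.
  have -> : 2%:R^-1 * (res v x + res v^* x) = ((x + a) / ((x + a) ^+ 2 + y ^+ 2))%:C.
    have two : (2%:R : R[i]) != 0 by rewrite pnatr_eq0.
    apply: (mulfI two); rewrite mulrA divff // mul1r mulr_natl mulr2n.
    have := gt_eqF (den_gt0 (x + a)); rewrite /res /a /y; case: (v) => q r /= den0.
    rewrite addrC in den0; apply: eqC; rewrite /= !addr0 (addrC q x).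
      by rewrite sqrrN.
    by rewrite sqrrN; ring.
  rewrite -realCM; congr (_ %:C); set X := x + a.
  have key (Z : R) : 0 < Z -> soft e (o Z) = Z / (Z ^+ 2 + y ^+ 2) * k Z.
    move=> Z0; rewrite /k; have [Zh|Zh] := leP h Z.
      by field; rewrite !gt_eqF.
    by rewrite (soft_eq0 (hh Z _)) ?gtr0_norm // mul0r mulr0.
  have [X0|X0|<-] := ltgtP 0 X; last 1 first.
  - by rewrite o0 soft_eq0 ?normr0 ?(ltW e0) // !mul0r.
  - by rewrite gtr0_norm // -key.
  have NX : 0 < - X by rewrite oppr_gt0.
  rewrite ltr0_norm // -[X in soft e (o X)]opprK oodd soft_odd key // sqrrN.
  by rewrite mulNr mulNr opprK.
apply: ralgM => //; apply: (usc_scale cl); apply: (usc_add cl); exact: ralg_res.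
Qed.

(** Split into even and odd parts about [- a]. *)
Lemma ralg_compact_support (f : R -> R) (N K : R) : continuous f ->
  (forall x, N <= `|x| -> f x = 0) -> (forall x, `|f x| <= K) ->
  ralg W (fun x => (f x)%:C).
Proof.
move=> fc fN fK; pose F X := f (X - a).
have Fc : continuous F.
  move=> X; apply: (@continuous_comp _ _ _ (fun X => X - a) f); last exact: fc.
  by apply: cvgB; [exact: cvg_id|exact: cvg_cst].
have FNc : continuous (fun X => F (- X)).
  move=> X; apply: (@continuous_comp _ _ _ (fun X => - X) F); last exact: Fc.
  by apply: cvgN; exact: cvg_id.
pose N' := `|N| + `|a| + 1.
have N'0 : 0 < N' by rewrite ltr_wpDl // addr_ge0.
have FN X : N' <= `|X| -> F X = 0.
  move=> XN; apply: fN; have := lerB_dist X a; have := ler_norm N.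
  rewrite /N' in XN; lra.
pose ev X := (F X + F (- X)) / 2; pose od X := (F X - F (- X)) / 2.
have FK X : `|F X| <= K by exact: fK.
have evc : continuous ev by move=> X; apply: cvgM; [apply: cvgD; [exact: Fc|exact: FNc]|exact: cvg_cst].
have odc : continuous od by move=> X; apply: cvgM; [apply: cvgB; [exact: Fc|exact: FNc]|exact: cvg_cst].
have FN2 X : N' <= X -> F X = 0 /\ F (- X) = 0.
  by move=> XN; rewrite !FN ?normrN //; apply: le_trans XN (ler_norm _).
have evN X : N' <= X -> ev X = 0 by move=> /FN2[h1 h2]; rewrite /ev h1 h2; lra.
have odN X : N' <= X -> od X = 0 by move=> /FN2[h1 h2]; rewrite /od h1 h2; lra.
have evK X : `|ev X| <= K.
  by have := FK X; have := FK (- X); rewrite /ev !ler_norml => /andP[? ?] /andP[? ?]; apply/andP; split; lra.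
have odK X : `|od X| <= K.
  by have := FK X; have := FK (- X); rewrite /od !ler_norml => /andP[? ?] /andP[? ?]; apply/andP; split; lra.
have ododd X : od (- X) = - od X by rewrite /od opprK; ring.
have evE X : ev `|X| = ev X.
  have [X0|X0] := leP 0 X; first by rewrite ger0_norm.
  by rewrite ltr0_norm // /ev opprK addrC.
apply: (usc_lim cl); first exact: cbounded_continuous fK.
move=> e e0; exists (fun x => (ev `|x + a|)%:C + (soft e (od (x + a)))%:C).
  by apply: (usc_add cl); [exact: (ralg_even evc N'0 evN evK)|exact: (ralg_odd odc N'0 e0 ododd odN odK)].
move=> x; rewrite evE -realCD -rmorphB cmod_real.
have -> : f x = ev (x + a) + od (x + a).
  by rewrite /ev /od -mulrDl addrACA subrr addr0 /F addrK; field.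
rewrite opprD addrACA subrr add0r; exact: soft_close (ltW e0).
Qed.

End compact_support.

(** * From resolvents to weak convergence *)

Section weak_convergence.
Context {R : realType}.

Lemma cbounded_comp d (T : measurableType d) (f : R -> R[i]) (Y : T -> R) :
  measurable_fun setT Y -> cbounded f -> cbounded (fun t => f (Y t)).
Proof.
move=> mY [[f1 f2] [M fM]]; split; last by exists M => t; exact: fM.
split; first exact: (measurableT_comp f1 mY).
exact: (measurableT_comp f2 mY).
Qed.

Lemma Rintegral_cutoff d (T : measurableType d) (mu : probability T R)
    (f chi : T -> R) (K : R) : measurable_fun setT f -> measurable_fun setT chi ->
  (forall t, `|f t| <= K) -> (forall t, 0 <= chi t <= 1) ->
  `|\int[mu]_t f t - \int[mu]_t (f t * chi t)| <= K * (1 - \int[mu]_t chi t).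
Proof.
move=> mf mchi fK chi01.
have chiK t : `|chi t| <= 1 by have /andP[c0 c1] := chi01 t; rewrite ger0_norm.
have fcK t : `|f t * chi t| <= K.
  by rewrite -[K]mulr1; apply: norm_leM.
have mfc : measurable_fun setT (fun t => f t * chi t) by exact: measurable_funM.
have mC : measurable_fun setT (fun t => 1 - chi t).
  by apply: measurable_funB => //; exact: measurable_cst.
have CK t : `|1 - chi t| <= 1.
  by have /andP[c0 c1] := chi01 t; rewrite ger0_norm ?subr_ge0 // gerBl.
rewrite -RintegralB //; [|exact: (bounded_integrable mu mf fK)
  |exact: (bounded_integrable mu mfc fcK)].
have -> : 1 - \int[mu]_t chi t = \int[mu]_t (1 - chi t).
  have i1 : mu.-integrable setT (EFin \o (fun=> 1 : R)).
    by apply: (@bounded_integrable _ _ _ mu (fun=> 1) `|1|).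
  rewrite RintegralB //; last exact: (bounded_integrable mu mchi chiK).
  by rewrite Rintegral_cst // (congr1 fine (probability_setT mu)) mulr1.
rewrite -RintegralZl //; last exact: (bounded_integrable mu mC CK).
have mD : measurable_fun setT (fun t => f t - f t * chi t) by exact: measurable_funB.
have DK t : `|f t - f t * chi t| <= K * (1 - chi t).
  have /andP[c0 c1] := chi01 t.
  rewrite -[X in X - _]mulr1 -mulrBr normrM (ger0_norm (_ : 0 <= 1 - _)) ?subr_ge0 //.
  by rewrite ler_wpM2r // subr_ge0.
have DK' t : `|f t - f t * chi t| <= K * 1.
  apply: le_trans (DK t) _; have /andP[c0 c1] := chi01 t.
  rewrite ler_wpM2l //; first exact: le_trans (fK t).
  by rewrite gerBl.
have mKC : measurable_fun setT (fun t => K * (1 - chi t)).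
  by apply: measurable_funM => //; exact: measurable_cst.
apply: le_trans (le_normr_Rintegral _ _) _ => //.
  exact: (bounded_integrable mu mD DK').
apply: le_Rintegral => //.
- apply: (bounded_integrable mu (M := K * 1)); first exact: measurableT_comp.
  by move=> t; rewrite normr_id.
- apply: (bounded_integrable mu (M := `|K| * 1)) => // t.
  exact: norm_leM.
Qed.

Definition tent (N x : R) : R := Num.max 0 (1 - Num.max 0 (`|x| - N)).

Lemma tent_itv N x : 0 <= tent N x <= 1.
Proof.
rewrite /tent le_max lexx /= ge_max ler01 /= gerBl.
by rewrite le_max lexx.
Qed.

Lemma tent_eq1 N x : `|x| <= N -> tent N x = 1.
Proof.
move=> xN; rewrite /tent; have -> : Num.max 0 (`|x| - N) = 0.
  by apply/max_idPl; rewrite subr_le0.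
by rewrite subr0; apply/max_idPr.
Qed.

Lemma tent_eq0 N x : N + 1 <= `|x| -> tent N x = 0.
Proof.
move=> xN; rewrite /tent; have -> : Num.max 0 (`|x| - N) = `|x| - N.
  by apply/max_idPr; lra.
by apply/max_idPl; lra.
Qed.

Lemma continuous_tent N : continuous (tent N).
Proof.
move=> x; apply: cvg_maxr; first exact: cvg_cst.
apply: cvgB; first exact: cvg_cst.
apply: cvg_maxr; first exact: cvg_cst.
by apply: cvgB; [apply: cvg_norm; exact: cvg_id|exact: cvg_cst].
Qed.

(** To be applied to the limit law: convergence of the mean of [tent] then
    controls the mass escaping from the approximating laws. *)
Lemma tight d (T : measurableType d) (P : probability T R) (Y : T -> R) (e : R) :
  measurable_fun setT Y -> 0 < e ->
  exists N : R, 1 - e < \int[P]_t tent N (Y t).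
Proof.
move=> mY e0.
have mt (n : nat) : measurable_fun setT (fun t => tent n%:R (Y t)).
  apply: measurableT_comp => //; apply: continuous_measurable_fun.
  exact: continuous_tent.
have tK (n : nat) t : `|tent n%:R (Y t)| <= 1.
  by have /andP[h0 h1] := tent_itv n%:R (Y t); rewrite ger0_norm.
have [] := @dominated_convergence _ T R P setT measurableT
  (fun n t => (tent n%:R (Y t))%:E) (fun=> 1%:E) (fun=> 1%:E).
- by move=> n; apply/measurable_EFinP; exact: mt.
- exact: measurable_cst.
- apply: aeW => t _; apply: cvg_near_cst; near=> n.
  congr EFin; apply: tent_eq1; near: n.
  exists (Num.truncn `|Y t|).+1 => // n /= hn.
  apply: le_trans (ltW (truncnS_gt _)) _; by rewrite ler_nat.
- by apply: (bounded_integrable P (r := fun=> 1) (M := 1)) => //; rewrite normr1.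
- by apply: aeW => t n _; rewrite /= lee_fin.
move=> _ _; have -> : (\int[P]_(x in setT) 1%:E = 1%:E)%E.
  rewrite integral_cst // mul1e; exact: probability_setT.
move=> /fine_cvgP[_ /cvgrPdist_lt/(_ _ e0)][n _ hn]; exists n%:R.
have := hn n (leqnn n) => /=; rewrite -/(Rintegral P setT (fun t => tent n%:R (Y t))).
by move=> /(le_lt_trans (ler_norm _)); lra.
Unshelve. all: by end_near. Qed.

Variables (rho : R -> probability R R) (d : measure_display) (T : measurableType d).
Variables (P : probability T R) (Y : T -> R).
Hypothesis mY : measurable_fun setT Y.
Variables (W : set R[i]) (v : R[i]).
Hypothesis Wp : nonreal_perfect W.
Hypothesis Wv : W v.
Hypothesis Wvc : W (v^*).

Let L (e : R) := fun x : R => ln x / e.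
Let mL e : measurable_fun setT (L e).
Proof. by apply: measurable_funM; [exact: measurable_ln|exact: measurable_cst]. Qed.

Let meanL f e := Cint (rho e) (fun x => f (L e x)).
Let meanY f := Cint P (fun t => f (Y t)).

Hypothesis res_cvg : forall w, W w -> clim (meanL (res w)) (meanY (res w)).

(** Uniform approximation commutes with the limit because all laws are
    probability measures. *)
Lemma cvg_mean_closed :
  uniform_span_closed (fun f => cbounded f /\ clim (meanL f) (meanY f)).
Proof.
split=> [f g [bf hf] [bg hg]|w f [bf hf]|f bf happ].
- split; first exact: cboundedD.
  rewrite /meanY CintD; [|exact: cbounded_comp..].
  rewrite (_ : meanL _ = fun e => meanL f e + meanL g e); first exact: climD.
  by apply/funext => e; rewrite /meanL CintD //; exact: cbounded_comp.
- split; first by apply: cboundedM => //; exact: cbounded_cst.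
  rewrite /meanY CintZ; last exact: cbounded_comp.
  rewrite (_ : meanL _ = fun e => w * meanL f e).
    by apply: climM => //; exact: clim_cst.
  by apply/funext => e; rewrite /meanL CintZ //; exact: cbounded_comp.
- split=> // e e0; have e8 : 0 < e / 8 by rewrite divr_gt0.
  have e4 : 0 < e / 4 by rewrite divr_gt0.
  have [g [bg hg] fg] := happ _ e8.
  near=> h.
  have h1 : cmod (meanL g h - meanY g) < e / 4 by near: h; exact: hg.
  have h2 : cmod (meanL f h - meanL g h) <= 2 * (e / 8).
    by apply: Cint_close; [exact: cbounded_comp|exact: cbounded_comp|move=> x; exact: fg].
  have h3 : cmod (meanY g - meanY f) <= 2 * (e / 8).
    by rewrite cmodBC; apply: Cint_close;
      [exact: cbounded_comp|exact: cbounded_comp|move=> x; exact: fg].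
  rewrite (_ : _ - _ = (meanL f h - meanL g h) + ((meanL g h - meanY g) +
    (meanY g - meanY f))); last by ring.
  have := cmodD (meanL f h - meanL g h) ((meanL g h - meanY g) + (meanY g - meanY f)).
  have := cmodD (meanL g h - meanY g) (meanY g - meanY f); lra.
Unshelve. all: by end_near. Qed.

Lemma cvg_compact_support (f : R -> R) (N K : R) : continuous f ->
  (forall x, N <= `|x| -> f x = 0) -> (forall x, `|f x| <= K) ->
  forall e : R, 0 < e -> \forall h \near 0^'+,
    `|\int[rho h]_x f (L h x) - \int[P]_t f (Y t)| < e.
Proof.
move=> fc fN fK; have [_] := @ralg_compact_support R W v Wp Wv Wvc f N K fc fN fK
  _ cvg_mean_closed (fun w Ww => conj (cbounded_res (Wp.1 w Ww)) (res_cvg Ww)).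
move=> hf e e0; near=> h.
have : cmod (meanL (fun x => (f x)%:C) h - meanY (fun x => (f x)%:C)) < e.
  by near: h; exact: hf.
by rewrite /meanL /meanY !Cint_real -rmorphB cmod_real.
Unshelve. all: by end_near. Qed.

(** Cut [f] off by [tent N]. The error is bounded by the mass missed by
    [tent N], small for the limit law by [tight] and for the others by
    convergence of the mean of [tent N], itself of compact support. *)
Lemma cvg_bounded_continuous (f : R -> R) (K : R) : continuous f ->
  (forall x, `|f x| <= K) ->
  forall e : R, 0 < e -> \forall h \near 0^'+,
    `|\int[rho h]_x f (L h x) - \int[P]_t f (Y t)| < e.
Proof.
move=> fc fK e e0; have K0 : 0 <= K by apply: le_trans (fK 0).
have K1 : 0 < K + 1 by rewrite ltr_wpDl.
pose eta := e / (8 * (K + 1)); have eta0 : 0 < eta by rewrite divr_gt0 // mulr_gt0.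
have [N hN] := tight P mY eta0.
have e4 : 0 < e / 4 by rewrite divr_gt0.
have tK x : `|tent N x| <= 1.
  by have /andP[h0 h1] := tent_itv N x; rewrite ger0_norm.
have tN x : N + 1 <= `|x| -> tent N x = 0 by exact: tent_eq0.
have ftc : continuous (fun x => f x * tent N x).
  by move=> x; apply: cvgM; [exact: fc|exact: continuous_tent].
have ftN x : N + 1 <= `|x| -> f x * tent N x = 0 by move=> /tN ->; rewrite mulr0.
have ftK x : `|f x * tent N x| <= K by rewrite -[K]mulr1; apply: norm_leM.
have mf := continuous_measurable_fun fc.
have mt := continuous_measurable_fun (@continuous_tent N).
have t01 := tent_itv N.
have cutY := @Rintegral_cutoff _ T P (fun t => f (Y t)) (fun t => tent N (Y t)) K
  (measurableT_comp mf mY) (measurableT_comp mt mY) (fun t => fK _) (fun t => t01 _).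
near=> h.
have cutL := @Rintegral_cutoff _ R (rho h) (fun x => f (L h x))
  (fun x => tent N (L h x)) K
  (measurableT_comp mf (mL h)) (measurableT_comp mt (mL h)) (fun t => fK _) (fun t => t01 _).
have h1 : `|\int[rho h]_x tent N (L h x) - \int[P]_t tent N (Y t)| < eta.
  near: h; exact: (cvg_compact_support (@continuous_tent N) tN tK eta0).
have h2 : `|\int[rho h]_x (f (L h x) * tent N (L h x)) -
    \int[P]_t (f (Y t) * tent N (Y t))| < e / 4.
  near: h; exact: (cvg_compact_support ftc ftN ftK e4).
have b1 : K * (1 - \int[P]_t tent N (Y t)) <= K * eta.
  by rewrite ler_wpM2l //; lra.
have b2 : K * (1 - \int[rho h]_x tent N (L h x)) <= K * (2 * eta).
  by rewrite ler_wpM2l //; move: h1; rewrite ltr_norml => /andP[? _]; lra.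
have Ke : K * eta <= e / 8.
  rewrite /eta (_ : K * (e / (8 * (K + 1))) = e / 8 * (K / (K + 1))); last first.
    by field; rewrite gt_eqF.
  rewrite -[leRHS]mulr1 ler_wpM2l //; first by rewrite ltW // divr_gt0.
  by rewrite ler_pdivrMr // mul1r lerDl.
move: (le_trans cutY b1) (le_trans cutL b2) h2; set A := Rintegral _ _ _; set B := Rintegral _ _ _.
set D := Rintegral _ _ _; set E := Rintegral _ _ _.
rewrite !ler_norml !ltr_norml => /andP[? ?] /andP[? ?] /andP[? ?].
apply/andP; split; lra.
Unshelve. all: by end_near. Qed.

End weak_convergence.

(** * The free stable law *)

Section cauchy_transform_of_law.
Context {R : realType} d (T : measurableType d) (P : probability T R).

Lemma Rintegral_distribution (X : {RV P >-> R}) (f : R -> R) (K : R) :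
  measurable_fun setT f -> (forall x, `|f x| <= K) ->
  \int[distribution P X]_x f x = \int[P]_t f (X t).
Proof.
move=> mf fK; rewrite /Rintegral; congr fine.
apply: (@integral_distribution _ _ _ _ _ P X (EFin \o f)).
  exact/measurable_EFinP.
apply: (bounded_integrable P (r := fun t => f (X t)) (M := K)) => //.
exact: measurableT_comp.
Qed.

Lemma Cint_distribution (X : {RV P >-> R}) (f : R -> R[i]) : cbounded f ->
  Cint (distribution P X) f = Cint P (fun t => f (X t)).
Proof.
move=> [[f1 f2] [M fM]]; apply: eqC; rewrite /Cint /=;
  apply: (Rintegral_distribution _ (K := M)) => // x.
  exact: le_trans (normRe _) _.
exact: le_trans (normIm _) _.
Qed.

Lemma cmodJ (z : R[i]) : cmod z^* = cmod z.
Proof. by case: z => x y; rewrite /cmod /= sqrrN. Qed.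

Lemma CintJ (f : T -> R[i]) : cbounded f ->
  Cint P (fun t => (f t)^*) = (Cint P f)^*.
Proof.
move=> hf; have hI := Im_integrable P hf.
apply: eqC; rewrite /Cint /=.
  by apply: eq_Rintegral => t _; case: (f t).
rewrite -[RHS]mulN1r -RintegralZl //.
by apply: eq_Rintegral => t _; case: (f t) => x y /=; rewrite mulN1r.
Qed.

Lemma resJ (w : R[i]) (x : R) : res w^* x = (res w x)^*.
Proof.
rewrite /res conjc_inv; congr (_^-1); case: w => a b.
by apply: eqC; rewrite /= ?oppr0 ?addr0.
Qed.

(** The Voiculescu transform gives the preimage [z - (-z) ^ (1 - alpha)] of [z]
    under the reciprocal Cauchy transform, that is, a point where the Cauchy
    transform is [1 / z]. In the variable [u = - s z] the preimage becomes
    [v = u + s ^ alpha u ^ (1 - alpha)], the shape of [slope_lim]. *)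
Lemma free_stable_resolvent (alpha s : R) (F : {RV P >-> R}) : 0 < s ->
  is_free_stable alpha (distribution P F) ->
  exists A B : R, [/\ 0 < A, 0 < B & forall z, trunc_cone A B z ->
    let u := s%:C * - z in
    let v := u + (s `^ alpha)%:C * cexp (- (alpha - 1)%:C * clog u) in
    complex.Im v < 0 /\ Cint P (fun t => res v (s * F t)) = u^-1].
Proof.
move=> s0 [A [B [A' [B' [[A0 B0 A'0 B'0] inj sub phiE]]]]].
exists A, B; split => // z zA u v.
have [Kin KE] := pinv_in (fun=> 0) (sub _ zA).
set Z := 'pinv_(fun=> 0) _ _ _ in Kin KE.
have ZE : Z = z - cpow (- z) (1 - alpha).
  by have := phiE z zA; rewrite -/Z => h; rewrite -[LHS](subrK z) h addrC.
have [ImZ _ _] := Kin; have [Imz _ _] := zA.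
have Imz' : complex.Im (- z) < 0 by rewrite ImN oppr_lt0.
have zn0 : - z != 0 by apply/eqP => h; move: Imz'; rewrite h ltxx.
have sn0 : s%:C != 0 :> R[i] by rewrite realC_eq0 gt_eqF.
have vE : v = s%:C * - Z.
  rewrite /v /u clog_scale // ZE opprB cpow_clog // mulrDr cexpD.
  have -> : - (alpha - 1)%:C * (ln s)%:C = (- (alpha - 1) * ln s)%:C.
    by rewrite realCM rmorphN.
  rewrite cexp_real mulrA -realCM.
  have -> : s `^ alpha * expR (- (alpha - 1) * ln s) = s.
    rewrite /powR gt_eqF // -expRD -[RHS]lnK ?posrE //; congr expR; ring.
  have -> : - (alpha - 1)%:C = (1 - alpha)%:C :> R[i] by rewrite -rmorphN opprB.
  by rewrite mulrBr mulrN addrC.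
have Imv : complex.Im v < 0.
  by rewrite vE ImM /= mul0r addr0 pmulr_rlt0 // ImN oppr_lt0.
split=> //.
have bres : cbounded (fun x : R => (Z - x%:C)^-1).
  have -> : (fun x : R => (Z - x%:C)^-1) = (fun x => (-1) * res (- Z) x).
    by apply/funext => x; rewrite /res mulN1r -invrN opprD opprK.
  apply: cboundedM; first exact: cbounded_cst.
  by apply: cbounded_res; rewrite ImN oppr_eq0 gt_eqF.
have G : Cint P (fun t => (Z - (F t)%:C)^-1) = z^-1.
  by rewrite -(Cint_distribution F bres) -cauchyGE -KE /recF invrK.
have -> : (fun t => res v (s * F t)) = (fun t => (- s%:C^-1) * (Z - (F t)%:C)^-1).
  apply/funext => t; rewrite /res vE realCM -mulrDr invfM mulNr -mulrN -invrN.
  by rewrite opprB addrC.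
rewrite CintZ; last exact: (cbounded_comp (@measurable_funPT _ _ _ _ F) bres).
by rewrite G /u invfM mulNr -mulrN -invrN.
Qed.

End cauchy_transform_of_law.

(** * The limit theorem *)

Section main.
Context {R : realType} (k : nat).
Variables (beta : R) (alpha p : 'I_k.+1 -> R).
Variables (bbeta : probability R R) (nu nup : 'I_k.+1 -> probability R R).
Variables (nu_alpha_p bnu : probability R R) (rho : R -> probability R R).
Hypothesis beta01 : 0 < beta < 1.
Hypothesis bbetaE : is_boolean_stable beta bbeta.
Hypothesis nuE : forall i, is_nu_law (alpha i) (nu i).
Hypothesis nupE : forall i, is_mfpow (nu i) (p i) (nup i).
Hypothesis nu_alpha_pE : is_mfprod nup nu_alpha_p.
Hypothesis bnuE : is_mfconv bbeta nu_alpha_p bnu.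
Hypothesis rhoE : forall t : R, 0 < t -> is_mfpow bnu t (rho t).

(** The hypotheses on products only concern [w] near [0]. This is why the
    functional equation holds a priori on a half-line only, and has to be
    continued. *)
Lemma Strans_near0 : exists2 e : R, 0 < e <= 1 & forall w, - e < w < 0 ->
  Strans bnu w = Strans bbeta w * \prod_i Strans (nup i) w.
Proof.
have near_S : \forall w \near 0^'-,
    Strans bnu w = Strans bbeta w * \prod_i Strans (nup i) w.
  have h1 := bnuE.2; have h2 := mfprod_Strans nu_alpha_pE.
  near=> w; have <- : Strans nu_alpha_p w = \prod_i Strans (nup i) w by near: w.
  by near: w.
have [e /= e0 he] := near_S.
exists (Num.min e 1); first by rewrite lt_min e0 ltr01 /= ge_min lexx orbT.
move=> w /andP[w1 w0]; apply: he => //.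
rewrite /ball_ /= sub0r normrN ltr0_norm // ltrNl.
by apply: le_lt_trans w1; rewrite lerN2 ge_min lexx.
Unshelve. all: by end_near. Qed.

(** For [y = - exp x] the S-transform is evaluated at [w = y / (1 - y)], where
    [- w = 1 / (1 + exp (- x))]; [w] is close to [0] when [x] is very negative.
    *)
Lemma defect_real : exists M : R, forall t x : R, 0 < t -> x < M ->
  defect (beta^-1 - 1) t (fun i => alpha i - 1) p (rho t) x%:C = 0.
Proof.
have [e /andP[e0 e1] he] := Strans_near0; exists (ln e) => t x t0 xe.
have [rpos rhoS] := rhoE t0.
pose y := - expR x; have y0 : y < 0 by rewrite oppr_lt0 expR_gt0.
have ex0 := expR_gt0 x.
pose w := y / (1 - y).
have y1 : 1 - y != 0 by rewrite /y opprK gt_eqF // addr_gt0.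
have wy : w / (1 + w) = y.
  rewrite /w; have -> : 1 + y / (1 - y) = (1 - y)^-1 by field.
  by rewrite invrK divfK.
have wE : - w = (1 + expR (- x))^-1.
  rewrite /w /y expRN -mulNr !opprK; field.
  by rewrite ?gt_eqF ?addr_gt0.
have w0 : w < 0 by rewrite -oppr_gt0 wE invr_gt0 addr_gt0 ?expR_gt0.
have we : - e < w.
  rewrite ltrNl /w /y -mulNr !opprK ltr_pdivrMr ?addr_gt0 //.
  apply: (@lt_trans _ _ (e * 1)); last by rewrite ltr_pM2l // ltrDl.
  by rewrite mulr1 -[ltRHS]lnK ?posrE // ltr_expR.
have w1 : -1 < w < 0 by rewrite w0 andbT; apply: le_lt_trans we; rewrite lerN2.
pose h := (beta^-1 - 1) * x +
  \sum_(i < k.+1) p i * expR (- (alpha i - 1) * ln (1 + expR (- x))).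
have SE : Strans bnu w = expR h.
  rewrite he ?we // /Strans wy (Sigma_boolean beta01 bbetaE y0) opprK expRK.
  rewrite expRD; congr (_ * _).
  have -> : \prod_i Sigma (nup i) y = \prod_i Strans (nup i) w.
    by apply: eq_bigr => i _; rewrite /Strans wy.
  elim/big_ind2 : _ => [|a b c d -> ->|i _]; rewrite ?expR0 ?expRD //.
  rewrite (nupE i).2 // (nuE i).2 // wE /powR gt_eqF ?expR_gt0 // expRK.
  rewrite gt_eqF ?invr_gt0 ?addr_gt0 ?expR_gt0 //; congr (expR (_ * expR _)).
  by rewrite lnV ?posrE ?addr_gt0 ?expR_gt0 // mulNr mulrN.
have SrE : Sigma (rho t) y = expR (t * h).
  have := rhoS w w1; rewrite SE {1}/Strans wy => ->.
  by rewrite /powR gt_eqF ?expR_gt0 // expRK.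
have := Sigma_stieltjes rpos y0; rewrite SrE => /(_ (expR_gt0 _)).
have -> : - (y * expR (t * h))^-1 = expR (- (x + t * h)).
  by rewrite /y mulNr invrN opprK -expRD -expRN.
move=> key.
have PhiE : cexp (- Phi (beta^-1 - 1) t (fun i => alpha i - 1) p x%:C) =
    (expR (- (x + t * h)))%:C.
  by rewrite Phi_real -cexp_real rmorphN.
rewrite /defect PhiE key.
by rewrite cexp_real -[1 in X in _ - X]/(1%:C) -realCD -realCV /y opprK subrr.
Qed.

Hypothesis alpha12 : forall i, 1 < alpha i <= 2.
Hypothesis alpha_dec : forall i j : 'I_k.+1, (i < j)%N -> alpha j < alpha i.
Hypothesis p_gt0 : forall i, 0 < p i.
Variables (d : measure_display) (T : measurableType d) (P : probability T R).
Variables (F : {RV P >-> R}).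
Hypothesis FE : is_free_stable (alpha ord0) (distribution P F).

Let a0 := alpha ord0.
Let c := beta^-1 - 1.
Let s := p ord0 `^ a0^-1.
Let kappa := 5 + \sum_(i < k.+1) p i.
Let lim u : R[i] := slope_lim alpha p u.

Let a0_gt1 : 1 < a0. Proof. by have /andP[] := alpha12 ord0. Qed.
Let s0 : 0 < s. Proof. exact: powR_gt0. Qed.

(** The parameters [u = - s z], for [z] in the truncated cone where the
    Voiculescu transform is known, with the further restriction
    [Im u < - kappa]. The factor [1 + h] moves [u] inside this set, so it has
    no isolated points. *)
Lemma limit_points : exists U : set R[i], [/\ U !=set0,
  forall u (e : R), U u -> 0 < e -> exists2 u', U u' & u' != u /\ cmod (u' - u) < e &
  forall u, U u -> [/\ complex.Im u < - kappa, complex.Im (lim u) < 0 &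
    Cint P (fun t => res (lim u) (s * F t)) = u^-1]].
Proof.
have [A [B [A0 B0 hG]]] := free_stable_resolvent s0 FE.
have a00 : 0 < a0 by have := a0_gt1; lra.
have sa : s `^ a0 = p ord0.
  by rewrite /s -powRrM mulVf ?gt_eqF // powRr1 // (ltW (p_gt0 _)).
pose U : set R[i] := [set u | trunc_cone A B (- ((s^-1)%:C * u)) /\ complex.Im u < - kappa].
have sn : s%:C != 0 :> R[i] by rewrite realC_eq0 gt_eqF.
have uE u : s%:C * - (- ((s^-1)%:C * u)) = u.
  by rewrite opprK mulrA realCV divff // mul1r.
have k0 : 0 < kappa.
  by have : 0 <= \sum_(i < k.+1) p i by [apply: sumr_ge0 => i _; exact: ltW];
    rewrite /kappa; lra.
exists U; split.
- pose y := s * (B + 1) + kappa + 1.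
  have sB0 : 0 < s * (B + 1) by rewrite mulr_gt0 // addr_gt0.
  have y0 : 0 < y by rewrite /y; lra.
  exists (0 -i* y); split; last first.
    by rewrite /= ltrN2 /y; lra.
  have zE : - ((s^-1)%:C * (0 -i* y)) = 0 +i* (s^-1 * y).
    by apply: eqC; rewrite /=; ring.
  have sy0 : 0 < s^-1 * y by rewrite mulr_gt0 ?invr_gt0.
  rewrite zE; split=> //=; first by rewrite normr0 mulr_gt0.
  rewrite /cmod /= expr0n add0r sqrtr_sqr gtr0_norm // ltr_pdivlMl //.
  rewrite /y mulrDr mulr1; move: k0; move: (kappa) => q q0.
  by rewrite -!addrA ltrDl (addr_gt0 s0 (addr_gt0 q0 ltr01)).
- move=> u e [[u1 u2 u3] u4] e0.
  have un : 0 < cmod u.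
    rewrite cmod_gt0; apply/eqP => u0; move: u4; rewrite u0 /=; lra.
  pose h := e / (2 * cmod u); have h0 : 0 < h by rewrite divr_gt0 // mulr_gt0.
  have h1 : 0 < 1 + h by rewrite addr_gt0.
  exists ((1 + h)%:C * u).
    set z := - _ in u1 u2 u3.
    have zE : - ((s^-1)%:C * ((1 + h)%:C * u)) = (1 + h)%:C * z by rewrite /z; ring.
    split; last first.
      rewrite ImM /= mul0r addr0; nra.
    rewrite zE; split; rewrite ?ImM ?ReM /= ?mul0r ?addr0 ?subr0.
    + by rewrite mulr_gt0.
    + by rewrite normrM gtr0_norm // mulrCA ltr_pM2l.
    + rewrite cmodM cmod_real gtr0_norm //; have := cmod_ge0 z; nra.
  have dE : (1 + h)%:C * u - u = h%:C * u by rewrite realCD; ring.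
  split.
    rewrite -subr_eq0 dE mulf_neq0 -?cmod_gt0 //.
    by rewrite cmod_real gtr0_norm.
  rewrite dE cmodM cmod_real gtr0_norm // /h.
  have -> : e / (2 * cmod u) * cmod u = e / 2 by field; rewrite gt_eqF.
  lra.
- move=> u [zc uk]; have := hG _ zc; rewrite uE /= sa => -[h1 h2].
  by split.
Qed.

(** The points [slope_lim u] and their conjugates form a set without isolated
    points: [slope_lim] is continuous, and injective on the parameters since
    the resolvent of the limit law at [slope_lim u] is [1 / u]. *)
Lemma law_cvg (f : R -> R) (K : R) : continuous f -> (forall x, `|f x| <= K) ->
  forall e : R, 0 < e -> \forall h \near 0^'+,
    `|\int[rho (h `^ a0)]_x f (ln x / h) - \int[P]_t f (s * F t)| < e.
Proof.
move=> fc fK.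
have [U [[u0 Uu0] Up UE]] := limit_points.
have [M hM] := defect_real.
pose rho' h := rho (h `^ a0).
have c0 : 0 <= c.
  have /andP[b0 b1] := beta01.
  by rewrite subr_ge0 -invr1 lef_pV2 ?posrE // ltW.
have al_lt i : i != ord0 -> alpha i < a0.
  by move=> i0; apply: alpha_dec; rewrite lt0n.
have al1 i : 1 < alpha i by have /andP[] := alpha12 i.
have p0 i : 0 <= p i by exact: ltW.
have rpos h : 0 < h -> on_pos (rho' h) by move=> h0; exact: (rhoE (powR_gt0 _ h0)).1.
have rM h x : 0 < h -> x < M ->
    defect c (h `^ a0) (fun i => alpha i - 1) p (rho' h) x%:C = 0.
  by move=> h0 xM; apply: hM => //; exact: powR_gt0.
have conv u : U u -> clim (fun h => Cint (rho' h) (fun x => res (lim u) (ln x / h)))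
    (Cint P (fun t => res (lim u) (s * F t))).
  move=> /UE[uk vk ->].
  exact: (resolvent_cvg c0 a0_gt1 (erefl a0) al_lt al1 p0 rpos rM uk vk).
pose W : set R[i] := [set w | (exists2 u, U u & w = lim u) \/
  (exists2 u, U u & w = (lim u)^*)].
have Imlim u : U u -> complex.Im (lim u) != 0 by move=> /UE[_ h _]; rewrite lt_eqF.
have mF : measurable_fun setT (fun t => s * F t).
  by apply: measurable_funM; [exact: measurable_cst|exact: measurable_funPT].
have lim_inj u u' : U u -> U u' -> lim u = lim u' -> u = u'.
  move=> Uu Uu' e; have [_ _ h1] := UE _ Uu; have [_ _ h2] := UE _ Uu'.
  by apply: invr_inj; rewrite -h1 -h2 e.
have perf u (e : R) : U u -> 0 < e ->
    exists2 u', U u' & lim u' != lim u /\ cmod (lim u' - lim u) < e.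
  move=> Uu e0; have su : slit u.
    apply: slitP; left; have [h _ _] := UE _ Uu.
    have k0 : 0 <= \sum_(i < k.+1) p i by exact: sumr_ge0.
    by rewrite lt_eqF // (lt_trans h) // /kappa oppr_lt0 ltr_wpDr.
  have hl : hol2 lim u.
    apply: hol2D; first exact: hol2_id.
    apply: hol2M; first exact: hol2_cst.
    apply: hol2_cexpf; apply: hol2M; first exact: hol2_cst.
    exact: hol2_clog.
  have [L [r [r0 L0 hL]]] := hol2_lip hl.
  have L1 : 0 < L + 1 by rewrite ltr_wpDl.
  have m0 : 0 < Num.min r (e / (L + 1)) by rewrite lt_min r0 divr_gt0.
  have [u' Uu' [u'u]] := Up _ _ Uu m0.
  rewrite lt_min => /andP[ur ue]; exists u' => //; split.
    by apply: contra u'u => /eqP /lim_inj -> //.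
  have := hL _ ur; rewrite subrKC => /le_lt_trans; apply.
  rewrite ltr_pdivlMr // in ue; apply: le_lt_trans ue.
  by rewrite mulrC ler_wpM2l ?cmod_ge0 // lerDl.
have Wp : nonreal_perfect W.
  split=> [w [[u Uu ->]|[u Uu ->]]|w e].
  - exact: Imlim.
  - by case: (lim u) (Imlim u Uu) => x y /=; rewrite oppr_eq0.
  - move=> [[u Uu ->]|[u Uu ->]] e0; have [u' Uu' [h1 h2]] := perf _ _ Uu e0.
      by exists (lim u') => //; left; exists u'.
    exists (lim u')^*; first by right; exists u'.
    rewrite -rmorphB cmodJ; split => //.
    by apply: contra h1 => /eqP /(congr1 conjc); rewrite !conjcK => ->.
have Wv : W (lim u0) by left; exists u0.
have Wvc : W (lim u0)^* by right; exists u0.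
have Wcvg w : W w -> clim (fun h => Cint (rho' h) (fun x => res w (ln x / h)))
    (Cint P (fun t => res w (s * F t))).
  move=> [[u Uu ->]|[u Uu ->]]; first exact: conv.
  have bY : cbounded (fun t => res (lim u) (s * F t)).
    exact: (cbounded_comp mF (cbounded_res (Imlim u Uu))).
  have -> : (fun t => res (lim u)^* (s * F t)) = (fun t => (res (lim u) (s * F t))^*).
    by apply/funext => t; rewrite resJ.
  rewrite CintJ // => e e0; near=> h.
  have -> : (fun x : R => res (lim u)^* (ln x / h)) =
      (fun x => (res (lim u) (ln x / h))^*).
    by apply/funext => t; rewrite resJ.
  rewrite CintJ; last exact: (cbounded_resolvent h (Imlim u Uu)).
  rewrite -rmorphB cmodJ; near: h; exact: conv.
exact: (@cvg_bounded_continuous R rho' d T P (fun t => s * F t) mF W (lim u0)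
  Wp Wv Wvc Wcvg f K fc fK).
Unshelve. all: by end_near. Qed.

End main.

Theorem corollary4p15 (R : realType) (beta : R) (k : nat)
    (alpha p : 'I_k.+1 -> R)
    (bbeta : probability R R) (nu nup : 'I_k.+1 -> probability R R)
    (nu_alpha_p bnu : probability R R) (rho : R -> probability R R)
    (d : measure_display) (T : measurableType d) (P : probability T R)
    (F : {RV P >-> R})
    (beta01 : 0 < beta < 1)
    (alpha12 : forall i, 1 < alpha i <= 2)
    (alpha_dec : forall i j : 'I_k.+1, (i < j)%N -> alpha j < alpha i)
    (p_gt0 : forall i, 0 < p i)
    (bbetaE : is_boolean_stable beta bbeta)
    (nuE : forall i, is_nu_law (alpha i) (nu i))
    (nupE : forall i, is_mfpow (nu i) (p i) (nup i))
    (nu_alpha_pE : is_mfprod nup nu_alpha_p)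
    (bnuE : is_mfconv bbeta nu_alpha_p bnu)
    (rhoE : forall t : R, 0 < t -> is_mfpow bnu t (rho t))
    (FE : is_free_stable (alpha ord0) (distribution P F)) :
  weak_cvg (fun t => pow_law (rho t) (t `^ (- (alpha ord0)^-1))) 0^'+
    (distribution P (exp_scale (p ord0 `^ (alpha ord0)^-1) \o F)).
Proof.
move=> f fc [K fK]; set a0 := alpha ord0; set s := p ord0 `^ a0^-1.
have a0_gt1 : 1 < a0 by have /andP[] := alpha12 ord0.
have a00 : 0 < a0 by lra.
pose g x := f (expR x).
have gc : continuous g.
  by move=> x; apply: (@continuous_comp _ _ _ expR f); [exact: continuous_expR|exact: fc].
have gK x : `|g x| <= K by exact: fK.
have mf := continuous_measurable_fun fc.
have -> : \int[distribution P (exp_scale s \o F)]_x f x = \int[P]_t g (s * F t).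
  by rewrite (Rintegral_distribution _ mf fK).
apply/cvgrPdist_lt => e e0.
have [r /= r0 hr] := @law_cvg R k beta alpha p bbeta nu nup nu_alpha_p bnu rho beta01
  bbetaE nuE nupE nu_alpha_pE bnuE rhoE alpha12 alpha_dec p_gt0 d T P F FE g K gc gK e e0.
near=> t; have t0 : 0 < t by near: t; exact: near0_gt0.
have : t `^ a0^-1 < r by near: t; apply: powR_near0 => //; rewrite invr_gt0.
set h := t `^ a0^-1 => hlt; have h0 : 0 < h by exact: powR_gt0.
have ht : h `^ a0 = t by rewrite /h -powRrM mulVf ?powRr1 ?ltW // gt_eqF.
have := hr h; rewrite /ball_ /= sub0r normrN gtr0_norm // => /(_ hlt h0).
rewrite -/a0 ht distrC; congr (`|_ - _| < _).
rewrite /pow_law (Rintegral_distribution _ mf fK).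
have [tpos _] := rhoE t t0.
apply: (@eq_Rintegral_full R _ _ (rho t) `]0, +oo[%classic) => //.
- apply: measurableT_comp; first exact: continuous_measurable_fun gc.
  by apply: measurable_funM; [exact: measurable_ln|exact: measurable_cst].
- by apply: measurableT_comp => //; exact: measurable_powR.
- move=> x /=; rewrite in_itv /= andbT => x0.
  rewrite /g /power_map [x `^ _]/powR gt_eqF // powRN -/h mulrC //.
Unshelve. all: by end_near. Qed.
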